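(* Let $\mathcal{L}$ be a lattice in $\mathbb{R}^d$, $d\ge 1$, and let $\mathbf{p}=\{p_i,i\in\mathcal{L}\}$ be a strictly stationary random field in $\mathbb{R}^d$ with almost surely bounded perturbations (i.e. $|p_0|\le M$ almost surely for some constant $M<\infty$). If $$\sum_{i\in\mathcal{L}}\alpha_{1,1}(|i|)<\infty,$$ where $\alpha_{1,1}$ is the strong mixing coefficient of $\mathbf{p}$, then the corresponding perturbed lattice $\Xi=\sum_{i\in\mathcal{L}}\delta_{i+p_i+U}$ is class-I hyperuniform.
   Context: A lattice $\mathcal{L}\subset\mathbb{R}^d$ is the set of all integer linear combinations of a basis $(a_1,\dots,a_d)$ of $\mathbb{R}^d$; its fundamental domain is $\mathcal{D}=\{\sum_{j=1}^d t_ja_j:\ (t_1,\dots,t_d)\in[0,1)^d\}$. $|\cdot|$ is the Euclidean norm, $\lambda^d$ is Lebesgue measure, and $B_r$ is the closed Euclidean ball of radius $r$ centered at $0$. A random field $\{p_i,i\in\mathcal{L}\}$ of $\mathbb{R}^d$-valued random vectors is strictly stationary if $\{p_i,i\in\Lambda\}$ and $\{p_{i+j},i\in\Lambda\}$ have the same distribution for all $\Lambda\subset\mathcal{L}$ and $j\in\mathcal{L}$. The corresponding perturbed lattice is the stationary random counting measure $\Xi=\sum_{i\in\mathcal{L}}\delta_{i+p_i+U}$, where $U$ is uniformly distributed on $\mathcal{D}$ and independent of $\mathbf{p}$. Mixing coefficients: for two sub-$\sigma$-fields $\mathcal{A}_1,\mathcal{A}_2$, $\alpha(\mathcal{A}_1,\mathcal{A}_2)=\sup\{|\mathbb{P}(A\cap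 B)-\mathbb{P}(A)\mathbb{P}(B)|:\ A\in\mathcal{A}_1,\ B\in\mathcal{A}_2\}$. For $C\subset\mathcal{L}$, $\sigma(p_C)$ is the $\sigma$-field generated by $\{p_i,i\in C\}$. For $n\geq 0$, $$\alpha_{1,1}(n)=\sup\{\alpha(\sigma(p_A),\sigma(p_B)):\ A,B\subset\mathcal{L},\ |A|\le 1,\ |B|\le 1,\ d_{\mathcal{L}}(A,B)\ge n\},$$ where here $|A|,|B|$ denote cardinalities and $d_{\mathcal{L}}(A,B)=\inf\{|i-j|:\ i\in A,\ j\in B\}$. A stationary point process $\mu$ on $\mathbb{R}^d$ is class-I hyperuniform if $\mathrm{Var}(\mu(B_r))/\lambda^d(B_r)=O(r^{-1})$ as $r\to\infty$, i.e. $\mathrm{Var}(\mu(B_r))=O(r^{d-1})$. *)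

(* Defs.v *)
From mathcomp Require Export all_boot all_order all_algebra.
From mathcomp Require Export all_classical all_reals all_analysis.
Export Order.TTheory GRing.Theory Num.Theory numFieldNormedType.Exports.

Set Implicit Arguments.
Unset Strict Implicit.
Unset Printing Implicit Defensive.

Local Open Scope classical_set_scope.
Local Open Scope ring_scope.

(* R^d with its Borel sigma-algebra. *)
Notation borel_rV R d := (g_sigma_algebraType (@open 'rV[R]_d)).

(* The norm that the library puts on 'rV[R]_d is the sup norm. *)
Definition enorm (R : realType) (d : nat) (x : 'rV[R]_d) : R :=
  Num.sqrt (\sum_(j < d) x 0 j ^+ 2).

Definition eball (R : realType) (d : nat) (r : R) : set 'rV[R]_d :=
  [set x | enorm x <= r].
Arguments eball {R} d r.

(* Lebesgue measure on R^d as the d-fold product of the Lebesgue measure on R,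
   written as an iterated integral: the measure of A is the integral over the
   first coordinate of the measure of the corresponding section of A. *)
Fixpoint lebesgue_rV (R : realType) (d : nat) : set 'rV[R]_d -> \bar R :=
  match d return set 'rV[R]_d -> \bar R with
  | 0 => fun A => (\1_A (0 : 'rV[R]_0))%:E
  | d'.+1 => fun A =>
      \int[@lebesgue_measure R]_x
        lebesgue_rV [set v : 'rV[R]_d' | A (row_mx (x : R)%:M v)]
  end%E.

Definition lattice (R : realType) (d : nat) (a : d.-tuple 'rV[R]_d) :
    set 'rV[R]_d :=
  [set \sum_(j < d) (z j)%:~R *: tnth a j | z in [set: 'I_d -> int]].

Definition fundamental_domain (R : realType) (d : nat)
    (a : d.-tuple 'rV[R]_d) : set 'rV[R]_d :=
  [set \sum_(j < d) t j *: tnth a j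
     | t in [set t : 'I_d -> R | forall j, 0 <= t j < 1]].

(* sigma(X_i, i in C) *)
Definition sigma_field (R : realType) (d : nat) (I T : Type)
    (X : I -> T -> borel_rV R d) (C : set I) : set (set T) :=
  <<s \bigcup_(i in C) preimage_set_system [set: T] (X i) measurable >>.

(* {X_i, i in Lam} and {X_{i+j}, i in Lam} have the same distribution for all
   Lam included in L and j in L.  Their laws are compared on the product
   sigma-algebra, generated by the coordinate maps of index in Lam; the sets it
   contains only depend on these coordinates. *)
Definition strictly_stationary (R : realType) (d : nat) (dT : measure_display)
    (T : measurableType dT) (P : probability T R) (L : set 'rV[R]_d)
    (X : 'rV[R]_d -> T -> borel_rV R d) : Prop :=
  forall (Lam : set 'rV[R]_d) (j : 'rV[R]_d), Lam `<=` L -> L j ->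
  forall E : set ('rV[R]_d -> borel_rV R d),
    sigma_field (fun i x => x i) Lam E ->
    P [set w | E (fun i => X i w)] = P [set w | E (fun i => X (i + j) w)].

Definition independent_fields (R : realType) (dT : measure_display)
    (T : measurableType dT) (P : probability T R) (A1 A2 : set (set T)) : Prop :=
  forall A B : set T, A1 A -> A2 B -> P (A `&` B) = (P A * P B)%E.

Definition uniform_on (R : realType) (d : nat) (dT : measure_display)
    (T : measurableType dT) (P : probability T R) (U : T -> borel_rV R d)
    (D : set 'rV[R]_d) : Prop :=
  forall A : set (borel_rV R d), measurable A ->
    P (U @^-1` A) = (lebesgue_rV (A `&` D) / lebesgue_rV D)%E.

Definition strong_mixing (R : realType) (dT : measure_display)
    (T : measurableType dT) (P : probability T R) (A1 A2 : set (set T)) :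
    \bar R :=
  ereal_sup [set `|P (A `&` B) - P A * P B|%E | A in A1 & B in A2].

Definition set_dist (R : realType) (d : nat) (A B : set 'rV[R]_d) : \bar R :=
  ereal_inf [set (enorm (i - j))%:E | i in A & j in B].

(* The index n ranges over the reals since it is applied to norms |i|. *)
Definition alpha11 (R : realType) (d : nat) (dT : measure_display)
    (T : measurableType dT) (P : probability T R) (L : set 'rV[R]_d)
    (X : 'rV[R]_d -> T -> borel_rV R d) (n : R) : \bar R :=
  ereal_sup [set x | exists A B : set 'rV[R]_d,
    [/\ A `<=` L, B `<=` L, (A #<= `I_1)%card, (B #<= `I_1)%card &
        (n%:E <= set_dist A B)%E] /\
    x = strong_mixing P (sigma_field X A) (sigma_field X B)].

Definition perturbed_lattice (R : realType) (d : nat) (T : Type)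
    (L : set 'rV[R]_d) (p : 'rV[R]_d -> T -> borel_rV R d)
    (U : T -> borel_rV R d) (w : T) (A : set 'rV[R]_d) : \bar R :=
  \esum_(i in L) \d_((i + p i w + U w : 'rV[R]_d) : borel_rV R d) A.

(* The first clause (almost sure finiteness on bounded sets) is part of the
   notion of point process; it makes [fine] harmless in the second one, which is
   Var(mu(B_r)) / lambda^d(B_r) = O(1/r).  Stationarity of mu is not required:
   the property is meant for a mu which is stationary by construction. *)
Definition class_I_hyperuniform (R : realType) (d : nat) (dT : measure_display)
    (T : measurableType dT) (P : probability T R)
    (mu : T -> set 'rV[R]_d -> \bar R) : Prop :=
  {ae P, forall w, forall r : R, (mu w (eball d r) < +oo)%E} /\
  exists K : R, \forall r \near +oo,
    ('V_P[fun w => fine (mu w (eball d r))] / lebesgue_rV (eball d r)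
       <= (K / r)%:E)%E.

(* Main.v *)
(* Write N(x) for the number of lattice points i with i + x in B_r, nu for the
   uniform law on the cell, and decompose the variance given U.

   Conditionally on U = u, Var = sum over i, j of the covariances of the events
   {i + p_i + u in B_r}.  Since the perturbations are bounded, these events are
   trivial unless i lies in a shell of bounded width around the sphere of
   radius r, and a covariance is at most alpha_{1,1}(|i - j|).  A shell contains
   O(r^{d-1}) lattice points, so the conditional variance is O(r^{d-1}).

   By stationarity the conditional mean is E N(u + p_0), so by Jensen,
   Fubini and the periodicity of N its variance in u is at most Var_nu(N).
   The Fourier coefficient of N at the dual frequency k is the Fourier transform
   of the ball, i.e. r^d y(r|k|) up to a constant, where y is a Bessel-type
   integral; it solves y'' + (d+1)/x y' + y = 0, and an energy estimate gives
   y(x)^2 = O(x^{-(d+1)}).  Hence |N^(k)|^2 <= C r^{d-1} |k|^{-(d+1)}, which is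
   summable over k != 0.  Parseval's inequality is replaced by averaging the
   increments of N against a Fejer kernel. *)

Require Import Defs.
From HB Require Import structures.
From mathcomp Require Import ring lra zify measurable_realfun.

Set Implicit Arguments.
Unset Strict Implicit.
Unset Printing Implicit Defensive.

Local Open Scope classical_set_scope.
Local Open Scope ring_scope.

(** * Lebesgue measure on R^d *)

(** Why a Fejer kernel: for a periodic G of mean zero, the average over y of cos(k.y) E(G(x) - G(x +
    y))^2 is an explicit expression in |G^(k)|^2. Averaging over all k = m - m' with m, m' in {0,
    ..., n-1}^d gives an exact identity: E G^2 is a Fejer average of the |G^(k)|^2 plus half the
    Fejer average of the squared increments of G. As n grows the kernel concentrates on the lattice,
    where the increments are small because thin shells have small volume, so the second term
    disappears. No completeness of the trigonometric system is required, and the first term is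
    bounded row by row in m, uniformly in n. Lebesgue measure is given as an iterated integral, from
    which invariance under rotations is not visible. It comes from uniqueness of
    translation-invariant measures up to a factor. Changes of variables and exchanges of sums are
    done for nonnegative integrands; this is why Fourier coefficients appear through 1 + cos and 1 +
    sin. *)

Definition dyadic_cube (R : realType) n (N : nat) (z : 'I_n -> int) :
    set 'rV[R]_n :=
  [set x | forall j, (z j)%:~R <= 2 ^+ N * x 0 j < (z j)%:~R + 1].
Arguments dyadic_cube {R n} N z.

Lemma dyadic_cube_mem (R : realType) n N (x : 'rV[R]_n) :
  dyadic_cube N (fun j => Num.floor (2 ^+ N * x 0 j)) x.
Proof.
move=> j; rewrite ge_floor/=.
by have := floorD1_gt (2 ^+ N * x 0 j); rewrite intrD1.
Qed.

Lemma dyadic_cube_uniq (R : realType) n N (y z : 'I_n -> int) (x : 'rV[R]_n) :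
  dyadic_cube N y x -> dyadic_cube N z x -> y = z.
Proof.
move=> xy xz; apply/funext => j.
have F (w : 'I_n -> int) : dyadic_cube N w x -> Num.floor (2 ^+ N * x 0 j) = w j.
  by move=> /(_ j) xw; apply: floor_def; rewrite intrD1.
by rewrite -(F y) // -(F z).
Qed.

(** Inclusion of cubes at two scales is a comparison of integers: after scaling by [2 ^+ (M - N)],
    the strict inequalities at the common point [x] become weak inequalities between integer end
    points. *)
Lemma dyadic_cube_nested (R : realType) n N M (y z : 'I_n -> int) (x : 'rV[R]_n) :
  (N <= M)%N -> dyadic_cube N z x -> dyadic_cube M y x ->
  @dyadic_cube R n M y `<=` dyadic_cube N z.
Proof.
move=> NM xz xy x' x'y j.
have k0 : 0 < 2 ^+ (M - N) :> R by rewrite exprn_gt0.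
have E u : 2 ^+ M * u = 2 ^+ (M - N) * (2 ^+ N * u) :> R.
  by rewrite mulrA -exprD subnK.
have /andP[z1 z2] := xz j; have /andP[y1 y2] := xy j.
have /andP[y1' y2'] := x'y j.
move: y1 y2 y1' y2'; rewrite !E => y1 y2 y1' y2'.
have I (w : int) : (w * 2 ^+ (M - N))%:~R = 2 ^+ (M - N) * w%:~R :> R.
  by rewrite intrM rmorphXn mulrC.
have zy : z j * 2 ^+ (M - N) <= y j.
  rewrite -ltzD1 -(ltr_int R) I intrD.
  by apply: le_lt_trans y2; rewrite ler_wpM2l// ltW.
have yz : y j + 1 <= (z j + 1) * 2 ^+ (M - N).
  rewrite lezD1 -(ltr_int R) I intrD.
  by apply: le_lt_trans y1 _; rewrite ltr_pM2l.
move: zy yz; rewrite -(ler_int R) -[in X in _ -> X](ler_int R).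
rewrite !I !intrD => zy yz.
apply/andP; split.
  by rewrite -(ler_pM2l k0) (le_trans zy).
by rewrite -(ltr_pM2l k0) (lt_le_trans y2').
Qed.

(** Positions are finite functions into [int], a countable type, so every open set is a countable
    union of cubes. *)
Lemma open_dyadic (R : realType) n (O : set 'rV[R]_n) : open O ->
  O = \bigcup_(k in [set k : nat * {ffun 'I_n -> int} |
        dyadic_cube k.1 k.2 `<=` O]) dyadic_cube k.1 k.2.
Proof.
move=> oO; apply/seteqP; split => [x Ox|x [k]]; last exact.
have := oO; rewrite openE => /(_ _ Ox) /nbhs_ballP[e /= e0 xeO].
have [N Ne] : exists N, (2 ^+ N)^-1 < e.
  have [N _ NP] := near_infty_natSinv_lt (PosNum e0).
  exists N; apply: le_lt_trans (NP N (leqnn N)) => /=.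
  rewrite lef_pV2 ?posrE ?exprn_gt0// -natrX ler_nat.
  exact: ltn_expl.
exists (N, [ffun j => Num.floor (2 ^+ N * x 0 j)]); last first.
  by move=> j /=; rewrite ffunE; exact: dyadic_cube_mem.
move=> y /= yz; apply: xeO; split=> // i j; rewrite ord1.
have := yz j; rewrite ffunE => /andP[y1 y2].
have /andP[x1 x2] := dyadic_cube_mem N x j.
have k0 : 0 < 2 ^+ N :> R by rewrite exprn_gt0.
rewrite /ball/= (lt_trans _ Ne)// -(ltr_pM2l k0) mulfV ?gt_eqF//.
rewrite -[X in X * _]gtr0_norm// -normrM ltr_norml mulrBr.
by lra.
Qed.

Section borel.
Variable R : realType.

Lemma measurable_dyadic n N (z : 'I_n -> int) d (T : measurableType d)
    (f : T -> 'rV[R]_n) :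
  (forall j, measurable_fun setT (fun w => f w 0 j)) ->
  measurable (f @^-1` dyadic_cube N z).
Proof.
move=> mf.
have -> : f @^-1` dyadic_cube N z = \bigcap_(j in [set: 'I_n])
    ((fun w => 2 ^+ N * f w 0 j) @^-1` `[(z j)%:~R, (z j)%:~R + 1[%classic).
  apply/seteqP; split => w /=.
    by move=> + j _; move=> /(_ j); rewrite /= in_itv.
  by move=> + j; move=> /(_ j I); rewrite /= in_itv.
apply: fin_bigcap_measurable => // j _.
rewrite -[X in measurable X]setTI.
have : measurable_fun setT (fun w => 2 ^+ N * f w 0 j).
  exact: measurable_funM.
by apply => //; exact: measurable_itv.
Qed.

(** Passes from coordinates to the Borel sets of ['rV[R]_n], which are generated by open sets and
    not by products; countability in [open_dyadic] is what allows it. *)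
Lemma measurable_rV n d (T : measurableType d) (f : T -> borel_rV R n) :
  (forall j, measurable_fun setT (fun w => (f w : 'rV[R]_n) 0 j)) ->
  measurable_fun setT f.
Proof.
move=> mf; apply: (measurability _ (erefl (@measurable _ (borel_rV R n)))) => //.
move=> _ [B oB <-]; rewrite setTI (open_dyadic oB) preimage_bigcup.
rewrite bigcup_mkcond; apply: countable_bigcupT_measurable => //.
by move=> k; case: ifP => // _; exact: measurable_dyadic.
Qed.

Lemma open_measurable_rV n (O : set 'rV[R]_n) : open O ->
  measurable (O : set (borel_rV R n)).
Proof. by move=> oO; exact: sub_sigma_algebra. Qed.

Lemma continuous_measurable_rV n (f : 'rV[R]_n -> R) : continuous f ->
  measurable_fun setT (f : borel_rV R n -> R).
Proof.
move=> cf; apply: (measurability _ (RGenOpens.measurableE R)) => //.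
move=> _ [_ [x [y ->]] <-]; rewrite setTI; apply: open_measurable_rV.
by move/continuousP : cf; apply; exact: interval_open.
Qed.
End borel.

Section image_measure.
Context d d' (T1 : measurableType d) (T2 : measurableType d') (R : realType).

Lemma image_measure (m : {measure set T1 -> \bar R}) (f : T1 -> T2) :
  measurable_fun setT f ->
  exists m' : {measure set T2 -> \bar R}, forall A, m' A = m (f @^-1` A).
Proof. by move=> mf; unshelve eexists (pushforward m f). Qed.

Lemma sigma_finite_product (m1 : {sigma_finite_measure set T1 -> \bar R})
    (m2 : {sigma_finite_measure set T2 -> \bar R}) :
  sigma_finite setT (m1 \x m2)%E.
Proof.
have /sigma_finiteP[F [FT ndF Foo]] := sigma_finiteT m1.
have /sigma_finiteP[G [GT ndG Goo]] := sigma_finiteT m2.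
exists (fun n => F n `*` G n).
  apply/seteqP; split => [[x y] _|//].
  have [i _ Fx] : (\bigcup_i F i) x by rewrite -FT.
  have [j _ Gy] : (\bigcup_i G i) y by rewrite -GT.
  exists (maxn i j) => //; split.
    by move: Fx; apply/subsetPset/ndF/leq_maxl.
  by move: Gy; apply/subsetPset/ndG/leq_maxr.
move=> k; have [mF Fk] := Foo k; have [mG Gk] := Goo k.
split; first exact: measurableX.
by rewrite product_measure1E// lte_mul_pinfty// ge0_fin_numE.
Qed.

Section sigma_finite_measure_of.
Variables (m : {measure set T2 -> \bar R}) (sf : sigma_finite setT m).
Let m0 : set T2 -> \bar R := m.
HB.instance Definition _ := Measure.on m0.
HB.instance Definition _ := Measure_isSigmaFinite.Build _ _ _ m0 sf.
Definition sigma_finite_measure_of : {sigma_finite_measure set T2 -> \bar R} := m0.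
End sigma_finite_measure_of.

End image_measure.

Section rV_cons.
Variable R : realType.

Lemma measurable_coord n (j : 'I_n) :
  measurable_fun setT (fun x : borel_rV R n => (x : 'rV[R]_n) 0 j).
Proof. by apply: continuous_measurable_rV => x; exact: coord_continuous. Qed.

Definition rV_cons n (x : measurableTypeR R * borel_rV R n) : borel_rV R n.+1 :=
  row_mx (x.1 : R)%:M (x.2 : 'rV[R]_n).

Definition rV_uncons n (x : borel_rV R n.+1) : measurableTypeR R * borel_rV R n :=
  ((x : 'rV[R]_n.+1) 0 0, rsubmx (x : 'rV[R]_(1 + n))).

Lemma rV_consK n : cancel (@rV_cons n) (@rV_uncons n).
Proof.
move=> [x v]; rewrite /rV_uncons /rV_cons/= row_mxKr; congr pair.
have -> : 0 = lshift n (0 : 'I_1) :> 'I_(1 + n) by exact: val_inj.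
by rewrite (@row_mxEl _ 1 1 n) mxE eqxx mulr1n.
Qed.

Lemma measurable_rV_cons n : measurable_fun setT (@rV_cons n).
Proof.
apply: measurable_rV => j.
case: (@split_ordP 1 n j) => k ->.
  under eq_fun do rewrite /rV_cons (@row_mxEl _ 1 1 n) ord1 mxE eqxx mulr1n.
  exact: measurable_fst.
under eq_fun do rewrite /rV_cons (@row_mxEr _ 1 1 n).
by apply: (measurableT_comp (measurable_coord k)); exact: measurable_snd.
Qed.

Lemma measurable_rV_consr n x : measurable_fun setT (fun v => @rV_cons n (x, v)).
Proof.
apply: measurableT_comp; first exact: measurable_rV_cons.
by apply: measurable_fun_pair.
Qed.

Lemma measurable_rV_uncons n : measurable_fun setT (@rV_uncons n).
Proof.
apply: measurable_fun_pair; first exact: measurable_coord.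
apply: measurable_rV => j; under eq_fun do rewrite mxE.
exact: measurable_coord.
Qed.

(** [lebesgue_rV] is only a set function; additivity comes from a measure that agrees with it on
    Borel sets. In the inductive step this is the image of a product measure under [rV_cons], and
    sigma-finiteness is carried along because the next product requires it. *)
Lemma lebesgue_rV_measure n :
  exists m : {sigma_finite_measure set (borel_rV R n) -> \bar R},
    forall A, measurable A -> m A = lebesgue_rV A.
Proof.
elim: n => [|n [m mE]].
  by exists (\d_(0 : borel_rV R 0)) => A mA /=; rewrite diracE.
have [m1 m1E] := image_measure (@lebesgue_measure R \x m)%E (@measurable_rV_cons n).
have sf : sigma_finite setT m1.
  have [F FT Foo] : sigma_finite setT (@lebesgue_measure R \x m)%E.
    exact: sigma_finite_product.
  exists (fun k => @rV_uncons n @^-1` F k).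
    by rewrite -preimage_bigcup -FT preimage_setT.
  move=> k; have [mF Fk] := Foo k; split.
    by rewrite -[X in measurable X]setTI; exact: measurable_rV_uncons.
  rewrite m1E -comp_preimage.
  rewrite (_ : rV_uncons (n:=n) \o rV_cons (n:=n) = id) ?preimage_id//.
  by apply/funext => x; exact: rV_consK.
exists (sigma_finite_measure_of sf) => A mA; rewrite [LHS]m1E /= /product_measure1.
apply: eq_integral => x _ /=; rewrite -mE.
  by congr (m _); apply/seteqP; split => v; rewrite /xsection /= inE.
rewrite -[X in measurable X]setTI; apply: (measurable_rV_consr x) => //.
Qed.

End rV_cons.

Section leb.
Variable R : realType.

Definition leb n : {sigma_finite_measure set (borel_rV R n) -> \bar R} :=
  projT1 (cid (@lebesgue_rV_measure R n)).

Lemma lebE n (A : set (borel_rV R n)) : measurable A -> leb n A = lebesgue_rV A.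
Proof. exact: (projT2 (cid (@lebesgue_rV_measure R n))). Qed.

Lemma lebesgue_rV_set0 n : lebesgue_rV (set0 : set 'rV[R]_n) = 0%E.
Proof. by rewrite -lebE ?measure0//; exact: measurable0. Qed.

Definition box n (a b : 'I_n -> R) : set 'rV[R]_n :=
  [set x | forall j, a j <= x 0 j < b j].

Lemma lebesgue_rV_box n (a b : 'I_n -> R) : (forall j, a j <= b j) ->
  lebesgue_rV (box a b) = (\prod_j (b j - a j))%:E.
Proof.
elim: n a b => [|n IH] a b ab /=.
  by rewrite big_ord0 indicE mem_set// => -[].
rewrite big_ord_recl /=.
pose a' := fun j : 'I_n => a (rshift 1 j); pose b' := fun j : 'I_n => b (rshift 1 j).
transitivity (\int[@lebesgue_measure R]_(x in `[a 0%R, b 0%R[)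
    (\prod_j (b' j - a' j))%:E)%E.
  rewrite [RHS]integral_mkcond; apply: eq_integral => x _ /=.
  rewrite patchE; case: ifPn => xab.
    rewrite -IH => [|j]; last exact: ab.
    congr lebesgue_rV; apply/seteqP; split => v /= H.
      by move=> j; have := H (rshift 1 j); rewrite (@row_mxEr _ 1 1 n).
    move=> j; case: (@split_ordP 1 n j) => k ->.
      rewrite (@row_mxEl _ 1 1 n) ord1 mxE eqxx mulr1n.
      have -> : lshift n (0 : 'I_1) = 0 :> 'I_(1 + n) by exact: val_inj.
      by move: xab; rewrite inE /= in_itv.
    by rewrite (@row_mxEr _ 1 1 n); exact: H.
  rewrite (_ : [set v | _] = set0) ?lebesgue_rV_set0//.
  apply/seteqP; split => // v /= /(_ (lshift n (0 : 'I_1))).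
  rewrite (@row_mxEl _ 1 1 n) mxE eqxx mulr1n.
  have -> : lshift n (0 : 'I_1) = 0 :> 'I_(1 + n) by exact: val_inj.
  by move=> xab'; move: xab; rewrite notin_setE /= in_itv.
have -> : \prod_(i < n) (b (lift ord0 i) - a (lift ord0 i)) =
    \prod_(i < n) (b' i - a' i).
  apply: eq_bigr => i _; rewrite /a' /b'.
  by have -> : lift ord0 i = rshift 1 i :> 'I_(1 + n) by exact: val_inj.
rewrite integral_cst//= lebesgue_measure_itv/= lte_fin.
case: ltP => ba; first by rewrite -EFinD -EFinM mulrC.
have -> : b ord0 = a 0 by apply/eqP; rewrite eq_le ba ab.
by rewrite subrr mul0r mule0.
Qed.

Lemma measurable_box n (a b : 'I_n -> R) : measurable (box a b : set (borel_rV R n)).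
Proof.
rewrite (_ : box a b = \bigcap_(j in [set: 'I_n])
    ((fun x : borel_rV R n => (x : 'rV[R]_n) 0 j) @^-1` `[a j, b j[%classic)).
  apply: fin_bigcap_measurable => // j _.
  rewrite -[X in measurable X]setTI; apply: (@measurable_coord R n j) => //.
apply/seteqP; split => x /=.
  by move=> H j _ /=; rewrite in_itv; exact: H.
by move=> H j; have := H j I; rewrite /= in_itv.
Qed.

Lemma leb_box n (a b : 'I_n -> R) : (forall j, a j <= b j) ->
  leb n (box a b) = (\prod_j (b j - a j))%:E.
Proof. by move=> ab; rewrite lebE ?lebesgue_rV_box//; exact: measurable_box. Qed.

Lemma dyadic_cube_box n N (z : 'I_n -> int) : dyadic_cube N z =
  box (fun j => (z j)%:~R / 2 ^+ N) (fun j => ((z j)%:~R + 1) / 2 ^+ N).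
Proof.
have k0 : 0 < 2 ^+ N :> R by rewrite exprn_gt0.
apply/seteqP; split => x H j; have := H j.
  by rewrite ler_pdivrMr// ltr_pdivlMr// mulrC.
by rewrite ler_pdivrMr// ltr_pdivlMr// mulrC.
Qed.

(** Uniqueness on a pi-system: two dyadic cubes are disjoint or nested, so together with the empty
    set they are stable under intersection, and the unit cubes form a countable cover by sets of
    finite measure. *)
Lemma measure_eq_dyadic n (m1 m2 : {measure set (borel_rV R n) -> \bar R}) :
  (forall N z, m1 (dyadic_cube N z) = m2 (dyadic_cube N z)) ->
  (forall z, m1 (dyadic_cube 0 z) < +oo)%E ->
  forall A, measurable A -> m1 A = m2 A.
Proof.
move=> m12 m1oo.
pose G : set (set (borel_rV R n)) :=
  [set C | C = set0 \/ exists N z, C = dyadic_cube N z].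
(* Enumerates the unit cubes; a number that encodes no position falls back on the cube at the
   origin, which is harmless in a cover. *)
pose g (k : nat) : set (borel_rV R n) :=
  dyadic_cube 0 (if @unpickle {ffun 'I_n -> int} k is Some z then z
                 else fun=> 0).
apply: (@measure_unique _ R _ G g).
- apply/seteqP; split.
    apply: smallest_sub => [|B oB]; first exact: smallest_sigma_algebra.
    rewrite (open_dyadic oB) bigcup_mkcond.
    apply: (@countable_bigcupT_measurable _ (g_sigma_algebraType G)) => // k.
    case: ifP => _; last exact: measurable0.
    by apply: sub_sigma_algebra; right; exists k.1, k.2.
  apply: smallest_sub; first exact: sigma_algebra_measurable.
  move=> _ [->|[N [z ->]]]; first exact: measurable0.
  by rewrite dyadic_cube_box; exact: measurable_box.
- move=> A B [->|[N [z ->]]]; first by rewrite set0I; left.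
  case=> [->|[M [y ->]]]; first by rewrite setI0; left.
  have [[x [xz xy]]|] := pselect (exists x : 'rV[R]_n, dyadic_cube N z x /\ dyadic_cube M y x); last first.
    move=> H; left; apply/seteqP; split => // x [xz xy].
    by apply: H; exists x.
  right; case: (leqP N M) => [NM|/ltnW MN].
    exists M, y; apply/setIidr; exact: dyadic_cube_nested xz xy.
  exists N, z; apply/setIidl; exact: dyadic_cube_nested xy xz.
- by move=> k; right; rewrite /g; eexists; eexists; reflexivity.
- apply/seteqP; split => // x _.
  exists (pickle [ffun j => Num.floor (2 ^+ 0 * (x : 'rV[R]_n) 0 j)]) => //.
  rewrite /g pickleK => j; rewrite ffunE; exact: dyadic_cube_mem.
- by move=> A [->|[N [z ->]]//]; rewrite !measure0.
- by move=> k; rewrite /g.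
Qed.

Lemma measurable_shift n (y : 'rV[R]_n) :
  measurable_fun setT (fun x : borel_rV R n => (x + y : 'rV[R]_n) : borel_rV R n).
Proof.
apply: measurable_rV => j; under eq_fun do rewrite mxE.
by apply: measurable_funD => //; exact: measurable_coord.
Qed.

Lemma measurable_mulmx n k (G : 'M[R]_(n, k)) :
  measurable_fun setT (fun x : borel_rV R n => ((x : 'rV[R]_n) *m G) : borel_rV R k).
Proof.
apply: measurable_rV => j; under eq_fun do rewrite mxE.
by apply: measurable_sum => i; apply: measurable_funM => //; exact: measurable_coord.
Qed.

Lemma leb_shift n (y : 'rV[R]_n) (A : set (borel_rV R n)) : measurable A ->
  leb n [set x | A ((x : 'rV[R]_n) + y)] = leb n A.
Proof.
move=> mA; have [m1 m1E] := image_measure (leb n) (measurable_shift y).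
have m1D N z : m1 (dyadic_cube N z) = leb n (dyadic_cube N z).
  rewrite m1E !dyadic_cube_box leb_box; last first.
    by move=> j; rewrite ler_pM2r ?invr_gt0 ?exprn_gt0// lerDl.
  rewrite (_ : _ @^-1` _ = box (fun j => (z j)%:~R / 2 ^+ N - y 0 j)
      (fun j => ((z j)%:~R + 1) / 2 ^+ N - y 0 j)); last first.
    apply/seteqP; split => x H j; have := H j; rewrite mxE.
      by rewrite lerBlDr ltrBrDr.
    by rewrite lerBlDr ltrBrDr.
  rewrite leb_box; last first.
    by move=> j; rewrite lerD2r ler_pM2r ?invr_gt0 ?exprn_gt0// lerDl.
  by congr EFin; apply: eq_bigr => j _; ring.
rewrite -(m1E A); apply: measure_eq_dyadic => // z.
rewrite m1D dyadic_cube_box leb_box ?ltry// => j.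
by rewrite ler_pM2r ?invr_gt0 ?exprn_gt0// lerDl.
Qed.

Definition shift_invariant n (m : {measure set (borel_rV R n) -> \bar R}) :=
  forall (y : 'rV[R]_n) (A : set (borel_rV R n)), measurable A ->
    m [set x | A ((x : 'rV[R]_n) + y)] = m A.

Lemma measurable_dyadic_cube n N z :
  measurable (dyadic_cube N z : set (borel_rV R n)).
Proof. by rewrite dyadic_cube_box; exact: measurable_box. Qed.

(** The unit cube is a disjoint union of [(2 ^ N) ^ n] translates of any cube of level [N], so
    invariance determines the measure of the latter. *)
Lemma shift_invariant_dyadic n (m : {measure set (borel_rV R n) -> \bar R}) N z :
  shift_invariant m ->
  m (dyadic_cube 0 (fun=> 0)) = (((2 ^ N) ^ n)%:R%:E * m (dyadic_cube N z))%E.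
Proof.
move=> mS.
pose F (e : {ffun 'I_n -> 'I_(2 ^ N)}) : set (borel_rV R n) :=
  dyadic_cube N (fun j => Posz (e j)).
have k0 : 0 < 2 ^+ N :> R by rewrite exprn_gt0.
have mF e : m (F e) = m (dyadic_cube N z).
  rewrite -(mS (\row_j (((e j : nat)%:~R - (z j)%:~R) / 2 ^+ N))); last first.
    exact: measurable_dyadic_cube.
  congr (m _); apply/seteqP; split => x H j; have := H j; rewrite /= !mxE.
    by rewrite mulrDr [2 ^+ N * (_ / _)]mulrC divfK ?gt_eqF// => ?; lra.
  by rewrite mulrDr [2 ^+ N * (_ / _)]mulrC divfK ?gt_eqF// => ?; lra.
have -> : dyadic_cube 0 (fun=> 0) = \bigcup_(e in [set: {ffun 'I_n -> 'I_(2 ^ N)}]) F e.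
  apply/seteqP; split => x /=.
    move=> H.
    pose f j := Num.floor (2 ^+ N * x 0 j).
    have f0 j : 0 <= f j.
      have := H j; rewrite expr0 mul1r => /andP[x0 _].
      by rewrite floor_ge0 mulr_ge0// ltW.
    have fN j : (absz (f j) < 2 ^ N)%N.
      have := H j; rewrite expr0 mul1r add0r => /andP[_ x1].
      rewrite -ltz_nat gez0_abs// -(ltr_int R).
      rewrite (le_lt_trans (ge_floor _))// -[ltRHS]/((2 ^ N)%:R) natrX -[ltRHS]mulr1.
      by rewrite ltr_pM2l.
    exists [ffun j => Ordinal (fN j)] => // j; rewrite ffunE/= gez0_abs//.
    exact: dyadic_cube_mem.
  move=> [e _ H] j; have := H j; rewrite expr0 mul1r add0r => /andP[x0 x1].
  have e0 : 0 <= (Posz (e j))%:~R :> R by rewrite ler0z.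
  apply/andP; split.
    by rewrite -(pmulr_rge0 _ k0) (le_trans e0).
  rewrite -(ltr_pM2l k0) mulr1 (lt_le_trans x1)//.
  by rewrite -natrX -[leLHS]/((e j)%:R + 1) natr1 ler_nat.
rewrite measure_fin_bigcup//=; last 2 first.
- by apply/trivIsetP => e e' _ _ ee'; apply/seteqP; split => // x [/= xe xe'];
    case/eqP: ee'; apply/ffunP => j; have := dyadic_cube_uniq xe xe';
    move=> /(congr1 (fun f => f j)) [] /val_inj.
- by move=> e _; exact: measurable_dyadic_cube.
rewrite (eq_fsbigr (fun=> m (dyadic_cube N z))); last by move=> e _; exact: mF.
rewrite (fsbigE (enum {: {ffun 'I_n -> 'I_(2 ^ N)}})) ?enum_uniq//; last first.
  by move=> i _; rewrite mem_enum.
rewrite big_enum_cond/= (eq_bigl xpredT); last by move=> i; rewrite in_setT.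
by rewrite sumr_const card_ffun !card_ord mule_natl.
Qed.

(** Cancels the finite factor [k] in [\bar R], where the measures [x] and [y] of a small cube are
    not yet known to be finite. *)
Lemma ediv_unique (k c : R) (x y : \bar R) : 0 < k ->
  (c%:E = k%:E * x -> 1 = k%:E * y -> x = c%:E * y)%E.
Proof.
move=> k0; have kK (z : \bar R) : z = (k^-1%:E * (k%:E * z))%E.
  by rewrite muleA -EFinM mulVf ?gt_eqF// mul1e.
by move=> cE oE; rewrite [LHS]kK [in RHS](kK y) -cE -oE mule1 -!EFinM mulrC.
Qed.

(** This takes the place of the linear change of variables formula: a linear image of Lebesgue
    measure is invariant, so one test set determines its factor. *)
Lemma shift_invariant_unique n (m : {measure set (borel_rV R n) -> \bar R}) (c : R) :
  0 <= c -> shift_invariant m -> m (dyadic_cube 0 (fun=> 0)) = c%:E ->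
  forall A, measurable A -> m A = (c%:E * leb n A)%E.
Proof.
move=> c0 mS m1 A mA.
have lebS : shift_invariant (leb n) by move=> y B; exact: leb_shift.
have leb1 : leb n (dyadic_cube 0 (fun=> 0)) = 1%E.
  rewrite dyadic_cube_box leb_box; last first.
    by move=> j; rewrite ler_pM2r ?invr_gt0 ?exprn_gt0// lerDl.
  by rewrite big1// => j _; rewrite expr0 add0r mul0r subr0 divr1.
rewrite -[RHS]/(mscale (NngNum c0) (leb n) A); move: A mA.
apply: measure_eq_dyadic => [N z|z].
  rewrite -[RHS]/(c%:E * leb n (dyadic_cube N z))%E.
  have k0 : 0 < ((2 ^ N) ^ n)%:R :> R by rewrite ltr0n !expn_gt0.
  have := shift_invariant_dyadic N z lebS; rewrite leb1.
  have := shift_invariant_dyadic N z mS; rewrite m1.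
  exact: ediv_unique.
have := shift_invariant_dyadic 0 z mS; rewrite expn0 exp1n mul1e m1 => <-.
by rewrite ltry.
Qed.

Lemma leb_bounded n (A : set (borel_rV R n)) K : measurable A ->
  (forall x, A x -> forall j, `|(x : 'rV[R]_n) 0 j| <= K) -> (leb n A < +oo)%E.
Proof.
move=> mA AK.
apply: (@le_lt_trans _ _ (leb n (box (fun=> - `|K|) (fun=> `|K| + 1)))).
  apply: le_measure; rewrite ?inE//; first exact: measurable_box.
  move=> x /AK xK j; have := xK j; rewrite ler_norml => /andP[x1 x2].
  have K1 := ler_norm K.
  by apply/andP; split; lra.
by rewrite leb_box ?ltry// => j; have := normr_ge0 K; lra.
Qed.

(** No determinant is computed: [c] is the measure of the preimage of the unit cube, finite because
    [invmx G] maps that cube to a bounded set. It is identified later on a set adapted to [G]. *)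
Lemma leb_mulmx n (G : 'M[R]_n) : G \in unitmx -> exists2 c : R, 0 <= c &
  forall A, measurable A ->
    leb n [set x | A ((x : 'rV[R]_n) *m G : borel_rV R n)] = (c%:E * leb n A)%E.
Proof.
move=> uG; have [m mE] := image_measure (leb n) (measurable_mulmx G).
pose D : set (borel_rV R n) := dyadic_cube 0 (fun=> 0).
have mD : (m (D) < +oo)%E.
  rewrite mE; apply: (@leb_bounded _ _ (\sum_i \sum_j `|invmx G i j|)).
    rewrite -[X in measurable X]setTI; apply: measurable_mulmx => //.
    exact: measurable_dyadic_cube.
  move=> x /= xG j.
  have -> : (x : 'rV_n) 0 j = \sum_i ((x : 'rV_n) *m G) 0 i * invmx G i j.
    by rewrite -{1}(mulmxK uG x) mxE.
  apply: le_trans (ler_norm_sum _ _ _) _; apply: ler_sum => i _.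
  rewrite (bigD1 j)//= normrM -[leLHS]addr0 lerD ?sumr_ge0//.
  rewrite -[leRHS]mul1r ler_wpM2r//.
  have := xG i; rewrite expr0 mul1r add0r => /andP[x0 x1].
  by rewrite ger0_norm ?(ltW x1).
have mS : shift_invariant m.
  move=> y A mA; rewrite !mE -[RHS](leb_shift (y *m invmx G)); last first.
    by rewrite -[X in measurable X]setTI; apply: measurable_mulmx.
  congr (leb n _); apply/seteqP; split => x /=; rewrite mulmxDl mulmxKV//.
exists (fine (m D)); first exact: fine_ge0.
move=> A mA; rewrite -[LHS](mE A); apply: shift_invariant_unique => //.
by rewrite fineK// ge0_fin_numE.
Qed.

End leb.

(** * The Euclidean norm and balls *)

Section enorm.
Variables (R : realType) (n : nat).
Implicit Types x y : 'rV[R]_n.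

Definition dot x y : R := \sum_j x 0 j * y 0 j.

Lemma dotE x y : dot x y = (x *m y^T) 0 0.
Proof. by rewrite mxE; apply: eq_bigr => j _; rewrite mxE. Qed.

Lemma dotC x y : dot x y = dot y x.
Proof. by apply: eq_bigr => j _; rewrite mulrC. Qed.

Lemma dotDl x y z : dot (x + y) z = dot x z + dot y z.
Proof. by rewrite -big_split; apply: eq_bigr => j _; rewrite mxE mulrDl. Qed.

Lemma dotZl a x y : dot (a *: x) y = a * dot x y.
Proof. by rewrite mulr_sumr; apply: eq_bigr => j _; rewrite mxE mulrA. Qed.

Lemma dotDr x y z : dot z (x + y) = dot z x + dot z y.
Proof. by rewrite !(dotC z) dotDl. Qed.

Lemma dotZr a x y : dot y (a *: x) = a * dot y x.
Proof. by rewrite !(dotC y) dotZl. Qed.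

Lemma dot_ge0 x : 0 <= dot x x.
Proof. by apply: sumr_ge0 => j _; rewrite -expr2 sqr_ge0. Qed.

Lemma enorm_sqr x : enorm x ^+ 2 = dot x x.
Proof. by rewrite sqr_sqrtr ?sumr_ge0// => j _; rewrite sqr_ge0. Qed.

Lemma enorm_ge0 x : 0 <= enorm x.
Proof. exact: sqrtr_ge0. Qed.

Lemma dot_eq0 x : (dot x x == 0) = (x == 0).
Proof.
apply/idP/eqP => [|->]; last first.
  by rewrite /dot big1// => j _; rewrite mxE mul0r.
rewrite psumr_eq0 => [/allP H|j _]; last by rewrite -expr2 sqr_ge0.
apply/rowP => j; rewrite mxE; apply/eqP.
by have := H j (mem_index_enum j); rewrite -expr2 sqrf_eq0.
Qed.

Lemma enorm_eq0 x : (enorm x == 0) = (x == 0).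
Proof. by rewrite -dot_eq0 -enorm_sqr sqrf_eq0. Qed.

Lemma enorm0 : enorm (0 : 'rV[R]_n) = 0.
Proof. by apply/eqP; rewrite enorm_eq0. Qed.

Lemma enormN x : enorm (- x) = enorm x.
Proof. by congr Num.sqrt; apply: eq_bigr => j _; rewrite mxE sqrrN. Qed.

Lemma enormZ a x : enorm (a *: x) = `|a| * enorm x.
Proof.
apply/eqP; rewrite -(@eqrXn2 _ 2)// ?mulr_ge0 ?enorm_ge0//.
by rewrite exprMn !enorm_sqr dotZl dotZr real_normK ?num_real// mulrA.
Qed.

Lemma dot_le x y : dot x y <= enorm x * enorm y.
Proof.
have [->|x0] := eqVneq x 0.
  by rewrite enorm0 mul0r -(scale0r 0) dotZl mul0r.
have e0 : 0 < dot x x by rewrite lt_def dot_eq0 x0 dot_ge0.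
apply: le_trans (ler_norm _) _.
rewrite -(@ler_pXn2r _ 2) ?nnegrE ?mulr_ge0 ?enorm_ge0//.
rewrite real_normK ?num_real// exprMn !enorm_sqr.
(* Cauchy-Schwarz: this vector is [dot x x] times the component of [y] orthogonal to [x]. *)
have := dot_ge0 (dot x x *: y - dot x y *: x).
rewrite !(dotDl, dotDr, dotZl, dotZr, =^~ scaleNr).
rewrite -(pmulr_rge0 _ e0) (dotC y x) => ?; rewrite -subr_ge0.
rewrite -(pmulr_rge0 _ e0) -(pmulr_rge0 _ e0); nra.
Qed.

Lemma enormD x y : enorm (x + y) <= enorm x + enorm y.
Proof.
rewrite -(@ler_pXn2r _ 2) ?nnegrE ?addr_ge0 ?enorm_ge0//.
rewrite sqrrD !enorm_sqr dotDl !dotDr (dotC y x).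
by have := dot_le x y; lra.
Qed.

Lemma enormB x y : enorm (x - y) <= enorm x + enorm y.
Proof. by rewrite -(enormN y) enormD. Qed.

Lemma enormDl x y : enorm x - enorm y <= enorm (x + y).
Proof. by have := enormB (x + y) y; rewrite addrK; lra. Qed.

Lemma enorm_coord x j : `|x 0 j| <= enorm x.
Proof.
rewrite -(@ler_pXn2r _ 2) ?nnegrE ?enorm_ge0// enorm_sqr real_normK ?num_real//.
by rewrite /dot (bigD1 j)//= -expr2 lerDl sumr_ge0// => i _; rewrite -expr2 sqr_ge0.
Qed.

Lemma enorm_le_sum x : enorm x <= \sum_j `|x 0 j|.
Proof.
rewrite -(@ler_pXn2r _ 2) ?nnegrE ?enorm_ge0 ?sumr_ge0// enorm_sqr.
rewrite expr2 mulr_suml; apply: ler_sum => j _.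
rewrite -expr2 -real_normK ?num_real// expr2 ler_wpM2l//.
by rewrite (bigD1 j)//= lerDl sumr_ge0.
Qed.

Lemma measurable_enorm : measurable_fun setT (fun x : borel_rV R n => enorm (x : 'rV[R]_n)).
Proof.
apply: (@measurableT_comp _ _ _ _ _ _ (@Num.sqrt R)).
  by apply: continuous_measurable_fun; exact: sqrt_continuous.
apply: measurable_sum => j; apply: measurable_funX.
exact: measurable_coord.
Qed.

Lemma measurable_eball r : measurable (eball n r : set (borel_rV R n)).
Proof.
rewrite -[X in measurable X]setTI.
rewrite (_ : eball n r = (fun x : borel_rV R n => enorm (x : 'rV[R]_n)) @^-1` `]-oo, r]%classic).
  exact: measurable_enorm.
by apply/seteqP; split => x; rewrite /= in_itv.
Qed.

Lemma leb_eball_lty r : (leb R n (eball n r) < +oo)%E.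
Proof.
apply: (@leb_bounded _ _ _ r); first exact: measurable_eball.
by move=> x xr j; exact: le_trans (enorm_coord _ _) xr.
Qed.

Lemma leb_eball_gt0 r : 0 < r -> (0 < leb R n (eball n r))%E.
Proof.
(* Points of the box of side [e] have l1 norm at most [n * e], hence lie in the ball; [n.+1] also
   covers dimension 0. *)
move=> r0; pose e := r / n.+1%:R.
have e0 : 0 < e by rewrite divr_gt0.
apply: (@lt_le_trans _ _ (leb R n (box (fun=> 0) (fun=> e)))).
  rewrite leb_box => [|j]; last exact: ltW.
  by rewrite lte_fin prodr_gt0// => j _; rewrite subr0.
apply: le_measure; rewrite ?inE; [exact: measurable_box|exact: measurable_eball|].
move=> x xe; apply: le_trans (enorm_le_sum _) _.
apply: (@le_trans _ _ (\sum_(j < n) e)).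
  by apply: ler_sum => j _; have /andP[x0 x1] := xe j; rewrite ger0_norm// ltW.
rewrite sumr_const card_ord -mulr_natl mulrA ler_pdivrMr// mulrC ler_pM2l// ler_nat.
exact: leqnSn.
Qed.

Lemma enorm_mulmx (G : 'M[R]_n) x : G *m G^T = 1%:M -> enorm (x *m G) = enorm x.
Proof.
move=> GG; apply/eqP; rewrite -(@eqrXn2 _ 2)// ?enorm_ge0//.
by rewrite !enorm_sqr !dotE trmx_mul mulmxA -(mulmxA x) GG mulmx1.
Qed.

(** The unit ball is invariant under [G] and has positive finite measure, so the factor of
    [leb_mulmx] must be 1. *)
Lemma leb_orthogonal (G : 'M[R]_n) (A : set (borel_rV R n)) :
  G *m G^T = 1%:M -> measurable A ->
  leb R n [set x | A ((x : 'rV[R]_n) *m G : borel_rV R n)] = leb R n A.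
Proof.
move=> GG mA; have [uG _] := mulmx1_unit GG.
have [c c0 cE] := leb_mulmx uG; rewrite cE//.
suff -> : c = 1 by rewrite mul1e.
have := cE _ (measurable_eball 1).
rewrite (_ : [set x | _] = eball n 1); last first.
  by apply/seteqP; split => x; rewrite /eball/= enorm_mulmx.
have := leb_eball_lty 1; have := @leb_eball_gt0 1 ltr01.
case: (leb _ _ _) => // b; rewrite lte_fin => b0 _ [] bE.
by apply: (mulIf (lt0r_neq0 b0)); rewrite -bE mul1r.
Qed.

Lemma leb_opp (A : set (borel_rV R n)) : measurable A ->
  leb R n [set x | A (- (x : 'rV[R]_n) : borel_rV R n)] = leb R n A.
Proof.
move=> mA; rewrite -[RHS](@leb_orthogonal (- 1%:M))//.
  by congr (leb R n _); apply/seteqP; split => x; rewrite /= mulmxN mulmx1.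
by rewrite linearN/= trmx1 mulmxN mulNmx opprK mulmx1.
Qed.

Lemma leb_scale s (A : set (borel_rV R n)) : 0 < s -> measurable A ->
  leb R n [set x | A (s *: (x : 'rV[R]_n) : borel_rV R n)] = ((s ^- n)%:E * leb R n A)%E.
Proof.
move=> s0 mA.
have uG : (s%:M : 'M[R]_n) \in unitmx.
  by rewrite unitmxE det_scalar unitrX// unitfE gt_eqF.
have [c c0 cE] := leb_mulmx uG.
have -> : [set x | A (s *: (x : 'rV[R]_n) : borel_rV R n)] =
    [set x | A ((x : 'rV[R]_n) *m s%:M : borel_rV R n)].
  by apply/seteqP; split => x; rewrite /= mul_mx_scalar.
rewrite cE//; congr (_%:E * _)%E.
have := cE _ (measurable_box (fun=> 0) (fun=> 1)).
rewrite (_ : [set x | _] = box (fun=> 0) (fun=> s^-1)); last first.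
  apply/seteqP; split => x /= H j; have := H j.
    by rewrite mul_mx_scalar mxE pmulr_rge0// -ltr_pdivlMl// mulr1.
  by rewrite mul_mx_scalar mxE pmulr_rge0// -ltr_pdivlMl// mulr1.
rewrite !leb_box => [|j|j]; rewrite ?invr_ge0 ?ltW//.
rewrite !subr0 !prodr_const !card_ord expr1n mule1 exprVn => -[].
by [].
Qed.

Lemma leb_eball r : 0 < r ->
  leb R n (eball n r) = ((r ^+ n)%:E * leb R n (eball n 1))%E.
Proof.
move=> r0; have rV : 0 < r^-1 by rewrite invr_gt0.
have := leb_scale rV (measurable_eball 1); rewrite exprVn invrK => <-.
congr (leb R n _); apply/seteqP; split => x; rewrite /eball/= enormZ gtr0_norm//.
  by rewrite ler_pdivrMl// mulr1.
by rewrite ler_pdivrMl// mulr1.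
Qed.

(* Householder reflection *)
Lemma ex_rotation (k : 'rV[R]_n) (i : 'I_n) : exists2 G : 'M[R]_n,
  G *m G^T = 1%:M & forall x, dot x k = enorm k * (x *m G) 0 i.
Proof.
pose e : 'rV[R]_n := enorm k *: delta_mx 0 i.
pose v := k - e.
have dotd x : dot x (delta_mx 0 i) = x 0 i.
  rewrite /dot (bigD1 i)//= big1 => [|j ji]; first by rewrite mxE !eqxx mulr1 addr0.
  by rewrite mxE (negbTE ji) andbF mulr0.
have dote x : dot x e = enorm k * x 0 i by rewrite dotZr dotd.
(* The reflection across the hyperplane orthogonal to [v = k - e] exchanges [k] and [e]; if [v = 0],
   then [k] is already on the axis and the identity does. *)
have [v0|v0] := eqVneq v 0.
  exists 1%:M => [|x]; first by rewrite trmx1 mulmx1.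
  by rewrite mulmx1 -dote; congr dot; apply/eqP; rewrite -subr_eq0 -/v v0.
have vv0 : dot v v != 0 by rewrite dot_eq0.
pose G : 'M[R]_n := 1%:M - (2 / dot v v) *: (v^T *m v).
have xG x : x *m G = x - (2 * dot x v / dot v v) *: v.
  rewrite mulmxBr mulmx1 -scalemxAr mulmxA [x *m v^T]mx11_scalar -dotE mul_scalar_mx.
  by rewrite scalerA; congr (_ - _ *: _); rewrite mulrAC.
have GT : G^T = G by rewrite linearB linearZ/= trmx1 trmx_mul trmxK.
exists G.
  apply/row_matrixP => j; rewrite GT !rowE mulmxA mulmx1.
  move: (delta_mx 0 j) => x; rewrite !xG dotDl -scaleNr dotZl.
  rewrite -addrA -scalerBl -[RHS]addr0; congr (_ + _).
  apply/eqP; rewrite scaler_eq0; apply/orP; left; apply/eqP; field.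
  exact: vv0.
move=> x.
have ee : dot e e = dot k k by rewrite dote !mxE !eqxx mulr1 -expr2 enorm_sqr.
(* Since [e] and [k] have the same length, the coefficient of [v] in the reflection of [k] is 1. *)
have vvE : dot v v = 2 * dot k v.
  rewrite /v; move: (e) ee => f ff.
  rewrite !(dotDl, dotDr) -scaleN1r !(dotZl, dotZr) ff (dotC f k); ring.
have kG : k *m G = e.
  rewrite xG -vvE divff// scale1r /v; apply/eqP; rewrite subr_eq addrC subrK//.
rewrite -dote -kG !dotE trmx_mul GT mulmxA -(mulmxA x).
have -> : G *m G = 1%:M.
  apply/row_matrixP => j; rewrite !rowE mulmxA mulmx1.
  move: (delta_mx 0 j) => y; rewrite !xG dotDl -scaleNr dotZl.
  rewrite -addrA -scalerBl -[RHS]addr0; congr (_ + _).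
  apply/eqP; rewrite scaler_eq0; apply/orP; left; apply/eqP; field.
  exact: vv0.
by rewrite mulmx1.
Qed.

End enorm.

(** * Expectations of bounded measurable functions *)

(** This class is closed under the algebra used below and is integrable for every probability, so
    integrability conditions reduce to closure lemmas. *)
Definition bmeas d (T : measurableType d) (R : realType) (f : T -> R) :=
  measurable_fun setT f /\ exists M, forall x, `|f x| <= M.

Section bmeas.
Context d (T : measurableType d) (R : realType).
Implicit Types f g : T -> R.

Lemma bmeas_cst (c : R) : bmeas (fun _ : T => c).
Proof. by split; [exact: measurable_cst|exists `|c|]. Qed.

Lemma bmeasD f g : bmeas f -> bmeas g -> bmeas (fun x => f x + g x).
Proof.
move=> [mf [M fM]] [mg [N gN]]; split; first exact: measurable_funD.
by exists (M + N) => x; rewrite (le_trans (ler_normD _ _))// lerD.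
Qed.

Lemma bmeasM f g : bmeas f -> bmeas g -> bmeas (fun x => f x * g x).
Proof.
move=> [mf [M fM]] [mg [N gN]]; split; first exact: measurable_funM.
by exists (M * N) => x; rewrite normrM ler_pM.
Qed.

Lemma bmeasN f : bmeas f -> bmeas (fun x => - f x).
Proof.
move=> [mf [M fM]]; split; first exact: measurableT_comp.
by exists M => x; rewrite normrN.
Qed.

Lemma bmeasB f g : bmeas f -> bmeas g -> bmeas (fun x => f x - g x).
Proof. by move=> bf bg; apply: bmeasD => //; exact: bmeasN. Qed.

Lemma bmeasZ (c : R) f : bmeas f -> bmeas (fun x => c * f x).
Proof. by move=> bf; apply: bmeasM => //; exact: bmeas_cst. Qed.

Lemma bmeasX f n : bmeas f -> bmeas (fun x => f x ^+ n).
Proof.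
move=> [mf [M fM]]; split; first exact: measurable_funX.
by exists (M ^+ n) => x; rewrite normrX lerXn2r ?nnegrE// (le_trans _ (fM x)).
Qed.

Lemma bmeas_sum (I : Type) (s : seq I) (P : pred I) (F : I -> T -> R) :
  (forall i, bmeas (F i)) -> bmeas (fun x => \sum_(i <- s | P i) F i x).
Proof.
move=> bF; elim: s => [|i s IH].
  by under eq_fun do rewrite big_nil; exact: bmeas_cst.
under eq_fun do rewrite big_cons; case: (P i) => //.
exact: bmeasD.
Qed.

Lemma bmeas_indic (A : set T) : measurable A -> bmeas (\1_A : T -> R).
Proof.
move=> mA; split; first exact: measurable_indic.
by exists 1 => x; rewrite indicE; case: (_ \in _); rewrite ?normr1 ?normr0.
Qed.

Lemma bmeas_comp d' (T' : measurableType d') (h : T' -> T) f :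
  measurable_fun setT h -> bmeas f -> bmeas (f \o h).
Proof.
by move=> mh [mf [M fM]]; split; [exact: measurableT_comp|exists M => x /=].
Qed.

Variable P : probability T R.

Lemma Ex_setT : P [set: T] = 1%E. Proof. exact: probability_setT. Qed.

Lemma bmeas_integrable f : bmeas f -> P.-integrable setT (EFin \o f).
Proof.
move=> [mf [M fM]]; apply: measurable_bounded_integrable => //.
  by rewrite ltey_eq fin_num_measure.
exists M; split; first exact: num_real.
by move=> x Mx y _ /=; exact: le_trans (fM y) (ltW Mx).
Qed.

Definition Ex f : R := \int[P]_x f x.

Lemma ExE f : bmeas f -> (\int[P]_x (f x)%:E)%E = (Ex f)%:E.
Proof.
move=> bf; rewrite /Ex /Rintegral fineK//.
exact: (integrable_fin_num _ (bmeas_integrable bf)).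
Qed.

Lemma eq_Ex f g : f =1 g -> Ex f = Ex g.
Proof. by move=> fg; congr Ex; exact/funext. Qed.

Lemma Ex_cst c : Ex (fun=> c) = c.
Proof. by rewrite /Ex Rintegral_cst//= Ex_setT mulr1. Qed.

Lemma integral_prob_cst c : (\int[P]_x c%:E)%E = c%:E.
Proof. by rewrite (ExE (bmeas_cst c)) Ex_cst. Qed.

Lemma ExD f g : bmeas f -> bmeas g -> Ex (fun x => f x + g x) = Ex f + Ex g.
Proof. by move=> bf bg; apply: RintegralD => //; exact: bmeas_integrable. Qed.

Lemma ExB f g : bmeas f -> bmeas g -> Ex (fun x => f x - g x) = Ex f - Ex g.
Proof. by move=> bf bg; apply: RintegralB => //; exact: bmeas_integrable. Qed.

Lemma ExZ c f : bmeas f -> Ex (fun x => c * f x) = c * Ex f.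
Proof. by move=> bf; apply: RintegralZl => //; exact: bmeas_integrable. Qed.

Lemma Ex_sum (I : Type) (s : seq I) (Q : pred I) (F : I -> T -> R) :
  (forall i, bmeas (F i)) ->
  Ex (fun x => \sum_(i <- s | Q i) F i x) = \sum_(i <- s | Q i) Ex (F i).
Proof.
move=> bF; elim: s => [|i s IH].
  by under eq_Ex do rewrite big_nil; rewrite big_nil Ex_cst.
under eq_Ex do rewrite big_cons; rewrite big_cons; case: (Q i) => //.
by rewrite ExD ?IH//; exact: bmeas_sum.
Qed.

Lemma le_Ex f g : bmeas f -> bmeas g -> (forall x, f x <= g x) -> Ex f <= Ex g.
Proof. by move=> bf bg fg; apply: le_Rintegral => //; exact: bmeas_integrable. Qed.

Lemma Ex_ge0 f : (forall x, 0 <= f x) -> 0 <= Ex f.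
Proof. by move=> f0; apply: Rintegral_ge0. Qed.

Lemma le_norm_Ex f : bmeas f -> `|Ex f| <= Ex (fun x => `|f x|).
Proof. by move=> bf; apply: le_normr_Rintegral => //; exact: bmeas_integrable. Qed.

Lemma Ex_indic (A : set T) : measurable A -> (Ex (\1_A))%:E = P A.
Proof.
by move=> mA; rewrite -ExE ?integral_indic ?setIT//; exact: bmeas_indic.
Qed.

Lemma Ex_bound f M : bmeas f -> (forall x, `|f x| <= M) -> `|Ex f| <= M.
Proof.
move=> bf fM; rewrite -(Ex_cst M) (le_trans (le_norm_Ex bf))// le_Ex//.
  case: bf => mf _; split; first exact: measurableT_comp.
  by exists M => x; rewrite normr_id.
exact: bmeas_cst.
Qed.

(** Jensen for the square: in the expansion around [Ex f] the cross term has mean zero, and the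
    defect is the variance of [f]. *)
Lemma Ex_sqr_le f c : bmeas f -> (Ex f - c) ^+ 2 <= Ex (fun x => (f x - c) ^+ 2).
Proof.
move=> bf; pose e := Ex f.
have bc (a : R) : bmeas (fun x => f x - a) by apply: bmeasB => //; exact: bmeas_cst.
have : 0 <= Ex (fun x => (f x - e) ^+ 2) by apply: Ex_ge0 => x; rewrite sqr_ge0.
have -> : Ex (fun x => (f x - c) ^+ 2) =
    Ex (fun x => (f x - e) ^+ 2 + (2 * (e - c)) * (f x - e) + (e - c) ^+ 2).
  by apply: eq_Ex => x; ring.
rewrite !ExD ?Ex_cst ?ExZ//; last first.
- exact: bmeas_cst.
- by apply: bmeasD; [exact: bmeasX|exact: bmeasZ].
- exact: bmeasZ.
- exact: bmeasX.
by rewrite ExB ?Ex_cst ?subrr//; [rewrite mulr0 addr0 lerDr|exact: bmeas_cst].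
Qed.

End bmeas.

Section Ex_fubini.
Context d1 d2 (T1 : measurableType d1) (T2 : measurableType d2) (R : realType).
Variables (P1 : probability T1 R) (P2 : probability T2 R).
Variable f : T1 * T2 -> R.
Hypothesis bf : bmeas f.

Lemma bmeas_pair1 x : bmeas (fun y => f (x, y)).
Proof. by apply: (bmeas_comp (h := fun y => (x, y))) bf; exact: measurable_fun_pair. Qed.

Lemma bmeas_pair2 y : bmeas (fun x => f (x, y)).
Proof. by apply: (bmeas_comp (h := fun x => (x, y))) bf; exact: measurable_fun_pair. Qed.

Lemma bmeas_int : (P1 \x P2)%E.-integrable setT (EFin \o f).
Proof.
have [mf [M fM]] := bf; apply/integrable12ltyP.
  exact/measurable_EFinP.
apply: (@le_lt_trans _ _ (\int[P1]_x \int[P2]_y (`|M|%:E))%E).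
  apply: ge0_le_integral => //.
  - by move=> x _; exact: integral_ge0.
  - apply: (measurable_fun_fubini_tonelli_F (fun z => `|(f z)%:E|%E)) => //.
    by apply: measurableT_comp => //; exact/measurable_EFinP.
  - move=> x _; apply: ge0_le_integral => //.
    + by apply: measurableT_comp => //; apply/measurable_EFinP; case: (bmeas_pair1 x).
    + by move=> y _; rewrite lee_fin (le_trans (fM _))// ler_norm.
under eq_integral do rewrite integral_prob_cst.
by rewrite integral_prob_cst ltry.
Qed.

Lemma bmeas_Ex1 : bmeas (fun x => Ex P2 (fun y => f (x, y))).
Proof.
split.
  have := measurable_fubini_F bmeas_int.
  rewrite (_ : fubini_F _ _ = EFin \o (fun x => Ex P2 (fun y => f (x, y)))).
    by move=> H; exact/measurable_EFinP.
  by apply/funext => x; rewrite /fubini_F/= ExE//; exact: bmeas_pair1.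
have [mf [M fM]] := bf; exists M => x; apply: Ex_bound => //.
exact: bmeas_pair1.
Qed.

Lemma bmeas_Ex2 : bmeas (fun y => Ex P1 (fun x => f (x, y))).
Proof.
split.
  have := measurable_fubini_G bmeas_int.
  rewrite (_ : fubini_G _ _ = EFin \o (fun y => Ex P1 (fun x => f (x, y)))).
    by move=> H; exact/measurable_EFinP.
  by apply/funext => y; rewrite /fubini_G/= ExE//; exact: bmeas_pair2.
have [mf [M fM]] := bf; exists M => y; apply: Ex_bound => //.
exact: bmeas_pair2.
Qed.

Lemma Ex_fubini :
  Ex P1 (fun x => Ex P2 (fun y => f (x, y))) =
  Ex P2 (fun y => Ex P1 (fun x => f (x, y))).
Proof.
apply: EFin_inj; rewrite -!ExE; [|exact: bmeas_Ex2|exact: bmeas_Ex1].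
rewrite -(eq_integral _ _ (fun x _ => ExE P2 (bmeas_pair1 x))).
rewrite -[RHS](eq_integral _ _ (fun y _ => ExE P1 (bmeas_pair2 y))).
exact: (Fubini bmeas_int).
Qed.

Lemma Ex_product :
  (\int[P1 \x P2]_z (f z)%:E = (Ex P1 (fun x => Ex P2 (fun y => f (x, y))))%:E)%E.
Proof.
rewrite -ExE; last exact: bmeas_Ex1.
rewrite -(eq_integral _ _ (fun x _ => ExE P2 (bmeas_pair1 x))).
exact/esym/(integral12_prod_meas1 bmeas_int).
Qed.

End Ex_fubini.

(** * Variance of a periodic function through the Fejer kernel *)

Lemma measurable_cos (R : realType) : measurable_fun setT (@cos R).
Proof. by apply: continuous_measurable_fun; exact: continuous_cos. Qed.

Lemma measurable_sin (R : realType) : measurable_fun setT (@sin R).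
Proof. by apply: continuous_measurable_fun; exact: continuous_sin. Qed.

Lemma periodicz (R : realType) (f : R -> R) (T : R) : periodic f T ->
  forall (z : int) a, f (a + T * z%:~R) = f a.
Proof.
move=> fT [n|n] a.
  by rewrite -[_%:~R]/(n%:R) mulr_natr (periodicn fT).
by rewrite NegzE mulrNz mulrN -(periodicn fT n.+1) mulr_natr subrK.
Qed.

Section fejer.
Variables (R : realType) (d : nat) (B : 'M[R]_d).
Hypothesis uB : B \in unitmx.
Variable nu : probability (borel_rV R d) R.

(** In the application [B] is the inverse of the basis matrix, so [l *m B] gives the coordinates of
    [l] in the basis, and [l] is a period when they are integers. The hypothesis [nu_inv] below lets
    [nu] act as Haar measure on the torus. *)
Definition lattice_periodic (f : 'rV[R]_d -> R) :=
  forall x l, (forall j, exists z : int, (l *m B) 0 j = z%:~R) -> f (x + l) = f x.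

Hypothesis nu_inv : forall f : borel_rV R d -> R, bmeas f -> lattice_periodic f ->
  forall y : 'rV[R]_d, Ex nu (fun x => f ((x : 'rV[R]_d) + y)) = Ex nu f.

Definition phase (k : 'I_d -> int) (x : 'rV[R]_d) : R :=
  pi *+ 2 * \sum_j (k j)%:~R * (x *m B) 0 j.

Lemma phaseD k x y : phase k (x + y) = phase k x + phase k y.
Proof.
rewrite /phase -mulrDr -big_split; congr (_ * _); apply: eq_bigr => j _.
by rewrite mulmxDl mxE mulrDr.
Qed.

Lemma phaseN k x : phase k (- x) = - phase k x.
Proof.
rewrite /phase -mulrN -sumrN; congr (_ * _); apply: eq_bigr => j _.
by rewrite mulNmx mxE mulrN.
Qed.

Lemma phase0 k x : (forall j, k j = 0) -> phase k x = 0.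
Proof. by move=> k0; rewrite /phase big1 ?mulr0// => j _; rewrite k0 mul0r. Qed.

Lemma phase_addl k k' x : phase (fun j => k j + k' j) x = phase k x + phase k' x.
Proof.
rewrite /phase -mulrDr -big_split; congr (_ * _); apply: eq_bigr => j _.
by rewrite intrD mulrDl.
Qed.

Lemma phase_oppl k x : phase (fun j => - k j) x = - phase k x.
Proof.
rewrite /phase -mulrN -sumrN; congr (_ * _); apply: eq_bigr => j _.
by rewrite mulrNz mulNr.
Qed.

Lemma phase_int k l : (forall j, exists z : int, (l *m B) 0 j = z%:~R) ->
  exists z : int, phase k l = pi *+ 2 * z%:~R.
Proof.
move=> /choice[z lz]; exists (\sum_j k j * z j).
rewrite /phase; congr (_ * _); rewrite (big_morph _ (@intrD R) (mulr0z _)).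
by apply: eq_bigr => j _; rewrite lz intrM.
Qed.

Lemma cos_phase_periodic k : lattice_periodic (fun x => cos (phase k x)).
Proof.
move=> x l /(phase_int k)[z lz]; rewrite phaseD lz.
exact: (periodicz (@cosD2pi R)).
Qed.

Lemma sin_phase_periodic k : lattice_periodic (fun x => sin (phase k x)).
Proof.
move=> x l /(phase_int k)[z lz]; rewrite phaseD lz.
exact: (periodicz (@sinD2pi R)).
Qed.

Lemma measurable_phase k :
  measurable_fun setT (fun x : borel_rV R d => phase k (x : 'rV[R]_d)).
Proof.
apply: measurable_funM => //; apply: measurable_sum => j.
apply: measurable_funM => //.
by apply: (measurableT_comp (measurable_coord j)); exact: measurable_mulmx.
Qed.

Lemma bmeas_cos k : bmeas (fun x : borel_rV R d => cos (phase k (x : 'rV[R]_d))).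
Proof.
split; first exact: measurableT_comp (@measurable_cos R) (measurable_phase k).
by exists 1 => x; rewrite ler_norml cos_geN1 cos_le1.
Qed.

Lemma bmeas_sin k : bmeas (fun x : borel_rV R d => sin (phase k (x : 'rV[R]_d))).
Proof.
split; first exact: measurableT_comp (@measurable_sin R) (measurable_phase k).
by exists 1 => x; rewrite ler_norml sin_geN1 sin_le1.
Qed.

(** Translating by such a [y] changes the sign of the cosine and of the sine, so by invariance both
    have mean zero. *)
Lemma ex_half_period k : (exists j, k j != 0) -> exists y, phase k y = pi.
Proof.
move=> [j kj]; exists ((\row_i (if i == j then (2 * (k j)%:~R)^-1 else 0)) *m invmx B).
rewrite /phase (bigD1 j)//= big1 => [|i ij].
  rewrite mulmxKV// mxE eqxx addr0; field.
  by rewrite intr_eq0.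
by rewrite mulmxKV// mxE (negbTE ij) mulr0.
Qed.

Definition null_freq (k : 'I_d -> int) := [forall j, k j == 0].

Lemma Ex_cos k : Ex nu (fun x => cos (phase k x)) = (null_freq k)%:R.
Proof.
case: (boolP (null_freq k)) => [/forallP k0|]; last first.
  rewrite negb_forall => /existsP/ex_half_period[y ky].
  have := nu_inv (bmeas_cos k) (@cos_phase_periodic k) y.
  under eq_Ex do rewrite phaseD ky cosDpi -mulN1r.
  rewrite ExZ; last exact: bmeas_cos.
  by move=> H; have : Ex nu (fun x => cos (phase k x)) = 0 by lra.
rewrite -[RHS](Ex_cst nu); apply: eq_Ex => x.
by rewrite phase0 ?cos0// => j; apply/eqP.
Qed.

Lemma Ex_sin k : Ex nu (fun x => sin (phase k x)) = 0.
Proof.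
have [/existsP/ex_half_period[y ky]|] := boolP [exists j, k j != 0].
  have := nu_inv (bmeas_sin k) (@sin_phase_periodic k) y.
  under eq_Ex do rewrite phaseD ky sinDpi -mulN1r.
  rewrite ExZ; last exact: bmeas_sin.
  by move=> H; have : Ex nu (fun x => sin (phase k x)) = 0 by lra.
rewrite negb_exists => /forallP k0; rewrite -[RHS](Ex_cst nu).
by apply: eq_Ex => x; rewrite phase0 ?sin0// => j; have := k0 j; rewrite negbK => /eqP.
Qed.

Section variance.
Variable G : borel_rV R d -> R.
Hypothesis bG : bmeas G.
Hypothesis perG : lattice_periodic G.

(** Squared modulus of the complex Fourier coefficient of [G] at [k]. *)
Definition coef2 (k : 'I_d -> int) : R :=
  (Ex nu (fun x => G x * cos (phase k x))) ^+ 2 +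
  (Ex nu (fun x => G x * sin (phase k x))) ^+ 2.

Definition increment (y : 'rV[R]_d) : R :=
  Ex nu (fun x => (G x - G ((x : 'rV[R]_d) + y)) ^+ 2).

Lemma bmeas_G2 : bmeas (fun z : borel_rV R d * borel_rV R d =>
  (G z.1 - G ((z.1 : 'rV[R]_d) + z.2)) ^+ 2).
Proof.
apply: bmeasX; apply: bmeasB.
  by apply: (bmeas_comp (h := fst)) bG.
apply: (bmeas_comp (h := fun z : borel_rV R d * borel_rV R d =>
  ((z.1 : 'rV[R]_d) + z.2 : borel_rV R d))) bG.
apply: measurable_rV => j; under eq_fun do rewrite mxE.
by apply: measurable_funD; apply: (measurableT_comp (measurable_coord j)).
Qed.

Lemma bmeas_increment : bmeas (increment : borel_rV R d -> R).
Proof. exact: (bmeas_Ex2 nu nu bmeas_G2). Qed.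

(** The Fourier coefficient of an autocorrelation is the squared modulus of that of [G]; [increment]
    is twice the mean of [G ^+ 2] minus twice the autocorrelation. *)
Lemma Ex_increment k :
  Ex nu (fun y => cos (phase k y) * increment y) =
  2 * (Ex nu (fun x => G x ^+ 2) * (null_freq k)%:R - coef2 k).
Proof.
have bc := bmeas_cos k; have bs := bmeas_sin k.
have bc2 : bmeas (fun z : borel_rV R d * borel_rV R d => cos (phase k z.2)).
  exact: (bmeas_comp (h := snd)) bc.
transitivity (Ex nu (fun x => Ex nu (fun y =>
    cos (phase k y) * (G x - G ((x : 'rV[R]_d) + y)) ^+ 2))).
  rewrite (@Ex_fubini _ _ _ _ _ nu nu
    (fun z => cos (phase k z.2) * (G z.1 - G ((z.1 : 'rV[R]_d) + z.2)) ^+ 2)).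
    apply: eq_Ex => y; rewrite /increment -ExZ//.
    exact: (bmeas_pair2 bmeas_G2).
  exact: bmeasM bc2 bmeas_G2.
(* Invariance under translation by [x] replaces [x + y] by [y]. The cosine of a difference then
   splits into products of a function of [x] and a function of [y]. *)
transitivity (Ex nu (fun x => Ex nu (fun y =>
    cos (phase k ((y : 'rV[R]_d) - x)) * (G x - G y) ^+ 2))).
  apply: eq_Ex => x.
  rewrite -[RHS](nu_inv _ _ x).
  - by apply: eq_Ex => y /=; rewrite (addrK (x : 'rV[R]_d)) (addrC (x : 'rV[R]_d)).
  - apply: bmeasM.
      apply: (bmeas_comp (h := fun y : borel_rV R d => (y : 'rV[R]_d) - x : borel_rV R d)) bc.
      exact: measurable_shift.
    by apply: bmeasX; apply: bmeasB => //; exact: bmeas_cst.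
  - move=> y l lB; rewrite perG// addrAC.
    by rewrite (@cos_phase_periodic k).
have E x : Ex nu (fun y => cos (phase k ((y : 'rV[R]_d) - x)) * (G x - G y) ^+ 2) =
   Ex nu (fun y => cos (phase k x) * (cos (phase k y) * G y ^+ 2) +
                   sin (phase k x) * (sin (phase k y) * G y ^+ 2) +
                   G x ^+ 2 * cos (phase k x) * cos (phase k y) +
                   G x ^+ 2 * sin (phase k x) * sin (phase k y) +
                   - 2 * (G x * cos (phase k x)) * (G y * cos (phase k y)) +
                   - 2 * (G x * sin (phase k x)) * (G y * sin (phase k y))).
  apply: eq_Ex => y; rewrite phaseD phaseN cosD cosN sinN; ring.
have bG2 : bmeas (fun x => G x ^+ 2) by exact: bmeasX.
have bcG := bmeasM bc bG2; have bsG := bmeasM bs bG2.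
have bGc := bmeasM bG bc; have bGs := bmeasM bG bs.
have {}E x : Ex nu (fun y => cos (phase k ((y : 'rV[R]_d) - x)) * (G x - G y) ^+ 2) =
  Ex nu (fun y => cos (phase k y) * G y ^+ 2) * cos (phase k x) +
  Ex nu (fun y => sin (phase k y) * G y ^+ 2) * sin (phase k x) +
  (null_freq k)%:R * (cos (phase k x) * G x ^+ 2) +
  - 2 * Ex nu (fun y => G y * cos (phase k y)) * (G x * cos (phase k x)) +
  - 2 * Ex nu (fun y => G y * sin (phase k y)) * (G x * sin (phase k x)).
  rewrite E !ExD ?ExZ ?Ex_sin ?Ex_cos//; try by do ?[exact: bmeasZ|apply: bmeasD].
  by ring.
under eq_Ex do rewrite E.
rewrite !ExD ?ExZ ?Ex_sin ?Ex_cos//; try by do ?[exact: bmeasZ|apply: bmeasD].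
rewrite /coef2.
case: (boolP (null_freq k)) => [/forallP k0|_]; last by rewrite /= mulr0n; ring.
rewrite /= mulr1n.
have -> : Ex nu (fun y => cos (phase k y) * G y ^+ 2) = Ex nu (fun y => G y ^+ 2).
  by apply: eq_Ex => y; rewrite phase0 ?cos0 ?mul1r// => j; apply/eqP.
by ring.
Qed.

End variance.

Section kernel.
Variable n : nat.
Hypothesis n_gt0 : (0 < n)%N.
Local Notation idx := {ffun 'I_d -> 'I_n}.

Definition freq_diff (m m' : idx) : 'I_d -> int := fun j => (m j)%:Z - (m' j)%:Z.

Lemma null_freq_diff m m' : null_freq (freq_diff m m') = (m == m').
Proof.
apply/forallP/eqP => [H|-> j]; last by rewrite /freq_diff subrr.
by apply/ffunP => j; apply: val_inj; have := H j; rewrite subr_eq0 => /eqP[].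
Qed.

(* n^-d |sum_m e(m . t(x))|^2, expanded as a double sum of cosines *)
Definition fejer (x : 'rV[R]_d) : R :=
  (n ^ d)%:R^-1 * \sum_m \sum_m' cos (phase (freq_diff m m') x).

Lemma fejer_ge0 x : 0 <= fejer x.
Proof.
rewrite mulr_ge0 ?invr_ge0//.
pose ph (m : idx) := phase (fun j => (m j)%:Z) x.
suff -> : \sum_m \sum_m' cos (phase (freq_diff m m') x) =
    (\sum_m cos (ph m)) ^+ 2 + (\sum_m sin (ph m)) ^+ 2.
  by rewrite addr_ge0// sqr_ge0.
rewrite !expr2 !mulr_suml -big_split; apply: eq_bigr => m _ /=.
rewrite !mulr_sumr -big_split; apply: eq_bigr => m' _ /=.
by rewrite -cosB /freq_diff phase_addl phase_oppl.
Qed.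

Lemma bmeas_fejer : bmeas (fejer : borel_rV R d -> R).
Proof.
apply: bmeasZ; apply: bmeas_sum => m; apply: bmeas_sum => m'.
exact: bmeas_cos.
Qed.

Lemma card_idx : #|{: idx}| = (n ^ d)%N.
Proof. by rewrite card_ffun !card_ord. Qed.

Let nd0 : (n ^ d)%:R != 0 :> R.
Proof. by rewrite pnatr_eq0 -lt0n expn_gt0 n_gt0. Qed.

Lemma Ex_fejerM (f : borel_rV R d -> R) : bmeas f ->
  Ex nu (fun x => fejer x * f x) =
  (n ^ d)%:R^-1 * \sum_m \sum_m' Ex nu (fun x => cos (phase (freq_diff m m') x) * f x).
Proof.
move=> bf; have bcf k : bmeas (fun x : borel_rV R d => cos (phase k x) * f x).
  by apply: bmeasM => //; exact: bmeas_cos.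
under eq_Ex => x.
  rewrite /fejer -mulrA mulr_suml.
  under eq_bigr do rewrite mulr_suml.
  over.
rewrite ExZ; last by apply: bmeas_sum => m; apply: bmeas_sum.
rewrite Ex_sum; last by move=> m; apply: bmeas_sum.
by congr (_ * _); apply: eq_bigr => m _; rewrite Ex_sum.
Qed.

Lemma sum_null_freq (c : R) :
  (n ^ d)%:R^-1 * (\sum_(m : idx) \sum_(m' : idx) c * (null_freq (freq_diff m m'))%:R) = c.
Proof.
rewrite (eq_bigr (fun=> c)) => [|m _]; last first.
  rewrite (bigD1 m)//= null_freq_diff eqxx mulr1 big1 ?addr0// => m' m'm.
  by rewrite null_freq_diff eq_sym (negbTE m'm) mulr0.
by rewrite sumr_const card_idx -[c *+ _]mulr_natl mulKf.
Qed.

(** The substitute for Parseval: average [Ex_increment] over all pairs [(m, m')]. Only the diagonal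
    pairs have zero frequency, and they reproduce the mean of [G ^+ 2] with weight 1. *)
Lemma variance_fejer (G : borel_rV R d -> R) : bmeas G -> lattice_periodic G ->
  Ex nu (fun x => G x ^+ 2) =
  (n ^ d)%:R^-1 * (\sum_m \sum_m' coef2 G (freq_diff m m')) +
  2^-1 * Ex nu (fun y => fejer y * increment G y).
Proof.
move=> bG pG; rewrite Ex_fejerM; last exact: bmeas_increment.
under [in X in _ = _ + X]eq_bigr do under eq_bigr do rewrite Ex_increment//.
rewrite -[LHS]sum_null_freq mulrCA -mulrDr; congr (_ * _).
rewrite mulr_sumr -big_split/=; apply: eq_bigr => m _.
rewrite mulr_sumr -big_split/=; apply: eq_bigr => m' _.
by rewrite mulKf ?pnatr_eq0// addrC subrK.
Qed.

Lemma Ex_fejer : Ex nu (fejer : borel_rV R d -> R) = 1.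
Proof.
transitivity (Ex nu (fun x => fejer x * 1)).
  by apply: eq_Ex => x; rewrite mulr1.
rewrite Ex_fejerM; last exact: bmeas_cst.
rewrite -[RHS](sum_null_freq 1); congr (_ * _).
apply: eq_bigr => m _; apply: eq_bigr => m' _.
by rewrite -Ex_cos mul1r; apply: eq_Ex => x; rewrite mulr1.
Qed.

Definition unit_freq (j : 'I_d) : 'I_d -> int := fun i => (i == j)%:Z.

(** The proportion of indices [m] that leave the grid when their [j]-th entry is increased by
    one. *)
Lemma card_last (j : 'I_d) : (n ^ d)%:R^-1 * (\sum_(m : idx) ((m j).+1 == n)%:R) = n%:R^-1 :> R.
Proof.
(* Written as a product over the coordinates, the indicator makes the sum over the grid
   factorize. *)
have -> : \sum_(m : idx) ((m j).+1 == n)%:R =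
   \sum_(m : idx) \prod_i (if i == j then ((m i).+1 == n)%:R else 1) :> R.
  by apply: eq_bigr => m _; rewrite -big_mkcond big_pred1_eq.
rewrite -(bigA_distr_bigA (fun i (c : 'I_n) => if i == j then (c.+1 == n)%:R else 1 : R)).
rewrite (bigD1 j)//= eqxx.
have -> : \sum_(c < n) (c.+1 == n)%:R = 1 :> R.
  have nn : (n.-1 < n)%N by rewrite prednK.
  rewrite (bigD1 (Ordinal nn))//= prednK// eqxx big1 ?addr0// => c.
  by rewrite -val_eqE/= -eqSS prednK// => /negbTE ->.
rewrite mul1r (eq_bigr (fun=> n%:R)) => [|i /negbTE ->]; last first.
  by rewrite sumr_const card_ord.
rewrite prodr_const cardC1 card_ord natrX.
have : n%:R != 0 :> R by rewrite pnatr_eq0 -lt0n.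
have : (0 < d)%N by case: (d) j => // -[].
by case: (d) => // d' _ n0; rewrite exprS invfM -mulrA mulVf ?mulr1// expf_neq0.
Qed.

(** By orthogonality this coefficient counts pairs of indices that differ by one step in direction
    [j]; every [m] that stays in the grid after the step contributes one pair. *)
Lemma Ex_fejer_cos j : 1 - n%:R^-1 <= Ex nu (fun x => fejer x * cos (phase (unit_freq j) x)).
Proof.
rewrite Ex_fejerM; last exact: bmeas_cos.
have bc := bmeas_cos.
have E k : Ex nu (fun x => cos (phase k x) * cos (phase (unit_freq j) x)) =
    2^-1 * ((null_freq (fun i => k i + unit_freq j i))%:R + (null_freq (fun i => k i - unit_freq j i))%:R).
  rewrite -!Ex_cos -ExD// -ExZ; last exact: bmeasD.
  apply: eq_Ex => x; rewrite !phase_addl phase_oppl cosD cosB; by field.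
have sh (m : idx) : 1 - ((m j).+1 == n)%:R <=
    \sum_m' (null_freq (fun i => freq_diff m' m i - unit_freq j i))%:R :> R.
  have [mj|mj] := eqVneq (m j).+1 n.
    by rewrite subrr sumr_ge0.
  have mjn : ((m j).+1 < n)%N by rewrite ltn_neqAle mj ltn_ord.
  pose m1 : idx := [ffun i => if i == j then Ordinal mjn else m i].
  have m1z : null_freq (fun i => freq_diff m1 m i - unit_freq j i).
    apply/forallP => i; rewrite /freq_diff /unit_freq ffunE.
    have [->|_] := eqVneq i j; last by rewrite subrr subr0.
    rewrite -[X in X == 0]/((m j).+1%:Z - (m j)%:Z - 1%:Z) intS.
    by apply/eqP; ring.
  by rewrite (bigD1 m1)//= m1z subr0 lerDl sumr_ge0.
rewrite -(card_last j).
rewrite [X in X - _](_ : _ = (n ^ d)%:R^-1 * \sum_(m : idx) 1); last first.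
  by rewrite sumr_const card_idx mulVf.
rewrite -mulrBr -sumrB ler_pM2l ?invr_gt0 ?lt0r ?nd0//=.
under [leRHS]eq_bigr do under eq_bigr do rewrite E.
(* Exchanging [m] and [m'] turns the frequency condition with [+] into the one with [-], so the two
   halves coincide. *)
have -> : \sum_(m : idx) \sum_(m' : idx)
    2^-1 * ((null_freq (fun i => freq_diff m m' i + unit_freq j i))%:R +
            (null_freq (fun i => freq_diff m m' i - unit_freq j i))%:R) =
  \sum_(m : idx) \sum_(m' : idx) (null_freq (fun i => freq_diff m' m i - unit_freq j i))%:R :> R.
  have -> : \sum_(m : idx) \sum_(m' : idx)
      2^-1 * ((null_freq (fun i => freq_diff m m' i + unit_freq j i))%:R +
              (null_freq (fun i => freq_diff m m' i - unit_freq j i))%:R) =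
    2^-1 * (\sum_(m : idx) \sum_(m' : idx)
              (null_freq (fun i => freq_diff m m' i + unit_freq j i))%:R +
            \sum_(m : idx) \sum_(m' : idx)
              (null_freq (fun i => freq_diff m m' i - unit_freq j i))%:R) :> R.
    rewrite -big_split mulr_sumr; apply: eq_bigr => m _ /=.
    by rewrite -big_split mulr_sumr.
  rewrite [X in _ + X]exchange_big/=.
  have -> : \sum_(m : idx) \sum_(m' : idx) (null_freq (fun i => freq_diff m m' i + unit_freq j i))%:R =
    \sum_(m : idx) \sum_(m' : idx) (null_freq (fun i => freq_diff m' m i - unit_freq j i))%:R :> R.
    apply: eq_bigr => m _; apply: eq_bigr => m' _; congr ((nat_of_bool _)%:R).
    by apply/forallP/forallP => H i; have := H i; rewrite -oppr_eq0 /freq_diff opprD ?opprB ?opprK.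
  by field.
by apply: ler_sum => m _; exact: sh.
Qed.

(** Concentration of the kernel: [1 - cos] measures the distance to the lattice in direction [j],
    and its mean under the density [fejer] tends to 0. *)
Lemma Ex_fejer_1Bcos j : Ex nu (fun x => fejer x * (1 - cos (phase (unit_freq j) x))) <= n%:R^-1.
Proof.
have bf := bmeas_fejer; have bc := bmeas_cos (unit_freq j).
under eq_Ex do rewrite mulrBr mulr1.
by rewrite ExB ?Ex_fejer; [have := Ex_fejer_cos j; lra|exact: bf|exact: bmeasM].
Qed.

End kernel.
End fejer.

(** * Summation of inverse powers over nonzero integer frequencies *)

Definition sup_norm d (k : 'I_d -> int) : nat := \max_j absz (k j).

Section lattice_sum.
Variables (R : realType) (d : nat).

Lemma card_near n (a : 'I_n) s :
  (#|[pred c : 'I_n | absz ((a : nat)%:Z - (c : nat)%:Z) <= s]| <= s.*2.+1)%N.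
Proof.
(* On the set considered [c + s - a] is a true subtraction with values at most [2 * s], so neither
   truncation nor the default of [inord] interferes. *)
pose f (c : 'I_n) : 'I_(s.*2.+1) := inord (c + s - a).
rewrite -[leqRHS]card_ord; apply: (@leq_card_in _ _ f) => // b c.
rewrite !inE => ab ac /(congr1 val); rewrite /f /= !inordK; [|lia..].
by move=> E; apply: val_inj => /=; lia.
Qed.

Lemma card_near_idx n (m : {ffun 'I_d -> 'I_n}) s :
  \sum_(m' : {ffun 'I_d -> 'I_n}) (sup_norm (freq_diff m m') <= s)%N%:R
    <= (s.*2.+1 ^ d)%:R :> R.
Proof.
have -> : \sum_(m' : {ffun 'I_d -> 'I_n}) (sup_norm (freq_diff m m') <= s)%N%:R =
    \sum_(m' : {ffun 'I_d -> 'I_n}) \prod_j (absz (freq_diff m m' j) <= s)%N%:R :> R.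
  apply: eq_bigr => m' _; have [/bigmax_leqP sm|] := boolP (_ <= s)%N.
    by rewrite big1// => j _; rewrite sm.
  case: (boolP [forall j, absz (freq_diff m m' j) <= s]%N) => [/forallP H|].
    by move=> /negP[]; apply/bigmax_leqP => j _; exact: H.
  rewrite negb_forall => /existsP[j jm] _.
  by rewrite (bigD1 j)//= (negbTE jm) mul0r.
rewrite -(bigA_distr_bigA (fun j (c : 'I_n) => (absz ((m j : nat)%:Z - (c : nat)%:Z) <= s)%N%:R : R)).
rewrite natrX -[in leRHS](card_ord d) -prodr_const; apply: ler_prod => j _.
rewrite sumr_ge0//= -natr_sum ler_nat.
apply: leq_trans (card_near (m j) s); rewrite -sum1_card [leqRHS]big_mkcond.
by apply: leq_sum => c _; rewrite inE; case: ifP.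
Qed.

Lemma sum_invsq n : \sum_(0 <= s < n) (s.+1%:R ^- 2) <= 2 :> R.
Proof.
case: n => [|n]; first by rewrite big_nil.
(* The stronger bound [2 - n.+1%:R^-1] is what the induction can carry, by telescoping. *)
suff : \sum_(0 <= s < n.+1) (s.+1%:R ^- 2) <= 2 - n.+1%:R^-1 :> R.
  by move=> /le_trans; apply; rewrite gerBl.
elim: n => [|n IH]; first by rewrite big_nat1 expr1n invr1; lra.
rewrite big_nat_recr//=; apply: le_trans (lerD IH (lexx _)) _.
have n0 : 0 < n.+1%:R :> R by [].
rewrite -(natr1 n.+1); set x := n.+1%:R in n0 *.
have x1 : 0 < x + 1 by lra.
rewrite -subr_ge0 (_ : _ - _ = (x * (x + 1) ^+ 2)^-1); last by field; rewrite !gt_eqF.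
by rewrite invr_ge0 mulr_ge0 ?sqr_ge0 ?ltW.
Qed.

(** A discrete layer-cake formula, which turns a sum over frequencies of a function of the norm into
    counts of the balls of radius [s.+1]. The [t] values of [s.+1] from [t] to [2 * t - 1] each
    contribute at least [(2 * t)] to the power [-(d+2)]. *)
Lemma inv_power_le t N : (0 < t)%N -> (t <= N)%N ->
  t%:R ^- d.+1 <= 2 ^+ d.+2 * \sum_(0 <= s < N.*2) (t <= s.+1)%N%:R * s.+1%:R ^- d.+2 :> R.
Proof.
move=> t0 tN.
have -> : t%:R ^- d.+1 = 2 ^+ d.+2 * \sum_(t.-1 <= s < t.-1 + t) (t.*2)%:R ^- d.+2 :> R.
  rewrite sumr_const_nat addKn -mul2n natrM exprMn -[_^-1 *+ t]mulr_natr.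
  have T0 : t%:R != 0 :> R by rewrite pnatr_eq0 -lt0n.
  rewrite invfM 2!mulrA mulfV ?expf_neq0 ?pnatr_eq0// mul1r.
  by rewrite [in RHS]exprS invfM mulrC mulrA mulfV ?mul1r.
rewrite ler_pM2l ?exprn_gt0//.
have tN2 : (t.-1 + t <= N.*2)%N by lia.
rewrite (@big_cat_nat _ _ _ t.-1 0 N.*2)//=; last lia.
rewrite (@big_cat_nat _ _ _ (t.-1 + t)%N t.-1 N.*2)//=; last lia.
have nn a b : 0 <= \sum_(a <= s < b) (t <= s.+1)%N%:R * s.+1%:R ^- d.+2 :> R.
  by apply: sumr_ge0 => s _; rewrite mulr_ge0// invr_ge0 exprn_ge0.
suff H : \sum_(t.-1 <= s < t.-1 + t) (t.*2)%:R ^- d.+2 <=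
  \sum_(t.-1 <= s < t.-1 + t) (t <= s.+1)%N%:R * s.+1%:R ^- d.+2 :> R.
  have := nn 0 t.-1; have := nn (t.-1 + t)%N N.*2; move: H; lra.
rewrite big_nat_cond [leRHS]big_nat_cond; apply: ler_sum => s /andP[/andP[s1 s2] _].
have -> : (t <= s.+1)%N by lia.
rewrite mul1r lef_pV2 ?posrE ?exprn_gt0 ?ltr0n ?double_gt0//.
by rewrite lerXn2r ?nnegrE// ler_nat; lia.
Qed.

(** [2 ^+ d.+2] comes from [inv_power_le], [3 ^+ d] from [2 * (s+1) + 1 <= 3 * (s+1)] in the count
    of a ball, and 2 from [sum_invsq]. *)
Definition lattice_const : R := 2 ^+ d.+2 * (3 ^+ d * 2).

(** A ball of radius [s+1] has at most a multiple of [(s+1)^d] points, so after exchanging the sums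
    only the inverse squares remain; the bound is uniform in the grid size [n]. *)
Lemma sum_inv_power n (m : {ffun 'I_d -> 'I_n}) :
  \sum_(m' | m' != m) (sup_norm (freq_diff m m'))%:R ^- d.+1 <= lattice_const.
Proof.
have sn_gt0 m' : m' != m -> (0 < sup_norm (freq_diff m m'))%N.
  apply: contraNT; rewrite -leqNgt => /bigmax_leqP H.
  by rewrite eq_sym -null_freq_diff; apply/forallP => j; rewrite -absz_eq0 -leqn0 H.
have sn_le m' : (sup_norm (freq_diff m m') <= n)%N.
  by apply/bigmax_leqP => j _; rewrite /freq_diff; have := ltn_ord (m j); have := ltn_ord (m' j); lia.
apply: (@le_trans _ _ (\sum_m' 2 ^+ d.+2 * \sum_(0 <= s < n.*2)
    (sup_norm (freq_diff m m') <= s.+1)%N%:R * s.+1%:R ^- d.+2)).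
  rewrite big_mkcond; apply: ler_sum => m' _; case: ifP => [m'm|_].
    exact: inv_power_le (sn_gt0 _ m'm) (sn_le _).
  by rewrite mulr_ge0 ?exprn_ge0// sumr_ge0.
rewrite -mulr_sumr ler_pM2l ?exprn_gt0// exchange_big/=.
apply: (@le_trans _ _ (3 ^+ d * \sum_(0 <= s < n.*2) (s.+1%:R ^- 2))).
  rewrite mulr_sumr; apply: ler_sum => s _; rewrite -mulr_suml.
  have s0 : 0 < s.+1%:R :> R by [].
  rewrite ler_pdivrMr ?exprn_gt0//.
  rewrite -[X in _ * X](_ : s.+1%:R ^+ d * s.+1%:R ^+ 2 = _); last first.
    by rewrite -exprD addn2.
  rewrite (mulrC (s.+1%:R ^+ d)) mulrA divfK ?expf_neq0 ?gt_eqF//.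
  apply: le_trans (card_near_idx _ _) _.
  rewrite natrX -exprMn -natrM lerXn2r ?nnegrE// ler_nat.
  by rewrite -addnn; lia.
by rewrite ler_pM2l ?exprn_gt0// sum_invsq.
Qed.

Lemma lattice_const_gt0 : 0 < lattice_const.
Proof. by rewrite /lattice_const mulr_gt0 ?exprn_gt0// mulr_gt0 ?exprn_gt0. Qed.

End lattice_sum.

(** * From decay of Fourier coefficients to a variance bound *)

Section variance_bound.
Variables (R : realType) (d : nat) (B : 'M[R]_d).
Hypothesis uB : B \in unitmx.
Variable nu : probability (borel_rV R d) R.
Hypothesis nu_inv : forall f : borel_rV R d -> R, bmeas f -> lattice_periodic B f ->
  forall y : 'rV[R]_d, Ex nu (fun x => f ((x : 'rV[R]_d) + y)) = Ex nu f.

(** The last hypothesis is continuity in quadratic mean at lattice points, in the form that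
    [Ex_fejer_1Bcos] can integrate: the kernel average of the increments is at most
    [e + C * d / n]. *)
Lemma variance_le_coef (G : borel_rV R d -> R) (H : R) :
  bmeas G -> lattice_periodic B G -> Ex nu G = 0 -> 0 <= H ->
  (forall k, ~~ null_freq k -> coef2 B nu G k <= H * (sup_norm k)%:R ^- d.+1) ->
  (forall e, 0 < e -> exists2 C, 0 <= C & forall y,
     increment nu G y <= e + C * \sum_j (1 - cos (phase B (unit_freq j) y))) ->
  Ex nu (fun x => G x ^+ 2) <= H * lattice_const R d.
Proof.
move=> bG pG G0 H0 Hk incr; apply/ler_addgt0Pr => e e0.
have [C C0 HC] := incr _ e0.
(* The grid is fine enough to absorb [C]; adding 1 to [C * d%:R] keeps the divisor positive when it
   vanishes. *)
have [n n_gt0 nC] : exists2 n, (0 < n)%N & C * d%:R * n%:R^-1 <= e.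
  have [n _ /(_ n (leqnn n)) nn] := near_infty_natSinv_lt 
    (PosNum (divr_gt0 e0 (ltr_pwDr ltr01 (mulr_ge0 C0 (ler0n R d))))).
  exists n.+1 => //; move: nn; rewrite /= ltr_pdivlMr; last first.
    by rewrite ltr_wpDl// mulr_ge0.
  by rewrite mulrC => /ltW; apply: le_trans; rewrite ler_wpM2r ?invr_ge0// lerDl.
rewrite (variance_fejer uB nu_inv n_gt0 bG pG).
have c0 (k : 'I_d -> int) : null_freq k -> coef2 B nu G k = 0.
  move=> /forallP kz; rewrite /coef2.
  rewrite (eq_Ex _ (g := G)) ?G0 => [|x]; last first.
    by rewrite phase0 ?cos0 ?mulr1// => j; apply/eqP.
  rewrite (eq_Ex _ (g := fun=> 0)) ?Ex_cst ?expr0n ?addr0// => x.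
  by rewrite phase0 ?sin0 ?mulr0// => j; apply/eqP.
have nd0 : (n ^ d)%:R != 0 :> R by rewrite pnatr_eq0 -lt0n expn_gt0 n_gt0.
apply: lerD.
  rewrite ler_pdivrMl ?lt0r ?nd0//=.
  apply: (@le_trans _ _ (\sum_(m : {ffun 'I_d -> 'I_n}) H * lattice_const R d)).
    apply: ler_sum => m _; rewrite (bigD1 m)//= c0 ?null_freq_diff// add0r.
    apply: (@le_trans _ _ (\sum_(m' | m' != m) H * (sup_norm (freq_diff m m'))%:R ^- d.+1)).
      by apply: ler_sum => m' m'm; apply: Hk; rewrite null_freq_diff eq_sym.
    by rewrite -mulr_sumr ler_wpM2l// sum_inv_power.
  by rewrite sumr_const card_idx mulr_natl.
have bf := bmeas_fejer B n; have bi := bmeas_increment nu bG.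
have bej j : bmeas (fun y : borel_rV R d => 1 - cos (phase B (unit_freq j) y)).
  by apply: bmeasB; [exact: bmeas_cst|exact: bmeas_cos].
have bfe j : bmeas (fun y : borel_rV R d => fejer B n y * (1 - cos (phase B (unit_freq j) y))).
  exact: bmeasM.
rewrite ler_pdivrMl//.
apply: (@le_trans _ _ (Ex nu (fun y => e * fejer B n y +
    C * \sum_j (fejer B n y * (1 - cos (phase B (unit_freq j) y)))))).
  apply: le_Ex; first exact: bmeasM.
    by apply: bmeasD; [exact: bmeasZ|apply: bmeasZ; exact: bmeas_sum].
  move=> y; have := HC y; have := fejer_ge0 B n y; rewrite -mulr_sumr.
  move: (fejer B n y) (increment nu G y) (\sum_j _) => f i t f0 it.
  suff -> : e * f + C * (f * t) = f * (e + C * t) by rewrite ler_wpM2l.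
  by ring.
rewrite ExD; [|exact: bmeasZ|by apply: bmeasZ; exact: bmeas_sum].
rewrite (ExZ _ e bf) (ExZ _ C (bmeas_sum _ _ bfe)) Ex_sum//.
rewrite (Ex_fejer uB nu_inv n_gt0).
apply: (@le_trans _ _ (e * 1 + C * \sum_(j < d) n%:R^-1)).
  rewrite lerD2l ler_wpM2l//; apply: ler_sum => j _.
  exact: (Ex_fejer_1Bcos uB nu_inv n_gt0).
rewrite sumr_const card_ord -[_ *+ d]mulr_natl mulrA; move: nC; lra.
Qed.

End variance_bound.

(** * Decay of Bessel-type integrals *)

Section bessel.
Variables (R : realType) (m : nat).
Local Notation mu := (@lebesgue_measure R).

Lemma is_derive1M (f g : R -> R) (x df dg : R) : is_derive x 1 f df ->
  is_derive x 1 g dg -> is_derive x 1 (fun t => f t * g t) (df * g x + f x * dg).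
Proof.
move=> Df Dg; apply: (@is_derive_eq _ _ _ _ _ _ _ _ (is_deriveM Df Dg)).
by rewrite /GRing.scale/= addrC mulrC.
Qed.

Lemma is_derive1X (n : nat) (x : R) :
  is_derive x 1 (fun t : R => t ^+ n.+1) (n.+1%:R * x ^+ n).
Proof.
rewrite (_ : (fun t => _) = (id : R -> R) ^+ n.+1); last first.
  by apply/funext => t; rewrite exprfctE.
apply: (@is_derive_eq _ _ _ _ _ _ _ _ (is_deriveX n.+1 (is_derive_id x 1))).
by rewrite /GRing.scale/= mulr1.
Qed.

Lemma is_derive1_inv (x : R) : x != 0 -> is_derive x 1 (fun t : R => t^-1) (- x ^- 2).
Proof.
move=> x0; apply: (@is_derive_eq _ _ _ _ _ _ _ _ (is_deriveV x0 (is_derive_id x 1))).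
by rewrite /GRing.scale/= mulr1.
Qed.

(** Radius of the section of the unit ball at height [t]. *)
Definition circ (t : R) : R := Num.sqrt (1 - t ^+ 2).

Lemma circ_sqr t : t \in `[(-1)%R, 1%R] -> circ t ^+ 2 = 1 - t ^+ 2.
Proof. by rewrite in_itv /= => /andP[t1 t2]; rewrite sqr_sqrtr//; nra. Qed.

Lemma continuous_comp_fun (f g : R -> R) : continuous f -> continuous g ->
  continuous (fun t : R => g (f t)).
Proof. by move=> cf cg t; apply: (@continuous_comp _ _ _ f g); [exact: cf|exact: cg]. Qed.

Lemma continuous_circ : continuous circ.
Proof.
apply: (@continuous_comp_fun (fun t => 1 - t ^+ 2) (@Num.sqrt R)).
  by move=> t; apply: cvgB; [exact: cvg_cst|exact: exprn_continuous].
exact: sqrt_continuous.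
Qed.

Lemma continuousM_fun (f g : R -> R) : continuous f -> continuous g ->
  continuous (fun t : R => f t * g t).
Proof. by move=> cf cg t; apply: cvgM; [exact: cf|exact: cg]. Qed.

Lemma continuousX_fun (f : R -> R) n : continuous f -> continuous (fun t : R => f t ^+ n).
Proof.
move=> cf; apply: (@continuous_comp_fun f (fun t => t ^+ n)) => //.
exact: exprn_continuous.
Qed.

Lemma continuous_integrable (f : R -> R) : continuous f ->
  mu.-integrable `[(-1)%R, 1%R] (EFin \o f).
Proof.
move=> cf; apply: continuous_compact_integrable; first exact: segment_compact.
exact: continuous_subspaceT.
Qed.

(** Since [dphi] is bounded by 1, the derivative of the integrand is dominated by the norm of
    [t * w t], uniformly in the parameter. *)
Lemma is_derive_integral (phi dphi w : R -> R) (x : R) :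
  (forall t : R, is_derive t 1 phi (dphi t)) -> continuous dphi ->
  (forall t, `|dphi t| <= 1) -> continuous w ->
  is_derive x 1 (fun x => \int[mu]_(t in `[(-1)%R, 1%R]) (phi (x * t) * w t))
    (\int[mu]_(t in `[(-1)%R, 1%R]) (dphi (x * t) * (t * w t))).
Proof.
move=> Dphi cdphi dphi1 cw.
pose f (x t : R) := phi (x * t) * w t.
have Df (u t : R) : is_derive u 1 (f ^~ t) (dphi (u * t) * (t * w t)).
  have D1 : is_derive u 1 (fun u => u * t) t.
    apply: (@is_derive_eq _ _ _ _ _ _ _ _ (is_derive1M (is_derive_id u 1) (is_derive_cst t u 1))).
    by rewrite mul1r mulr0 addr0.
  have D2 := @is_derive1_comp _ phi ( *%R^~ t) u _ _ (Dphi (u * t)) D1.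
  apply: (@is_derive_eq _ _ _ _ _ _ _ _ (is_derive1M D2 (is_derive_cst (w t) u 1))).
  by rewrite mulr0 addr0 mulrA.
have cphi : continuous phi.
  move=> t; apply: differentiable_continuous; apply/derivable1_diffP.
  exact: (@ex_derive _ _ _ _ _ _ _ (Dphi t)).
have cmul u : continuous (fun t : R => u * t).
  by move=> t; apply: cvgM; [exact: cvg_cst|exact: cvg_id].
have intf u : mu.-integrable `[(-1)%R, 1%R] (EFin \o f u).
  apply: continuous_integrable; apply: continuousM_fun => //.
  exact: (@continuous_comp_fun ( *%R u) phi).
have iG : mu.-integrable `[(-1)%R, 1%R] (EFin \o (fun t => `|t * w t|)).
  apply: continuous_integrable.
  apply: (@continuous_comp_fun (fun t => t * w t) Num.norm); last exact: norm_continuous.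
  by apply: continuousM_fun => // s; exact: cvg_id.
have xI : `]x - 1, x + 1[%classic x by rewrite /= in_itv /=; lra.
have mI : measurable (`[(-1)%R, 1%R]%classic : set (measurableTypeR R)).
  exact: measurable_itv.
have E1 := differentiation_under_integral mI xI (fun u _ => intf u)
  (fun u t _ _ => @ex_derive _ _ _ _ _ _ _ (Df u t)) (fun t => normr_ge0 _) iG.
have dG (u t : R) : `]x - 1, x + 1[%classic u -> `[(-1)%R, 1%R]%classic t ->
    `|partial1of2 f u t| <= `|t * w t|.
  move=> _ _; rewrite partial1of2E (@derive_val _ _ _ _ _ _ _ (Df u t)).
  by rewrite normrM ler_piMl.
have D3 := derivable_under_integral mI xI (fun u _ => intf u)
  (fun u t _ _ => @ex_derive _ _ _ _ _ _ _ (Df u t)) (fun t => normr_ge0 _) iG dG.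
apply: DeriveDef; first exact: D3.
rewrite -derive1E (E1 dG); apply: eq_Rintegral => t _ /=.
by rewrite partial1of2E (@derive_val _ _ _ _ _ _ _ (Df x t)).
Qed.

(** Poisson's integral: up to a constant this is [x^(-nu) J_nu(x)] with [nu = (m + 1) / 2]. It is
    the Fourier transform of the unit ball of dimension [m.+1], up to a volume factor. *)
Definition bessel x := \int[mu]_(t in `[(-1)%R, 1%R]) (cos (x * t) * circ t ^+ m).
Definition bessel_d1 x := \int[mu]_(t in `[(-1)%R, 1%R]) (- sin (x * t) * (t * circ t ^+ m)).
Definition bessel_d2 x := \int[mu]_(t in `[(-1)%R, 1%R]) (- cos (x * t) * (t * (t * circ t ^+ m))).

Let cw : continuous (fun t : R => circ t ^+ m).
Proof. by apply: continuousX_fun; exact: continuous_circ. Qed.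

Let ctw : continuous (fun t : R => t * circ t ^+ m).
Proof. by apply: continuousM_fun => // t; exact: cvg_id. Qed.

Lemma is_derive_bessel (x : R) : is_derive x 1 bessel (bessel_d1 x).
Proof.
apply: (@is_derive_integral (@cos R) (fun t => - sin t)) => //.
- by move=> t; apply: cvgN; exact: continuous_sin.
- by move=> t; rewrite normrN ler_norml sin_geN1 sin_le1.
Qed.

Lemma is_derive_bessel_d1 (x : R) : is_derive x 1 bessel_d1 (bessel_d2 x).
Proof.
apply: (@is_derive_integral (fun t => - sin t) (fun t => - cos t)) => //.
- by move=> t; apply: cvgN; exact: continuous_cos.
- by move=> t; rewrite normrN ler_norml cos_geN1 cos_le1.
Qed.

Lemma is_derive_circX (t : R) : t \in `](-1)%R, 1%R[ ->
  is_derive t 1 (fun t : R => circ t ^+ m.+2) (- (m.+2%:R * (t * circ t ^+ m))).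
Proof.
rewrite in_itv /= => /andP[t1 t2].
have t0 : 0 < 1 - t ^+ 2 by nra.
have D1 : is_derive t 1 (fun t : R => 1 - t ^+ 2) (- (2 * t)).
  apply: (@is_derive_eq _ _ _ _ _ _ _ _ (is_deriveB (is_derive_cst (1 : R) t 1) (is_derive1X 1 t))).
  by rewrite expr1 sub0r.
have D2 := @is_derive1_comp _ Num.sqrt (fun t => 1 - t ^+ 2) t _ _ (is_derive1_sqrt t0) D1.
have D3 := @is_derive1_comp _ (fun t => t ^+ m.+2) circ t _ _ (is_derive1X m.+1 (circ t)) D2.
apply: (@is_derive_eq _ _ _ _ _ _ _ _ D3).
rewrite -/(circ t) exprS; have c0 : circ t != 0 by rewrite gt_eqF// sqrtr_gt0.
by field.
Qed.

(* Integrate cos (x t) (1 - t^2)^((m+2)/2) by parts over [-1, 1]. *)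
Lemma bessel_ode x : x != 0 -> bessel_d2 x = - bessel x - m.+2%:R / x * bessel_d1 x.
Proof.
move=> x0.
have cs : continuous (fun t : R => sin (x * t)).
  apply: (@continuous_comp_fun ( *%R x) sin); last exact: continuous_sin.
  by move=> t; apply: cvgM; [exact: cvg_cst|exact: cvg_id].
have cc : continuous (fun t : R => cos (x * t)).
  apply: (@continuous_comp_fun ( *%R x) cos); last exact: continuous_cos.
  by move=> t; apply: cvgM; [exact: cvg_cst|exact: cvg_id].
have cF : continuous (fun t : R => circ t ^+ m.+2) by apply: continuousX_fun; exact: continuous_circ.
have cG : continuous (fun t : R => x^-1 * sin (x * t)).
  by apply: continuousM_fun => // t; exact: cvg_cst.
have DG (t : R) : is_derive t 1 (fun t : R => x^-1 * sin (x * t)) (cos (x * t)).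
  have D1 : is_derive t 1 (fun u : R => x * u) x.
    apply: (@is_derive_eq _ _ _ _ _ _ _ _ (is_derive1M (is_derive_cst x t 1) (is_derive_id t 1))).
    by rewrite mul0r add0r mulr1.
  have D2 := @is_derive1_comp _ sin ( *%R x) t _ _ (is_derive_sin (x * t)) D1.
  apply: (@is_derive_eq _ _ _ _ _ _ _ _ (is_derive1M (is_derive_cst x^-1 t 1) D2)).
  by rewrite mul0r add0r mulrCA mulVf ?mulr1.
have := @Rintegration_by_parts R (fun t => circ t ^+ m.+2) (fun t => x^-1 * sin (x * t))
  (fun t => - (m.+2%:R * (t * circ t ^+ m))) (fun t => cos (x * t)) (-1) 1.
(* The boundary terms vanish because [circ] does at both ends. *)
have -> : circ 1 ^+ m.+2 = 0 by rewrite /circ expr1n subrr sqrtr0 expr0n.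
have -> : circ (-1) ^+ m.+2 = 0 by rewrite /circ sqrrN expr1n subrr sqrtr0 expr0n.
rewrite !mul0r subrr sub0r => ibp.
(* The derivative of [circ] is available in the open interval only; one-sided continuity takes care
   of the end points. *)
have oo (F f : R -> R) : continuous F ->
    (forall t : R, t \in `](-1)%R, 1%R[ -> is_derive t 1 F (f t)) ->
    derivable_oo_LRcontinuous F (-1) 1.
  move=> cF' DF; split.
  - by move=> t tI; exact: (@ex_derive _ _ _ _ _ _ _ (DF t tI)).
  - exact/cvg_at_right_filter/cF'.
  - exact/cvg_at_left_filter/cF'.
have {}ibp : \int[mu]_(t in `[(-1)%R, 1%R]) (circ t ^+ m.+2 * cos (x * t)) =
    - \int[mu]_(t in `[(-1)%R, 1%R]) (- (m.+2%:R * (t * circ t ^+ m)) * (x^-1 * sin (x * t))).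
  apply: ibp => //.
  - apply: continuous_subspaceT => t; apply: cvgN.
    by apply: cvgM; [exact: cvg_cst|exact: ctw].
  - exact: (oo _ _ cF is_derive_circX).
  - by move=> t tI; rewrite derive1E (@derive_val _ _ _ _ _ _ _ (is_derive_circX tI)).
  - exact: continuous_subspaceT.
  - exact: (oo _ _ cG (fun t _ => DG t)).
  - by move=> t tI; rewrite derive1E (@derive_val _ _ _ _ _ _ _ (DG t)).
have i0 : mu.-integrable `[(-1)%R, 1%R] (EFin \o (fun t => cos (x * t) * circ t ^+ m)).
  by apply: continuous_integrable; exact: continuousM_fun.
have i1 : mu.-integrable `[(-1)%R, 1%R] (EFin \o (fun t => - sin (x * t) * (t * circ t ^+ m))).
  apply: continuous_integrable; apply: continuousM_fun => // t.
  by apply: cvgN; exact: cs.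
have i2 : mu.-integrable `[(-1)%R, 1%R] (EFin \o (fun t => - cos (x * t) * (t * (t * circ t ^+ m)))).
  apply: continuous_integrable; apply: continuousM_fun => [t|].
    by apply: cvgN; exact: cc.
  by apply: continuousM_fun => // t; exact: cvg_id.
have I1 : bessel x + bessel_d2 x = \int[mu]_(t in `[(-1)%R, 1%R]) (circ t ^+ m.+2 * cos (x * t)).
  rewrite /bessel /bessel_d2 -RintegralD//; apply: eq_Rintegral => t; rewrite inE/= => tI.
  by rewrite -addn2 exprD circ_sqr//; ring.
have I2 : m.+2%:R / x * bessel_d1 x =
    \int[mu]_(t in `[(-1)%R, 1%R]) (- (m.+2%:R * (t * circ t ^+ m)) * (x^-1 * sin (x * t))).
  rewrite /bessel_d1 -RintegralZl//; apply: eq_Rintegral => t _; ring.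
by rewrite I2 -[X in _ - X]opprK -ibp -I1; ring.
Qed.

Let a : R := m.+2%:R / 2.

(* With a = (m+2)/2, the function v = x^a y satisfies v'' + (1 - (a^2 - a)/x^2) v = 0;
   this is v^2 + v'^2, and its logarithmic derivative is at most |a^2 - a|/x^2. *)
Definition energy x : R := x ^+ m.+2 * (bessel x ^+ 2 + (bessel_d1 x + a * (x^-1 * bessel x)) ^+ 2).

Lemma is_derive_energy (x : R) : 0 < x -> is_derive x 1 energy
  (x ^+ m.+2 * (2 * (a ^+ 2 - a) * ((bessel_d1 x + a * (x^-1 * bessel x)) * bessel x) / x ^+ 2)).
Proof.
move=> x0; have xn : x != 0 by rewrite gt_eqF.
have D0 := is_derive_bessel x; have D1 := is_derive_bessel_d1 x.
have Dv := is_derive1M (is_derive1_inv xn) D0.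
have Dw := is_deriveD D1 (is_derive1M (is_derive_cst a x 1) Dv).
have Dsum := is_deriveD (is_derive1M D0 D0) (is_derive1M Dw Dw).
have DE := is_derive1M (is_derive1X m.+1 x) Dsum.
rewrite (_ : energy = (fun t : R => t ^+ m.+2 *
   ((fun t => bessel t * bessel t) + (fun t => 
    (bessel_d1 + (fun t => a * (t^-1 * bessel t))) t *
    (bessel_d1 + (fun t => a * (t^-1 * bessel t))) t)) t)); last first.
  by apply/funext => t; rewrite /energy !expr2.
apply: (@is_derive_eq _ _ _ _ _ _ _ _ DE).
(* The equation removes the second derivative. With [m.+2%:R = 2 * a], differentiating the power of
   [x] cancels the damping terms, and only a term with [x ^- 2] survives. *)
rewrite !addrfctE /= bessel_ode//.
move: (bessel x) (bessel_d1 x) => u v.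
have -> : m.+2%:R = 2 * a by rewrite /a; field.
rewrite (exprS x m.+1); move: (x ^+ m.+1) (a) => q b.
by rewrite ?expr2; field.
Qed.

Let c : R := `|a ^+ 2 - a|.

(** Gronwall with an integrable rate: multiplying by [expR (c / x)], whose logarithmic derivative is
    [- c / x ^+ 2], makes the energy nonincreasing, since twice a product is at most the sum of the
    squares. *)
Lemma energy_le (x : R) : 1 <= x -> energy x <= energy 1 * expR c.
Proof.
move=> x1; have xp (t : R) : 1 <= t -> 0 < t by lra.
have E0 (t : R) : 0 < t -> 0 <= energy t.
  by move=> t0; rewrite mulr_ge0 ?addr_ge0 ?sqr_ge0// exprn_ge0// ltW.
pose h (t : R) := energy t * expR (c * t^-1).
have Dh (t : R) : 0 < t -> is_derive t 1 h
   ((t ^+ m.+2 * (2 * (a ^+ 2 - a) * ((bessel_d1 t + a * (t^-1 * bessel t)) * bessel t) / t ^+ 2)) * expR (c * t^-1) +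
    energy t * (expR (c * t^-1) * (0 * t^-1 + c * (- t ^- 2)))).
  move=> t0; have tn : t != 0 by rewrite gt_eqF.
  have D1 := is_derive1M (is_derive_cst c t 1) (is_derive1_inv tn).
  have D2 := @is_derive1_comp _ expR (fun t => c * t^-1) t _ _ (is_derive_expR (c * t^-1)) D1.
  exact: (is_derive1M (is_derive_energy t0) D2).
have h_le (t : R) : 0 < t -> (h^`()%classic : R -> R) t <= 0.
  move=> t0; rewrite derive1E (@derive_val _ _ _ _ _ _ _ (Dh t t0)) mul0r add0r.
  rewrite /energy; move: (bessel t) (bessel_d1 t + _) => u v.
  rewrite (_ : _ + _ = - (expR (c * t^-1) * t ^+ m.+2 / t ^+ 2 *
     (c * (u ^+ 2 + v ^+ 2) - 2 * (a ^+ 2 - a) * (v * u)))); last first.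
    by rewrite invrM ?unitfE ?gt_eqF// expr2; field; rewrite gt_eqF.
  rewrite oppr_le0 mulr_ge0//.
    by apply: divr_ge0; [apply: mulr_ge0; [exact: expR_ge0|]|]; rewrite exprn_ge0// ltW.
  rewrite subr_ge0.
  have := ler_norm (a ^+ 2 - a); have := ler_norm (- (a ^+ 2 - a)); rewrite normrN -/c.
  have : 0 <= (u - v) ^+ 2 by rewrite sqr_ge0.
  have : 0 <= (u + v) ^+ 2 by rewrite sqr_ge0.
  move: (a ^+ 2 - a) => b; nra.
have hx : h x <= h 1.
  apply: (@ler0_derive1_nincry _ h 1) => //.
  - by move=> t; rewrite in_itv/= andbT => t1; apply: (@ex_derive _ _ _ _ _ _ _ (Dh t _)); lra.
  - by move=> t; rewrite in_itv/= andbT => t1; apply: h_le; lra.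
  - apply: continuous_in_subspaceT => t; rewrite inE /= in_itv/= andbT => t1.
    apply: differentiable_continuous; apply/derivable1_diffP.
    by apply: (@ex_derive _ _ _ _ _ _ _ (Dh t _)); lra.
have -> : energy 1 * expR c = h 1 by rewrite /h invr1 mulr1.
apply: le_trans hx; rewrite /h ler_peMr ?E0 ?xp//.
by rewrite -expR0 ler_expR mulr_ge0 ?invr_ge0 ?normr_ge0// ltW// xp.
Qed.

Lemma bessel_decay : exists2 C : R, 0 <= C & forall x : R, 1 <= x -> x ^+ m.+2 * bessel x ^+ 2 <= C.
Proof.
exists (energy 1 * expR c) => [|x x1].
  by rewrite mulr_ge0 ?expR_ge0// mulr_ge0 ?addr_ge0 ?sqr_ge0 ?exprn_ge0.
apply: le_trans (energy_le x1); rewrite /energy ler_wpM2l ?exprn_ge0 ?lerDl ?sqr_ge0//.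
by lra.
Qed.

End bessel.

(** * The Fourier transform of a ball *)

(** The one change of variables used below: for slicing, for rotations combined with scalings, for
    [x] to [- x] and for translations. *)
Lemma integral_image d1 d2 (T1 : measurableType d1) (T2 : measurableType d2)
    (R : realType) (m1 : {measure set T1 -> \bar R}) (m2 : {measure set T2 -> \bar R})
    (phi : T1 -> T2) (c : R) (f : T2 -> \bar R) : 0 <= c ->
  measurable_fun setT phi ->
  (forall A, measurable A -> m1 (phi @^-1` A) = (c%:E * m2 A)%E) ->
  measurable_fun setT f -> (forall y, (0 <= f y)%E) ->
  (\int[m1]_x f (phi x) = c%:E * \int[m2]_y f y)%E.
Proof.
move=> c0 mphi mE mf f0.
rewrite -[c%:E]/((NngNum c0)%:num%:E) -ge0_integral_mscale//.
transitivity (\int[pushforward m1 phi]_y f y)%E.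
  by rewrite ge0_integral_pushforward// => y _.
by apply: eq_measure_integral => A mA _; exact: mE.
Qed.

Section ball_fourier.
Variables (R : realType).

Lemma leb_consE n (A : set (borel_rV R n.+1)) : measurable A ->
  (@lebesgue_measure R \x leb R n)%E (@rV_cons R n @^-1` A) =
        (1%:E * leb R n.+1 A)%E.
Proof.
move=> mA; rewrite mul1e lebE// /= /product_measure1.
apply: eq_integral => x _ /=; rewrite -lebE.
  by congr (leb _ _ _); apply/seteqP; split => v; rewrite /xsection /= inE.
by rewrite -[X in measurable X]setTI; apply: (measurable_rV_consr x).
Qed.

Lemma enorm_cons n (s : R) (v : 'rV[R]_n) :
  enorm (rV_cons (s, v) : 'rV[R]_n.+1) ^+ 2 = s ^+ 2 + enorm v ^+ 2.
Proof.
rewrite !enorm_sqr /dot big_ord_recl; congr (_ + _).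
  rewrite /rV_cons/=; have -> : ord0 = lshift n (0 : 'I_1) :> 'I_(1 + n) by exact: val_inj.
  by rewrite (@row_mxEl _ 1 1 n) mxE eqxx mulr1n expr2.
apply: eq_bigr => j _; rewrite /rV_cons/=.
have -> : lift ord0 j = rshift 1 j :> 'I_(1 + n) by exact: val_inj.
by rewrite (@row_mxEr _ 1 1 n).
Qed.

Definition ball_vol n : R := fine (leb R n (eball n 1)).

Lemma ball_volE n : leb R n (eball n 1) = (ball_vol n)%:E.
Proof. by rewrite fineK// ge0_fin_numE// leb_eball_lty. Qed.

Lemma ball_vol_gt0 n : 0 < ball_vol n.
Proof. by rewrite -lte_fin -ball_volE leb_eball_gt0. Qed.

(** Extends [leb_eball] to radius 0, the radius of the sections of the unit ball at heights -1 and
    1. *)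
Lemma leb_eball_ge0 n r : 0 <= r -> leb R n (eball n r) = (r ^+ n * ball_vol n)%:E.
Proof.
rewrite le_eqVlt => /predU1P[<-|r0]; last by rewrite leb_eball// ball_volE.
case: n => [|n].
  rewrite expr0 mul1r -ball_volE; congr (leb _ _ _); apply/seteqP; split => x _;
  by rewrite /eball /enorm /= big_ord0 sqrtr0.
rewrite expr0n mul0r; apply/eqP; rewrite eq_le measure_ge0 andbT.
apply/lee_addgt0Pr => e e0; rewrite add0e.
pose b := ball_vol n.+1; have b0 : 0 < b := ball_vol_gt0 n.+1.
(* As [s <= 1], the power [s ^+ n.+1] is at most [s], hence at most [e / b]. *)
pose s := Num.min 1 (e / b).
have s0 : 0 < s by rewrite lt_min ltr01 divr_gt0.
apply: (@le_trans _ _ (leb R n.+1 (eball n.+1 s))).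
  apply: le_measure; rewrite ?inE; [exact: measurable_eball|exact: measurable_eball|].
  by move=> x /= x0; apply: le_trans x0 (ltW s0).
rewrite leb_eball// ball_volE lee_fin -/b -ler_pdivlMr//.
apply: (@le_trans _ _ s); last by rewrite ge_min lexx orbT.
by rewrite exprS ler_piMr ?(ltW s0)// exprn_ile1 ?(ltW s0)// ge_min lexx.
Qed.

Lemma leb_section n (s : R) :
  leb R n [set v | eball n.+1 1 (rV_cons (s, v))] =
  (\1_(`[(-1)%R, 1%R]%classic : set R) s * (circ s ^+ n * ball_vol n))%:E.
Proof.
rewrite indicE; case: (boolP (s \in _)) => [|]; rewrite ?inE ?notin_setE /= in_itv /= => sI.
  rewrite mul1r -leb_eball_ge0; last exact: sqrtr_ge0.
  congr (leb _ _ _); apply/seteqP; split => v; rewrite /eball/=.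
    rewrite -(@ler_pXn2r _ 2) ?nnegrE ?enorm_ge0// enorm_cons => H.
    rewrite -(@ler_pXn2r _ 2) ?nnegrE ?enorm_ge0 ?sqrtr_ge0// circ_sqr ?in_itv//.
    by lra.
  rewrite -(@ler_pXn2r _ 2) ?nnegrE ?enorm_ge0 ?sqrtr_ge0// circ_sqr ?in_itv// => H.
  by rewrite -(@ler_pXn2r _ 2) ?nnegrE ?enorm_ge0// enorm_cons; lra.
rewrite mul0r (_ : [set v | _] = set0) ?measure0//.
apply/seteqP; split => // v; rewrite /eball/= => H.
apply: sI; have : enorm (rV_cons (s, v) : 'rV[R]_n.+1) ^+ 2 <= 1.
  by rewrite -[leRHS](expr1n R 2) lerXn2r ?nnegrE ?enorm_ge0.
by rewrite enorm_cons; have := sqr_ge0 (enorm (v : 'rV[R]_n)); nra.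
Qed.

(** Slicing orthogonally to the first axis: the integrand is constant on each slice, and the slice
    at height [s] has volume [circ s ^+ n * ball_vol n]. Adding 1 to the cosine makes Tonelli
    apply. *)
Lemma integral_unit_ball n (c : R) (j0 := 0 : 'I_n.+1) :
  (\int[leb R n.+1]_x (\1_(eball n.+1 1) x * (1 + cos (c * (x : 'rV[R]_n.+1) 0 j0)))%:E =
   (ball_vol n * (bessel n 0 + bessel n c))%:E)%E.
Proof.
have mB := @measurable_eball R n.+1 1.
have gE (u : R) : 0 <= 1 + cos u by have := cos_geN1 u; lra.
have mg : measurable_fun setT (fun u : R => 1 + cos (c * u)).
  apply: measurable_funD => //.
  by apply: (measurableT_comp (@measurable_cos R)); exact: measurable_funM.
have mf : measurable_fun setT (fun x : borel_rV R n.+1 =>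
    (\1_(eball n.+1 1) x * (1 + cos (c * (x : 'rV[R]_n.+1) 0 j0)))%:E).
  apply/measurable_EFinP; apply: measurable_funM; first exact: measurable_indic.
  exact: (measurableT_comp mg (measurable_coord j0)).
have f0 (x : borel_rV R n.+1) : (0 <= (\1_(eball n.+1 1) x * (1 + cos (c * (x : 'rV[R]_n.+1) 0 j0)))%:E)%E.
  by rewrite lee_fin mulr_ge0// gE.
rewrite -[LHS]mul1e -(integral_image ler01 (@measurable_rV_cons R n) (@leb_consE n) mf f0).
rewrite fubini_tonelli1/=; last 2 first.
- exact: (measurableT_comp mf (@measurable_rV_cons R n)).
- by move=> x; exact: f0.
- exact: (sigma_finiteT (@lebesgue_measure R)).
move=> _; rewrite /fubini_F/=.
transitivity (\int[@lebesgue_measure R]_s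
   (\1_(`[(-1)%R, 1%R]%classic : set R) s * (ball_vol n * ((1 + cos (c * s)) * circ s ^+ n)))%:E)%E.
  apply: eq_integral => s _.
  have s0 v : (rV_cons (s, v) : 'rV[R]_n.+1) 0 j0 = s.
    by have := rV_consK (s, v : borel_rV R n); case.
  under eq_integral do rewrite s0 EFinM muleC.
  have mS : measurable ([set v | eball n.+1 1 (rV_cons (s, v))] : set (borel_rV R n)).
    by rewrite -[X in measurable X]setTI; apply: (measurable_rV_consr s).
  rewrite ge0_integralZl//; last first.
    by apply/measurable_EFinP; exact: (measurable_indic mS).
  rewrite (_ : (fun v => _) = (fun v => (\1_[set v | eball n.+1 1 (rV_cons (s, v))] v)%:E))//.
  rewrite integral_indic// ?setIT.
  by rewrite leb_section -EFinM; congr EFin; ring.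
have mI : measurable (`[(-1)%R, 1%R]%classic : set (measurableTypeR R)).
  exact: measurable_itv.
transitivity (\int[@lebesgue_measure R]_(s in `[(-1)%R, 1%R])
   (ball_vol n * ((1 + cos (c * s)) * circ s ^+ n))%:E)%E.
  rewrite [RHS]integral_mkcond; apply: eq_integral => s _.
  by rewrite patchE indicE; case: ifP => _; rewrite ?mul1r ?mul0r.
have cc (u : R) : continuous (fun s : R => cos (u * s) * circ s ^+ n).
  apply: continuousM_fun; last by apply: continuousX_fun; exact: continuous_circ.
  apply: (@continuous_comp_fun _ ( *%R u) cos); last exact: continuous_cos.
  by move=> t; apply: cvgM; [exact: cvg_cst|exact: cvg_id].
have E : bessel n 0 + bessel n c = \int[@lebesgue_measure R]_(s in `[(-1)%R, 1%R])
    ((1 + cos (c * s)) * circ s ^+ n).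
  rewrite /bessel -RintegralD//; [|exact: continuous_integrable|exact: continuous_integrable].
  by apply: eq_Rintegral => s _; rewrite mul0r cos0 mulrDl.
have ci : continuous (fun s : R => (1 + cos (c * s)) * circ s ^+ n).
  move=> s; rewrite (_ : (fun s => _) = (fun s : R => cos (0 * s) * circ s ^+ n + cos (c * s) * circ s ^+ n)).
    by apply: cvgD; exact: cc.
  by apply/funext => t; rewrite mul0r cos0 mulrDl.
rewrite E -RintegralZl//; last exact: continuous_integrable.
rewrite /Rintegral fineK//.
apply: integrable_fin_num => //; apply: continuous_integrable.
by apply: continuousM_fun => // s; exact: cvg_cst.
Qed.

End ball_fourier.

Section ball_fourier2.
Variables (R : realType) (n : nat).
Implicit Types (k : 'rV[R]_n.+1) (r : R).

Lemma measurable_dot k :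
  measurable_fun setT (fun x : borel_rV R n.+1 => dot (x : 'rV[R]_n.+1) k).
Proof.
apply: measurable_sum => j; apply: measurable_funM => //.
exact: measurable_coord.
Qed.

(** An orthogonal map takes [k] to the first axis and a scaling by [r^-1] takes the ball to the unit
    ball. *)
Lemma integral_ball_cos k r : 0 < r ->
  (\int[leb R n.+1]_x (\1_(eball n.+1 r) x * (1 + cos (dot (x : 'rV[R]_n.+1) k)))%:E =
   (r ^+ n.+1 * (ball_vol R n * (bessel n 0 + bessel n (r * enorm k))))%:E)%E.
Proof.
move=> r0; have [G GG kG] := ex_rotation k 0.
pose phi (x : borel_rV R n.+1) : borel_rV R n.+1 := (r^-1 *: ((x : 'rV[R]_n.+1) *m G)).
have mphi : measurable_fun setT phi.
  apply: measurable_rV => j; rewrite /phi; under eq_fun do rewrite mxE.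
  apply: measurable_funM => //.
  by apply: (measurableT_comp (measurable_coord j)); exact: measurable_mulmx.
have phiE (A : set (borel_rV R n.+1)) : measurable A ->
    leb R n.+1 (phi @^-1` A) = ((r ^+ n.+1)%:E * leb R n.+1 A)%E.
  move=> mA; have rV : 0 < r^-1 by rewrite invr_gt0.
  have := leb_scale rV mA; rewrite exprVn invrK => <-.
  rewrite -[RHS](leb_orthogonal GG)//.
  rewrite -[X in measurable X]setTI; apply: (@measurable_rV R n.+1 _ _
    (fun x : borel_rV R n.+1 => (r^-1 *: (x : 'rV[R]_n.+1) : borel_rV R n.+1))) => // j.
  under eq_fun do rewrite mxE.
  by apply: measurable_funM => //; exact: measurable_coord.
rewrite EFinM -integral_unit_ball.
rewrite -(integral_image (exprn_ge0 _ (ltW r0)) mphi phiE); last 2 first.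
- apply/measurable_EFinP; apply: measurable_funM.
    by apply: measurable_indic; exact: measurable_eball.
  apply: measurable_funD => //; apply: (measurableT_comp (@measurable_cos R)).
  by apply: measurable_funM => //; exact: measurable_coord.
- by move=> y; rewrite lee_fin mulr_ge0.
apply: eq_integral => x _; congr ((_ * _)%:E).
  rewrite !indicE; congr ((nat_of_bool _)%:R).
  apply/idP/idP; rewrite !inE /eball/= enormZ enorm_mulmx// gtr0_norm ?invr_gt0//.
    by rewrite ler_pdivrMl// mulr1.
  by rewrite ler_pdivrMl// mulr1.
have -> : (phi x : 'rV[R]_n.+1) 0 0 = r^-1 * ((x : 'rV[R]_n.+1) *m G) 0 0 by rewrite mxE.
rewrite kG; congr (1 + cos _); rewrite mulrA; congr (_ * _).
by rewrite mulrAC mulfV ?mul1r// gt_eqF.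
Qed.

(** The sine is odd and the ball symmetric: the integrals of [1 + sin] and [1 - sin] are equal, and
    they add up to twice the volume. *)
Lemma integral_ball_sin k r : 0 < r ->
  (\int[leb R n.+1]_x (\1_(eball n.+1 r) x * (1 + sin (dot (x : 'rV[R]_n.+1) k)))%:E =
   leb R n.+1 (eball n.+1 r))%E.
Proof.
move=> r0; pose f (s : R) (x : borel_rV R n.+1) : \bar R :=
  (\1_(eball n.+1 r) x * (1 + s * sin (dot (x : 'rV[R]_n.+1) k)))%:E.
have mf s : measurable_fun setT (f s).
  apply/measurable_EFinP; apply: measurable_funM.
    by apply: measurable_indic; exact: measurable_eball.
  apply: measurable_funD => //; apply: measurable_funM => //.
  by apply: (measurableT_comp (@measurable_sin R)); exact: measurable_dot.
have f0 s x : -1 <= s <= 1 -> (0 <= f s x)%E.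
  move=> s1; rewrite lee_fin mulr_ge0//.
  have := sin_geN1 (dot (x : 'rV[R]_n.+1) k); have := sin_le1 (dot (x : 'rV[R]_n.+1) k).
  by move: (sin _) => u; nra.
have mN : measurable_fun setT (fun x : borel_rV R n.+1 => - (x : 'rV[R]_n.+1) : borel_rV R n.+1).
  apply: measurable_rV => j; under eq_fun do rewrite mxE.
  by apply: measurableT_comp => //; exact: measurable_coord.
have sym : (\int[leb R n.+1]_x f 1%R x = \int[leb R n.+1]_x f (-1)%R x)%E.
  have leN (A : set (borel_rV R n.+1)) : measurable A ->
      leb R n.+1 ((fun x : borel_rV R n.+1 => - (x : 'rV[R]_n.+1) : borel_rV R n.+1) @^-1` A) = (1%:E * leb R n.+1 A)%E.
    by move=> mA; rewrite mul1e leb_opp.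
  rewrite -[RHS]mul1e -(integral_image ler01 mN leN) => [||y]//; last first.
    by apply: f0; lra.
  apply: eq_integral => x _; rewrite /f; congr (_%:E); congr (_ * _).
    rewrite !indicE; congr ((nat_of_bool _)%:R).
    by apply/idP/idP; rewrite !inE /eball/= enormN.
  congr (1 + _); have -> : dot (- (x : 'rV[R]_n.+1)) k = - dot (x : 'rV[R]_n.+1) k.
    by rewrite -scaleN1r dotZl mulN1r.
  by rewrite sinN mulN1r opprK mul1r.
have two : (\int[leb R n.+1]_x f 1%R x + \int[leb R n.+1]_x f (-1)%R x = 2%:E * leb R n.+1 (eball n.+1 r))%E.
  rewrite -ge0_integralD//; last 2 first.
  - by move=> x _; apply: f0; lra.
  - by move=> x _; apply: f0; lra.
  rewrite -[X in (2%:E * leb R n.+1 X)%E]setIT -integral_indic//; last exact: measurable_eball.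
  rewrite -ge0_integralZl//; last first.
    by apply/measurable_EFinP; apply: measurable_indic; exact: measurable_eball.
  by apply: eq_integral => x _; rewrite /f -EFinD -EFinM; congr EFin; ring.
rewrite -sym in two.
transitivity (\int[leb R n.+1]_x f 1%R x)%E.
  by apply: eq_integral => x _; rewrite /f mul1r.
(* An infinite value is excluded because its double would be the finite volume of the ball. *)
move: two; rewrite leb_eball_ge0 ?ltW//; case: (\int[leb R n.+1]_x f 1%R x)%E => // u.
by rewrite -EFinM -EFinD => -[] H; congr EFin; lra.
Qed.

(** The case [k = 0] of [integral_ball_cos]. Writing the volume with [bessel n 0] makes it cancel
    against the constant 1 in [1 + cos]. *)
Lemma leb_ball_bessel r : 0 < r ->
  leb R n.+1 (eball n.+1 r) = (r ^+ n.+1 * (ball_vol R n * bessel n 0))%:E.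
Proof.
move=> r0; have := integral_ball_cos 0 r0; rewrite enorm0 mulr0.
under eq_integral => x _.
  rewrite (_ : cos _ = 1); last by rewrite -(scale0r 0) dotZr mul0r cos0.
  rewrite EFinM muleC; over.
rewrite ge0_integralZl//; last first.
  by apply/measurable_EFinP; apply: measurable_indic; exact: measurable_eball.
rewrite integral_indic ?setIT//; last exact: measurable_eball.
rewrite [X in ((1 + 1)%:E * X)%E](leb_eball_ge0 _ (ltW r0)).
rewrite (leb_eball_ge0 _ (ltW r0)) -EFinM => -[] H; congr EFin.
by move: H; lra.
Qed.

End ball_fourier2.

(** * Sums over a countable type and their integrals *)

Section esum_countable.
Variables (R : realType) (Z : countType).
Local Open Scope ereal_scope.

(** Turns the sum into a series over [nat], with 0 at the numbers that encode nothing, so that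
    monotone convergence for series applies. *)
Lemma esum_nat (f : Z -> \bar R) : (forall z, 0 <= f z) ->
  \esum_(z in [set: Z]) f z = \sum_(k <oo) (if pickle_inv k is Some z then f z else 0).
Proof.
move=> f0; rewrite nneseries_esumT; last by move=> k; case: pickle_inv.
transitivity (\esum_(k in @pickle Z @` setT) (if pickle_inv k is Some z then f z else 0)).
  rewrite (@reindex_esum _ _ _ [set: Z] _ pickle).
    by apply: eq_esum => z _; rewrite pickleK_inv.
  split; [by move=> z _; exists z|by move=> x y _ _ /(pcan_inj pickleK)|by []].
rewrite esum_mkcond; apply: eq_esum => k _; case: ifPn => //.
rewrite notin_setE => kN; case E: (pickle_inv k) => [z|//].
by exfalso; apply: kN; exists z => //; have := @pickle_invK Z k; rewrite E.
Qed.

Lemma esumZ (c : R) (f : Z -> \bar R) : (0 <= c)%R -> (forall z, 0 <= f z) ->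
  \esum_(z in [set: Z]) (c%:E * f z) = c%:E * \esum_(z in [set: Z]) f z.
Proof.
move=> c0 f0; rewrite !esum_nat// => [|z]; last by rewrite mule_ge0// lee_fin.
rewrite -nneseriesZl//; last by move=> k _; case: pickle_inv.
by apply: eq_eseriesr => k _; case: pickle_inv => //; rewrite mule0.
Qed.

Context d (T : measurableType d) (mu : {measure set T -> \bar R}).
Variable F : Z -> T -> \bar R.
Hypothesis mF : forall z, measurable_fun setT (F z).
Hypothesis F0 : forall z x, 0 <= F z x.

Lemma measurable_esum : measurable_fun setT (fun x => \esum_(z in [set: Z]) F z x).
Proof.
under eq_fun do rewrite esum_nat//.
apply: ge0_emeasurable_sum => k; last by case: pickle_inv.
by move=> x _ _; case: pickle_inv.
Qed.

Lemma integral_esum :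
  \int[mu]_x (\esum_(z in [set: Z]) F z x) = \esum_(z in [set: Z]) \int[mu]_x F z x.
Proof.
rewrite esum_nat; last by move=> z; apply: integral_ge0.
under eq_integral do rewrite esum_nat//.
rewrite integral_nneseries//; last 2 first.
- by move=> k; case: pickle_inv.
- by move=> k x _; case: pickle_inv.
by apply: eq_eseriesr => k _; case: pickle_inv => //; rewrite integral0.
Qed.

Lemma esum_single (f : Z -> \bar R) z0 : (forall z, z != z0 -> f z = 0) -> 0 <= f z0 ->
  \esum_(z in [set: Z]) f z = f z0.
Proof.
move=> f0 fz0; rewrite -(esum_set1 fz0) [RHS]esum_mkcond.
apply: eq_esum => z _; case: ifPn; rewrite ?notin_setE /= => zz //.
by apply: f0; apply/eqP.
Qed.

End esum_countable.

(** * Functions on the torus *)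

Section torus.
Variables (R : realType) (n : nat) (A : 'M[R]_n.+1).
Local Notation d := n.+1.
Hypothesis uA : A \in unitmx.
Local Notation B := (invmx A).
Local Notation Z := {ffun 'I_d -> int}.

Definition lat (z : Z) : 'rV[R]_d := (\row_j (z j)%:~R) *m A.

Lemma latD z y : lat (z + y) = lat z + lat y.
Proof.
rewrite /lat -mulmxDl; congr (_ *m _).
by apply/rowP => j; rewrite !mxE ffunE intrD.
Qed.

Lemma latN z : lat (- z) = - lat z.
Proof.
rewrite /lat -mulNmx; congr (_ *m _).
by apply/rowP => j; rewrite !mxE ffunE mulrNz.
Qed.

Lemma latB z : lat z *m B = \row_j (z j)%:~R.
Proof. by rewrite /lat mulmxK. Qed.

Definition cell : set 'rV[R]_d := [set x | forall j, 0 <= (x *m B) 0 j < 1].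

Lemma measurable_cell : measurable (cell : set (borel_rV R d)).
Proof.
rewrite (_ : cell = (fun x : borel_rV R d => (x : 'rV[R]_d) *m B : borel_rV R d) @^-1`
   (box (fun=> 0) (fun=> 1))) //.
rewrite -[X in measurable X]setTI; apply: measurable_mulmx => //.
exact: measurable_box.
Qed.

Definition cell_index (x : 'rV[R]_d) : Z := [ffun j => Num.floor ((x *m B) 0 j)].

Lemma cellP x z : cell (x - lat z) <-> z = cell_index x.
Proof.
split => [xz|->].
  apply/ffunP => j; rewrite ffunE; have := xz j.
  rewrite mulmxBl latB !mxE => H; apply/esym/floor_def.
  by rewrite intrD; move: H; lra.
move=> j; rewrite mulmxBl latB !mxE ffunE.
have := ge_floor ((x *m B) 0 j); have := floorD1_gt ((x *m B) 0 j).
by rewrite intrD; rewrite mxE; lra.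
Qed.

Definition cell_vol : R := fine (leb R d cell).

Lemma cell_bounded : exists2 K, 0 < K & forall x, cell x -> enorm x <= K.
Proof.
exists (1 + \sum_j \sum_i `|A i j|) => [|x xc].
  by rewrite ltr_pwDl// sumr_ge0// => j _; rewrite sumr_ge0.
apply: le_trans (enorm_le_sum _) _; rewrite -[leLHS]add0r lerD//.
apply: ler_sum => j _; rewrite -[x](mulmxKV uA) mxE.
apply: le_trans (ler_norm_sum _ _ _) _; apply: ler_sum => i _.
rewrite normrM ler_piMl//; have /andP[x0 x1] := xc i.
by rewrite ger0_norm// ltW.
Qed.

Lemma cell_volE : leb R d cell = cell_vol%:E.
Proof.
rewrite /cell_vol fineK// ge0_fin_numE//.
have [K K0 KP] := cell_bounded.
apply: (@leb_bounded _ _ _ K); first exact: measurable_cell.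
by move=> x /KP xK j; exact: le_trans (enorm_coord _ _) xK.
Qed.

(** [cell_vol] is the factor by which [x *m B] changes volumes. Were it 0, all preimages under this
    map would be null, and the unit ball is one of them. *)
Lemma cell_vol_gt0 : 0 < cell_vol.
Proof.
have uB : B \in unitmx by rewrite unitmx_inv.
have [c c0 cE] := leb_mulmx uB.
have cE1 : cell_vol = c.
  apply: EFin_inj; rewrite -cell_volE.
  have := cE _ (measurable_box (fun=> 0) (fun=> 1)).
  by rewrite leb_box// big1 ?mule1// => j _; rewrite subr0.
rewrite cE1 lt_def c0 andbT; apply/eqP => c00.
have mS : measurable [set y : borel_rV R d | eball d 1 ((y : 'rV[R]_d) *m A)].
  rewrite -[X in measurable X]setTI; apply: (measurable_mulmx A) => //.
  exact: measurable_eball.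
have := cE _ mS; rewrite c00 mul0e.
rewrite (_ : [set x | _] = eball d 1); last first.
  by apply/seteqP; split => x /=; rewrite mulmxKV.
by move=> H; have := @leb_eball_gt0 R d 1 ltr01; rewrite H ltxx.
Qed.

Variable nu : probability (borel_rV R d) R.
Hypothesis nuE : forall C, measurable C ->
  nu C = (cell_vol^-1%:E * leb R d (C `&` cell))%E.


Lemma integral_nu (f : borel_rV R d -> \bar R) : measurable_fun setT f ->
  (forall x, 0 <= f x)%E ->
  (\int[nu]_x f x = cell_vol^-1%:E * \int[leb R d]_x ((\1_cell x)%:E * f x))%E.
Proof.
move=> mf f0; have mC := measurable_cell; have v0 := cell_vol_gt0.
have vi : 0 <= cell_vol^-1 by rewrite invr_ge0 ltW.
rewrite (@ge0_negligible_integral _ _ _ nu setT (~` cell))//; last 2 first.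
- exact: measurableC.
- have := nuE (measurableC mC); rewrite setICl (_ : leb R d set0 = 0%E) ?mule0//; exact: measure0.
rewrite setTD setCK.
transitivity (\int[mscale (NngNum vi) (leb R d)]_(x in cell) f x)%E.
  apply: eq_measure_integral => C mC' CD.
  by rewrite [LHS]nuE// setIidl.
rewrite ge0_integral_mscale//; last exact: measurable_funTS.
congr (_ * _)%E; rewrite integral_mkcond; apply: eq_integral => x _.
by rewrite patchE indicE; case: ifP => _; rewrite ?mul1e ?mul0e.
Qed.

Lemma measurable_lat_shift (f : borel_rV R d -> \bar R) z : measurable_fun setT f ->
  measurable_fun setT (fun x : borel_rV R d => f ((x : 'rV[R]_d) + lat z)%R).
Proof. by move=> mf; apply: (measurableT_comp mf); exact: measurable_shift. Qed.

(** Unfolding: each term is moved to its own translate of the cell, and these translates tile the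
    space. *)
Lemma integral_esum_lat (f : borel_rV R d -> \bar R) : measurable_fun setT f ->
  (forall x, 0 <= f x)%E ->
  (\int[nu]_x (\esum_(z in [set: Z]) f ((x : 'rV[R]_d) + lat z)%R) =
   cell_vol^-1%:E * \int[leb R d]_x f x)%E.
Proof.
move=> mf f0.
have mfz z := @measurable_lat_shift f z mf.
have mC := measurable_cell.
rewrite integral_nu//; last 2 first.
- by apply: measurable_esum => // z x.
- by move=> x; apply: esum_ge0.
congr (_ * _)%E.
transitivity (\int[leb R d]_x (\esum_(z in [set: Z]) ((\1_cell x)%:E * f ((x : 'rV[R]_d) + lat z)%R)))%E.
  by apply: eq_integral => x _; rewrite esumZ.
have mg : measurable_fun setT (fun x : borel_rV R d => (\1_cell x)%:E : \bar R).
  by apply/measurable_EFinP; exact: measurable_indic.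
rewrite integral_esum; last 2 first.
- by move=> z; apply: emeasurable_funM.
- by move=> z x; rewrite mule_ge0// lee_fin.
transitivity (\esum_(z in [set: Z]) \int[leb R d]_x ((\1_cell ((x : 'rV[R]_d) - lat z)%R)%:E * f x))%E.
  apply: eq_esum => z _.
  have h := @integral_image _ _ _ _ R (leb R d) (leb R d) (fun x : borel_rV R d => (x : 'rV[R]_d) + lat z) 1
    (fun x : borel_rV R d => (\1_cell ((x : 'rV[R]_d) - lat z)%R)%:E * f x)%E ler01 (measurable_shift _).
  rewrite mul1e in h; rewrite -h.
  - by apply: eq_integral => x _; rewrite (addrK (lat z) (x : 'rV[R]_d)).
  - by move=> C mC'; rewrite mul1e; exact: leb_shift.
  - apply: emeasurable_funM => //; apply: (measurableT_comp mg); exact: measurable_shift.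
  - by move=> x; rewrite mule_ge0// lee_fin.
rewrite -integral_esum; last 2 first.
- move=> z; apply: emeasurable_funM => //; apply: (measurableT_comp mg); exact: measurable_shift.
- by move=> z x; rewrite mule_ge0// lee_fin.
apply: eq_integral => x _.
rewrite (@esum_single _ _ _ (cell_index x)).
- by rewrite indicE mem_set ?mul1e//; apply/cellP.
- by move=> z zx; rewrite indicE memNset ?mul0e// => /cellP; exact/eqP.
- by rewrite mule_ge0// lee_fin.
Qed.

(** Unfolding backwards: [x] to [g (x + y)] is the periodization of [g] restricted to the cell and
    translated by [y], and its integral over the whole space is insensitive to [y]. *)
Lemma ge0_nu_inv (g : borel_rV R d -> \bar R) (y : 'rV[R]_d) : measurable_fun setT g ->
  (forall x, 0 <= g x)%E -> (forall x z, g ((x : 'rV[R]_d) + lat z)%R = g x) ->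
  (\int[nu]_x g ((x : 'rV[R]_d) + y)%R = \int[nu]_x g x)%E.
Proof.
move=> mg g0 gp; have mC := measurable_cell.
have mc : measurable_fun setT (fun x : borel_rV R d => (\1_cell x)%:E : \bar R).
  by apply/measurable_EFinP; exact: measurable_indic.
have mf : measurable_fun setT (fun x : borel_rV R d => (\1_cell x)%:E * g x)%E.
  exact: emeasurable_funM.
have f0 x : (0 <= (\1_cell x)%:E * g x)%E by rewrite mule_ge0// lee_fin.
rewrite [RHS]integral_nu//.
have h := @integral_image _ _ _ _ R (leb R d) (leb R d) (fun x : borel_rV R d => (x : 'rV[R]_d) + y) 1
    (fun x : borel_rV R d => (\1_cell x)%:E * g x)%E ler01 (measurable_shift _).
rewrite mul1e in h; rewrite -h//; last by move=> C mC'; rewrite mul1e; exact: leb_shift.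
rewrite -integral_esum_lat; last 2 first.
- by apply: (measurableT_comp mf); exact: measurable_shift.
- by move=> x; exact: f0.
apply: eq_integral => x _.
rewrite (@esum_single _ _ _ (- cell_index ((x : 'rV[R]_d) + y)%R)).
- have E : x + lat (- cell_index (x + y)) + y = x + y + lat (- cell_index (x + y)) by rewrite addrAC.
  rewrite E gp indicE mem_set ?mul1e// latN; exact/cellP.
- move=> z zx.
  have E : x + lat z + y = x + y - lat (- z) by rewrite addrAC latN opprK.
  rewrite E indicE memNset ?mul0e// => /cellP zE.
  by case/eqP: zx; rewrite -zE opprK.
- exact: f0.
Qed.

(** Adding the bound [M] reduces to the nonnegative case. *)
Lemma nu_inv (f : borel_rV R d -> R) : bmeas f -> lattice_periodic B f ->
  forall y : 'rV[R]_d, Ex nu (fun x => f ((x : 'rV[R]_d) + y)%R) = Ex nu f.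
Proof.
move=> bf pf y; have [mf [M fM]] := bf.
have bfy : bmeas (fun x : borel_rV R d => f ((x : 'rV[R]_d) + y)%R).
  by apply: (bmeas_comp
    (h := fun x : borel_rV R d => (x : 'rV[R]_d) + y : borel_rV R d)) bf; exact: measurable_shift.
have bM : bmeas (fun _ : borel_rV R d => M) by exact: bmeas_cst.
apply: (addIr M); rewrite -{1}(Ex_cst nu M) -ExD// -[in RHS](Ex_cst nu M) -ExD//.
apply: EFin_inj; rewrite -!ExE; [|exact: bmeasD..].
apply: (@ge0_nu_inv (fun x => (f x + M)%:E)).
- by apply/measurable_EFinP; apply: measurable_funD.
- by move=> x; rewrite lee_fin; have := fM x; rewrite ler_norml; lra.
- move=> x z; congr ((_ + _)%:E); apply: pf => j; exists (z j).
  by rewrite latB mxE.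
Qed.

End torus.

Lemma esum_seq (R : realType) (Z : choiceType) (s : seq Z) (f : Z -> R) : uniq s ->
  (forall z, 0 <= f z) -> (forall z, z \notin s -> f z = 0) ->
  (\esum_(z in [set: Z]) (f z)%:E = (\sum_(z <- s) f z)%:E)%E.
Proof.
move=> us f0 fs.
transitivity (\esum_(z in [set` s]) (f z)%:E)%E.
  rewrite [RHS]esum_mkcond; apply: eq_esum => z _; rewrite mem_setE.
  by case: ifPn => // /fs ->.
rewrite esum_fset//; last by move=> z _; rewrite lee_fin.
by rewrite -fsbig_seq// sumEFin.
Qed.

Section count.
Variables (R : realType) (n : nat) (A : 'M[R]_n.+1).
Local Notation d := n.+1.
Hypothesis uA : A \in unitmx.
Local Notation B := (invmx A).
Local Notation Z := {ffun 'I_d -> int}.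
Local Notation lat := (lat A).
Local Notation cell := (cell A).
Local Notation cell_vol := (cell_vol A).
Implicit Types (S : set 'rV[R]_d) (x y : 'rV[R]_d).

Lemma mulmx_coord_le (G : 'M[R]_d) x j : `|(x *m G) 0 j| <= enorm x * \sum_i \sum_l `|G i l|.
Proof.
rewrite mxE mulr_sumr; apply: le_trans (ler_norm_sum _ _ _) _.
apply: ler_sum => i _; rewrite normrM ler_pM//; first exact: enorm_coord.
by rewrite (bigD1 j)//= lerDl sumr_ge0.
Qed.

Lemma lattice_window K : exists2 s : seq Z, uniq s &
  forall x z, cell x -> enorm (x + lat z) <= K -> z \in s.
Proof.
(* The coordinates of [x + lat z] are bounded by a multiple of [K] and those of [x] lie in [[0, 1)],
   whence the extra 1. *)
pose N := Num.truncn (K * \sum_i \sum_l `|B i l| + 1).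
pose g (m : {ffun 'I_d -> 'I_(N.*2.+1)}) : Z := [ffun j => (m j)%:Z - N%:Z].
exists (undup [seq g m | m : {ffun 'I_d -> 'I_(N.*2.+1)}]); first exact: undup_uniq.
move=> x z xc zK; rewrite mem_undup.
have zN j : `|z j| <= N%:Z.
  have := mulmx_coord_le B (x + lat z) j; rewrite mulmxDl latB// mxE [X in `|_ + X|]mxE.
  move=> H; have /andP[x0 x1] := xc j.
  have zle : `|z j|%:~R <= K * \sum_i \sum_l `|B i l| + 1.
    rewrite intr_norm.
    have Kle : enorm (x + lat z) * (\sum_i \sum_l `|B i l|) <= K * \sum_i \sum_l `|B i l|.
      by rewrite ler_wpM2r// sumr_ge0// => i _; rewrite sumr_ge0.
    by move: H; rewrite !ler_norml; lra.
  have K0 : 0 <= K * \sum_i \sum_l `|B i l| + 1 by apply: le_trans zle; rewrite ler0z.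
  have := truncn_itv K0 => /andP[_ /(le_lt_trans zle)].
  by rewrite -/N -[(N.+1)%:R]/((N.+1%:Z)%:~R) ltr_int; lia.
have lt j : (absz (z j + N%:Z)%R < N.*2.+1)%N by have := zN j; lia.
apply/mapP; exists [ffun j => Ordinal (lt j)]; first by rewrite mem_enum.
by apply/ffunP => j; rewrite !ffunE/=; have := zN j; lia.
Qed.

(** For bounded [S] the sum is finite ([countE]), so [fine] loses nothing. *)
Definition count S x : R := fine (\esum_(z in [set: Z]) (\1_S (x + lat z))%:E)%E.

Lemma esum_lat_periodic S x z0 :
  (\esum_(z in [set: Z]) (\1_S (x + lat z0 + lat z))%:E =
   \esum_(z in [set: Z]) (\1_S (x + lat z))%:E :> \bar R)%E.
Proof.
rewrite [RHS](@reindex_esum _ _ _ [set: Z] _ (fun z => z0 + z)).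
  by apply: eq_esum => z _; rewrite latD addrA.
rewrite setTT_bijective; exists (fun z => - z0 + z) => z; first exact: addKr.
exact: addNKr.
Qed.

Lemma count_lat S x z : count S (x + lat z) = count S x.
Proof. by rewrite /count esum_lat_periodic. Qed.

Lemma lattice_lat x : (forall j, exists z : int, (x *m B) 0 j = z%:~R) ->
  exists z, x = lat z.
Proof.
move=> /choice[z xz]; exists [ffun j => z j].
apply: (can_inj (mulmxKV uA)); rewrite latB//.
by apply/rowP => j; rewrite xz !mxE ffunE.
Qed.

Lemma periodic_of_lat (f : 'rV[R]_d -> R) : (forall x z, f (x + lat z) = f x) ->
  lattice_periodic B f.
Proof. by move=> fp x l /lattice_lat[z ->]. Qed.

Lemma lat_of_periodic (f : 'rV[R]_d -> R) : lattice_periodic B f ->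
  forall x z, f (x + lat z) = f x.
Proof. by move=> fp x z; apply: fp => j; exists (z j); rewrite latB// mxE. Qed.

Lemma to_cell (Q : 'rV[R]_d -> Prop) : (forall x z, Q x -> Q (x + lat z)) ->
  (forall x, cell x -> Q x) -> forall x, Q x.
Proof.
move=> Qp Qc x; rewrite -[x](subrK (lat (cell_index A x))).
by apply: Qp; apply: Qc; apply/cellP.
Qed.

Section bounded_set.
Variables (S : set 'rV[R]_d) (K : R).
Hypothesis SK : S `<=` eball d K.

Lemma count_seq : exists2 s : seq Z, uniq s & forall x, cell x ->
  (\esum_(z in [set: Z]) (\1_S (x + lat z))%:E = (\sum_(z <- s) \1_S (x + lat z))%:E :> \bar R)%E.
Proof.
have [s us sP] := lattice_window K; exists s => // x xc; apply: esum_seq => // z zs.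
rewrite indicE memNset// => /SK; rewrite /eball/= => zK.
by rewrite (sP x) in zs.
Qed.

Lemma countE x : ((count S x)%:E = \esum_(z in [set: Z]) (\1_S (x + lat z))%:E)%E.
Proof.
move: x; apply: to_cell => [x z|x xc]; first by rewrite count_lat esum_lat_periodic.
by have [s _ sP] := count_seq; rewrite /count sP.
Qed.

Lemma count_ge0 x : 0 <= count S x.
Proof. by rewrite -lee_fin countE esum_ge0. Qed.

Hypothesis mS : measurable (S : set (borel_rV R d)).

Lemma bmeas_count : bmeas (count S : borel_rV R d -> R).
Proof.
split.
  apply/measurable_EFinP; rewrite (_ : EFin \o _ = fun x : borel_rV R d =>
     (\esum_(z in [set: Z]) (\1_S ((x : 'rV[R]_d) + lat z)%R)%:E)%E); last first.
    by apply/funext => x /=; rewrite countE.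
  apply: measurable_esum => [z|z x //].
  apply/measurable_EFinP; apply: (measurableT_comp (measurable_indic mS)).
  exact: measurable_shift.
have [s us sP] := count_seq; exists (size s)%:R; apply: to_cell => [x z|x xc].
  by rewrite count_lat.
rewrite ger0_norm ?count_ge0// /count sP//=.
rewrite -sum1_size natr_sum; apply: ler_sum => z _.
by rewrite indicE; case: (_ \in _).
Qed.

Variable nu : probability (borel_rV R d) R.
Hypothesis nuE : forall C, measurable C ->
  nu C = (cell_vol^-1%:E * leb R d (C `&` cell))%E.

(** For periodic [g], the function [count S x * g x] is the periodization of [\1_S x * g x]; Fourier
    coefficients of the count thus become integrals over [S]. *)
Lemma Ex_countM (g : borel_rV R d -> R) : bmeas g -> (forall x, 0 <= g x) ->
  lattice_periodic B g ->
  ((Ex nu (fun x => count S x * g x))%:E =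
   cell_vol^-1%:E * \int[leb R d]_x (\1_S x * g x)%:E)%E.
Proof.
move=> bg g0 pg.
have mf : measurable_fun setT (fun x : borel_rV R d => (\1_S x * g x)%:E).
  apply/measurable_EFinP; apply: measurable_funM; first exact: measurable_indic.
  by case: bg.
have f0 x : (0 <= (\1_S x * g x)%:E)%E by rewrite lee_fin mulr_ge0.
rewrite -(integral_esum_lat uA nuE mf f0).
rewrite -ExE; last by apply: bmeasM => //; exact: bmeas_count.
apply: eq_integral => x _; rewrite EFinM muleC countE -esumZ//.
by apply: eq_esum => z _; rewrite (lat_of_periodic pg) EFinM muleC.
Qed.

Lemma Ex_count : ((Ex nu (count S))%:E = cell_vol^-1%:E * leb R d S)%E.
Proof.
have := Ex_countM (bmeas_cst _ 1) (fun=> ler01) (fun _ _ _ => erefl).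
under eq_Ex do rewrite mulr1.
move=> ->; congr (_ * _)%E; under eq_integral do rewrite mulr1.
by rewrite integral_indic// setIT.
Qed.

End bounded_set.
End count.

(** * Lattice points in balls and shells *)

Section shell.
Variables (R : realType) (d : nat).

Definition shell (s t : R) : set 'rV[R]_d := eball d t `\` eball d s.

Lemma measurable_shell s t : measurable (shell s t : set (borel_rV R d)).
Proof. by apply: measurableD; exact: measurable_eball. Qed.

Lemma ler_subX (s t : R) : 0 <= s -> s <= t ->
  t ^+ d - s ^+ d <= d%:R * (t - s) * t ^+ d.-1.
Proof.
move=> s0 st; rewrite subrXX -[in d%:R](card_ord d) -mulrA mulrCA.
rewrite ler_wpM2l ?subr_ge0// mulr_natl -sumr_const.
apply: ler_sum => -[i id] _ /=.
have t0 := le_trans s0 st.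
rewrite [X in t ^+ X](_ : d.-1 = (d.-1 - i) + i)%N; last by rewrite subnK//; lia.
by rewrite exprD ler_wpM2l ?exprn_ge0// lerXn2r.
Qed.

Lemma leb_shell s t : 0 <= s -> s <= t ->
  (leb R d (shell s t) <= (d%:R * (t - s) * t ^+ d.-1 * ball_vol R d)%:E)%E.
Proof.
move=> s0 st.
have le_st : eball d s `<=` eball d t by move=> x /le_trans; exact.
rewrite /shell measureD ?leb_eball_lty//; try exact: measurable_eball.
rewrite setIidr// [X in (X - _ <= _)%E](leb_eball_ge0 d (le_trans s0 st)).
rewrite [X in (_ - X <= _)%E](leb_eball_ge0 d s0).
rewrite -EFinB lee_fin -mulrBl ler_wpM2r ?(ltW (ball_vol_gt0 R d))//.
exact: ler_subX.
Qed.

End shell.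
Arguments shell {R} d s t.

(** Used with [m = d], [p = d - 1] and [q = d + 1]: the factor [r ^ (2 d)] from the squared volume
    scaling meets [r ^ -(d+1)] from the decay and leaves [r ^ (d-1)]. *)
Lemma decay_scaling (R : realType) (m p q : nat) (a b c r s D : R) : r != 0 ->
  (m + m = p + q)%N ->
  (a * (r ^+ m * b)) ^+ 2 * (D * (r * (c * s)) ^- q) =
  (a * b) ^+ 2 * (D * c ^- q) * r ^+ p * s ^- q.
Proof.
move=> r0 mpq.
have rm : (r ^+ m) ^+ 2 = r ^+ p * r ^+ q by rewrite expr2 -!exprD mpq.
have rq : r ^+ q * r ^- q = 1 by rewrite divff// expf_neq0.
rewrite !exprMn rm !invfM -!exprVn.
move: rq; rewrite -!exprVn => rq.
transitivity (a ^+ 2 * b ^+ 2 * (D * c^-1 ^+ q) * r ^+ p * s^-1 ^+ q * (r ^+ q * r^-1 ^+ q)).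
  by move: (r ^+ q) (r^-1 ^+ q) (c^-1 ^+ q) (s^-1 ^+ q) (r ^+ p) => *; ring.
by rewrite rq mulr1.
Qed.

(** * Variance of the number of lattice points in a randomly shifted ball *)

Section count_variance.
Variables (R : realType) (n : nat) (A : 'M[R]_n.+1).
Local Notation d := n.+1.
Hypothesis uA : A \in unitmx.
Local Notation B := (invmx A).
Local Notation Z := {ffun 'I_d -> int}.
Local Notation lat := (lat A).
Local Notation cell := (cell A).
Local Notation cell_vol := (cell_vol A).
Local Notation shell := (shell d).
Variable nu : probability (borel_rV R d) R.
Hypothesis nuE : forall C, measurable C ->
  nu C = (cell_vol^-1%:E * leb R d (C `&` cell))%E.
Implicit Types (x y : 'rV[R]_d) (k : 'I_d -> int).

(** The vector of the dual lattice, times 2 pi, that represents [phase B k] as a scalar product. *)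
Definition freq k : 'rV[R]_d := (pi *+ 2) *: ((\row_j (k j)%:~R) *m B^T).

Lemma phase_dot k x : phase B k x = dot x (freq k).
Proof.
rewrite /freq dotZr /phase; congr (_ * _).
rewrite dotC dotE -mulmxA -trmx_mul mxE; apply: eq_bigr => j _.
by rewrite !mxE.
Qed.

(** Multiplying [freq k] by [A^T] recovers [k] up to the factor 2 pi, so the norm of [freq k] cannot
    be much smaller than that of [k]. *)
Lemma enorm_freq_ge : exists2 c : R, 0 < c & forall k, c * (sup_norm k)%:R <= enorm (freq k).
Proof.
pose a := \sum_i \sum_l `|A^T i l|; have a0 : 0 <= a.
  by apply: sumr_ge0 => i _; apply: sumr_ge0.
have pi0 := @pi_gt0 R; have pi2 : 0 < pi *+ 2 :> R by rewrite mulr2n; lra.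
exists (pi / (1 + a)) => [|k]; first by rewrite divr_gt0// ltr_pwDl.
have [j0 kj0] : exists j, sup_norm k = absz (k j).
  have [|j jk] := @bigop.eq_bigmax 'I_d (fun j => absz (k j)); first by rewrite card_ord.
  by exists j.
rewrite kj0 mulrAC ler_pdivrMr ?ltr_pwDl//.
have -> : (absz (k j0))%:R = `|(k j0)%:~R| :> R by rewrite natr_absz intr_norm.
have E : (k j0)%:~R = (pi *+ 2)^-1 * (freq k *m A^T) 0 j0.
  rewrite /freq -scalemxAl -mulmxA -trmx_mul mulmxV// trmx1 mulmx1 !mxE mulKf//.
  by rewrite gt_eqF.
rewrite E normrM gtr0_norm ?invr_gt0//.
have := mulmx_coord_le A^T (freq k) j0; rewrite -/a => H.
have : pi * ((pi *+ 2)^-1 * `|(freq k *m A^T) 0 j0|) <= `|(freq k *m A^T) 0 j0|.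
  by rewrite mulrA ler_piMl// -mulr_natr invfM mulrA divff ?gt_eqF// mul1r invf_le1//; lra.
have := enorm_ge0 (freq k); nra.
Qed.

Section ball.
Variables (r : R) (r0 : 0 < r).
Local Notation N := (count A (eball d r)).

Let bN : bmeas (N : borel_rV R d -> R) :=
  bmeas_count uA (@subset_refl _ (eball d r)) (@measurable_eball R d r).

Lemma count_bmeas : bmeas (N : borel_rV R d -> R). Proof. exact: bN. Qed.

Lemma count_cos k : Ex nu (fun x => N x * cos (phase B k x)) =
  cell_vol^-1 * (r ^+ d * (ball_vol R n * bessel n (r * enorm (freq k)))).
Proof.
have bc := bmeas_cos B k.
have H1 : (Ex nu (fun x => N x * (1 + cos (phase B k x))))%:E =
    (cell_vol^-1 * (r ^+ d * (ball_vol R n * (bessel n 0 + bessel n (r * enorm (freq k))))))%:E.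
  rewrite [LHS](Ex_countM uA (@subset_refl _ (eball d r)) (@measurable_eball R d r) nuE).
  - rewrite [RHS]EFinM -integral_ball_cos//; congr (_ * _)%E.
    by apply: eq_integral => x _; rewrite phase_dot.
  - by apply: bmeasD => //; exact: bmeas_cst.
  - by move=> x; have := cos_geN1 (phase B k x); lra.
  - by move=> x l /(cos_phase_periodic k x) ->.
have H0 := Ex_count uA (@subset_refl _ (eball d r)) (@measurable_eball R d r) nuE.
rewrite leb_ball_bessel// -EFinM in H0; move: H0 H1 => [H0] [].
have -> : Ex nu (fun x => N x * (1 + cos (phase B k x))) =
    Ex nu N + Ex nu (fun x => N x * cos (phase B k x)).
  rewrite -ExD//; last exact: bmeasM.
  by apply: eq_Ex => x; rewrite mulrDr mulr1.
by rewrite H0; lra.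
Qed.

Lemma count_sin k : Ex nu (fun x => N x * sin (phase B k x)) = 0.
Proof.
have bc := bmeas_sin B k.
have H1 : (Ex nu (fun x => N x * (1 + sin (phase B k x))))%:E = (Ex nu N)%:E.
  rewrite [LHS](Ex_countM uA (@subset_refl _ (eball d r)) (@measurable_eball R d r) nuE).
  - rewrite [RHS](Ex_count uA (@subset_refl _ (eball d r)) (@measurable_eball R d r) nuE).
    rewrite -(integral_ball_sin (freq k))//; congr (_ * _)%E.
    by apply: eq_integral => x _; rewrite phase_dot.
  - by apply: bmeasD => //; exact: bmeas_cst.
  - by move=> x; have := sin_geN1 (phase B k x); lra.
  - by move=> x l /(sin_phase_periodic k x) ->.
move: H1 => [].
have -> : Ex nu (fun x => N x * (1 + sin (phase B k x))) =
    Ex nu N + Ex nu (fun x => N x * sin (phase B k x)).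
  rewrite -ExD//; last exact: bmeasM.
  by apply: eq_Ex => x; rewrite mulrDr mulr1.
lra.
Qed.

(** The constant [m] only affects the zero frequency, and the sine part vanishes by symmetry of the
    ball. *)
Lemma coef2_count m k : ~~ null_freq k -> coef2 B nu (fun x => N x - m) k =
  (cell_vol^-1 * (r ^+ d * (ball_vol R n * bessel n (r * enorm (freq k))))) ^+ 2.
Proof.
move=> k0; have bc := bmeas_cos B k; have bs := bmeas_sin B k.
have uB : B \in unitmx by rewrite unitmx_inv.
rewrite /coef2.
have -> : Ex nu (fun x => (N x - m) * cos (phase B k x)) =
    Ex nu (fun x => N x * cos (phase B k x)) - m * Ex nu (fun x => cos (phase B k x)).
  rewrite -ExZ// -ExB//; [|exact: bmeasM|exact: bmeasZ].
  by apply: eq_Ex => x; rewrite mulrBl.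
have -> : Ex nu (fun x => (N x - m) * sin (phase B k x)) =
    Ex nu (fun x => N x * sin (phase B k x)) - m * Ex nu (fun x => sin (phase B k x)).
  rewrite -ExZ// -ExB//; [|exact: bmeasM|exact: bmeasZ].
  by apply: eq_Ex => x; rewrite mulrBl.
rewrite count_cos count_sin.
rewrite (Ex_cos uB (nu_inv uA nuE)) (Ex_sin uB (nu_inv uA nuE)) (negbTE k0).
by rewrite !mulr0 !subr0 expr0n addr0.
Qed.

Lemma ball_indic_shift e x y : enorm y <= e ->
  `|\1_(eball d r) x - \1_(eball d r) (x + y)| <= \1_(shell (r - e) (r + e)) x :> R.
Proof.
move=> ye; have := enormD x y; have := enormDl x y; rewrite !indicE.
case: (boolP (x \in eball d r)); case: (boolP (x + y \in eball d r));
  rewrite ?notin_setE ?in_setE /eball/= => H1 H2 H3 H4; rewrite ?subrr ?normr0//.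
- by rewrite subr0 normr1 mem_set// /shell /eball/=; split; lra.
- by rewrite sub0r normrN normr1 mem_set// /shell /eball/=; split; lra.
Qed.

Lemma count_shift e x y : enorm y <= e ->
  `|N x - N (x + y)| <= count A (shell (r - e) (r + e)) x.
Proof.
move=> ye.
have sB : shell (r - e) (r + e) `<=` eball d (r + e) by move=> ? [].
have key u v : (forall z, \1_(eball d r) (u + lat z) <=
    \1_(eball d r) (v + lat z) + \1_(shell (r - e) (r + e)) (x + lat z) :> R) ->
    N u <= N v + count A (shell (r - e) (r + e)) x.
  move=> H; rewrite -lee_fin EFinD.
  rewrite (countE uA (@subset_refl _ (eball d r)) u) (countE uA (@subset_refl _ (eball d r)) v) (countE uA sB x).
  by rewrite -esumD//; apply: le_esum => z _; rewrite -EFinD lee_fin.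
have D z : `|\1_(eball d r) (x + lat z) - \1_(eball d r) (x + y + lat z)|
    <= \1_(shell (r - e) (r + e)) (x + lat z) :> R.
  by rewrite addrAC; exact: ball_indic_shift.
have H1 := @key x (x + y); have H2 := @key (x + y) x.
have {}H1 := H1 (fun z => ltac:(have := D z; rewrite ler_norml; lra)).
have {}H2 := H2 (fun z => ltac:(have := D z; rewrite ler_norml; lra)).
by rewrite ler_norml; lra.
Qed.

Lemma increment_count_lat m y z :
  increment nu (fun x => N x - m) (y + lat z) = increment nu (fun x => N x - m) y.
Proof. by apply: eq_Ex => x; rewrite addrA count_lat. Qed.

(** One factor of the square is bounded by twice the supremum of the count, the other by a shell
    count whose mean is of the order of the width of the shell. *)
Lemma increment_count_small m e : 0 < e ->
  exists2 t, 0 < t & forall y, enorm y <= t -> increment nu (fun x => N x - m) y <= e.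
Proof.
move=> e0; have [_ [M NM]] := bN.
have M0 : 0 <= M by apply: le_trans (NM 0).
have vb := ball_vol_gt0 R d; have cv := cell_vol_gt0 uA.
have rr : 0 <= r + r by rewrite addr_ge0 ?(ltW r0).
have MM : 0 <= M + M by rewrite addr_ge0.
pose c : R := (M + M) * (cell_vol^-1 * (d%:R * 2 * (r + r) ^+ n * ball_vol R d)) + 1.
have c0 : 0 < c.
  by rewrite ltr_wpDl// !mulr_ge0 ?invr_ge0 ?exprn_ge0 ?(ltW vb) ?(ltW cv).
(* The minimum with [r] keeps the inner radius of the shell nonnegative. *)
exists (Num.min r (e / c)) => [|y]; first by rewrite lt_min r0 divr_gt0.
set t := Num.min _ _ => yt.
have tr : t <= r by rewrite ge_min lexx.
have te : t * c <= e by rewrite -ler_pdivlMr// ge_min lexx orbT.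
have t0 : 0 <= t by exact: le_trans (enorm_ge0 y) yt.
have sB : shell (r - t) (r + t) `<=` eball d (r + t) by move=> ? [].
have mS := @measurable_shell R d (r - t) (r + t).
have bS := bmeas_count uA sB mS.
have bNy : bmeas (fun x : borel_rV R d => N ((x : 'rV[R]_d) + y)).
  by apply: (bmeas_comp
    (h := fun x : borel_rV R d => (x : 'rV[R]_d) + y : borel_rV R d)) bN; exact: measurable_shift.
apply: (@le_trans _ _ (Ex nu (fun x => (M + M) * count A (shell (r - t) (r + t)) x))).
  apply: le_Ex.
  - apply: (bmeasX 2 (f := fun x : borel_rV R d => (N x - m) - (N ((x : 'rV[R]_d) + y) - m))).
    by apply: bmeasB; apply: bmeasB => //; exact: bmeas_cst.
  - exact: bmeasZ.
  move=> x; have H := count_shift x yt.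
  have -> : (N x - m - (N ((x : 'rV[R]_d) + y) - m)) = N x - N ((x : 'rV[R]_d) + y) by ring.
  rewrite -real_normK ?num_real// expr2 ler_pM//.
  by rewrite (le_trans (ler_normB _ _))// lerD.
rewrite ExZ//.
have ES := Ex_count uA sB mS nuE.
have rt : 0 <= r - t by lra.
have H := @leb_shell R d (r - t) (r + t) rt ltac:(lra).
have {}H : Ex nu (count A (shell (r - t) (r + t))) <=
    cell_vol^-1 * (d%:R * (r + t - (r - t)) * (r + t) ^+ n * ball_vol R d).
  rewrite -lee_fin [leLHS]ES EFinM; apply: lee_wpmul2l H.
  by rewrite lee_fin invr_ge0 ltW.
have H2 : cell_vol^-1 * (d%:R * (r + t - (r - t)) * (r + t) ^+ n * ball_vol R d) <=
   t * (cell_vol^-1 * (d%:R * 2 * (r + r) ^+ n * ball_vol R d)).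
  rewrite [leRHS]mulrCA ler_wpM2l ?invr_ge0 ?(ltW cv)//.
  rewrite !mulrA ler_wpM2r ?(ltW vb)//.
  have -> : d%:R * (r + t - (r - t)) = t * d%:R * 2 by ring.
  by rewrite ler_wpM2l ?mulr_ge0// lerXn2r ?nnegrE ?lerD2l//; lra.
apply: le_trans te; rewrite /c mulrDr mulr1 mulrCA -[leLHS]addr0.
by apply: lerD => //; rewrite ler_wpM2l ?addr_ge0//; exact: le_trans H2.
Qed.

(** Reduce [t] modulo 1, use the symmetry about one half, and compare with the value at [h] through
    strict monotonicity of the cosine on [[0, pi]]. *)
Lemma cos_near_int (h : R) : 0 < h -> exists2 e : R, 0 < e &
  forall t : R, 1 - cos (pi *+ 2 * t) < e -> exists z : int, `|t - z%:~R| <= h.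
Proof.
wlog h2 : h / h <= 2^-1.
  move=> H h0; have [||e e0 He] := H (Num.min h 2^-1).
  - by rewrite ge_min lexx orbT.
  - by rewrite lt_min h0 /= invr_gt0 ltr0n.
  exists e => // t /He[z zt]; exists z; apply: le_trans zt _.
  by rewrite ge_min lexx.
move=> h0; have pi0 := @pi_gt0 R.
have lt_cos (s : R) : h < s -> s <= 2^-1 -> cos (pi *+ 2 * s) < cos (pi *+ 2 * h).
  by move=> hs s2; rewrite ltr_cos ?in_itv/= ?ltr_pM2l ?mulr2n//; nra.
exists (1 - cos (pi *+ 2 * h)) => [|t].
  rewrite subr_gt0 -[ltRHS]cos0 ltr_cos ?in_itv/= ?mulr2n//; nra.
pose s := t - (Num.floor t)%:~R.
have s0 : 0 <= s by rewrite subr_ge0 ge_floor.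
have s1 : s < 1 by have := floorD1_gt t; rewrite intrD /s; lra.
have -> : cos (pi *+ 2 * t) = cos (pi *+ 2 * s).
  rewrite -[t](subrK (Num.floor t)%:~R) mulrDr.
  exact: (periodicz (@cosD2pi R)).
have [sh|hs] := leP s h.
  by move=> _; exists (Num.floor t); rewrite ger0_norm.
have [s2|s2] := leP s 2^-1; first by have := lt_cos _ hs s2; lra.
have [hs1|hs1] := ltP h (1 - s); last first.
  by move=> _; exists (Num.floor t + 1); rewrite intrD -/s ler0_norm; move: s1 hs1; rewrite /s; lra.
have := lt_cos _ hs1 ltac:(lra).
have -> : pi *+ 2 * (1 - s) = - (pi *+ 2 * s) + pi *+ 2 by ring.
by rewrite cosD2pi cosN; lra.
Qed.

Lemma near_lattice t : 0 < t -> exists2 e, 0 < e & forall y,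
  \sum_j (1 - cos (phase B (@unit_freq d j) y)) < e -> exists z, enorm (y - lat z) <= t.
Proof.
move=> t0; pose a := \sum_(j < d) \sum_i `|A i j|.
have a0 : 0 <= a by apply: sumr_ge0 => j _; apply: sumr_ge0.
have [|e e0 He] := @cos_near_int (t / (1 + a)); first by rewrite divr_gt0// ltr_pwDl.
exists e => // y ye.
have /choice[z zP] j : exists z : int, `|(y *m B) 0 j - z%:~R| <= t / (1 + a).
  apply: He; apply: le_lt_trans ye.
  have -> : pi *+ 2 * (y *m B) 0 j = phase B (@unit_freq d j) y.
    rewrite /phase (bigD1 j)//= /unit_freq eqxx mul1r big1 ?addr0// => i /negbTE ->.
    by rewrite mul0r.
  rewrite [leRHS](bigD1 j)//= lerDl; apply: sumr_ge0 => i _.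
  by rewrite subr_ge0 cos_le1.
exists [ffun j => z j].
apply: le_trans (enorm_le_sum _) _.
apply: (@le_trans _ _ (\sum_(j < d) \sum_i t / (1 + a) * `|A i j|)).
  apply: ler_sum => j _; rewrite -[y](mulmxKV uA) -mulmxBl mxE.
  apply: le_trans (ler_norm_sum _ _ _) _; apply: ler_sum => i _.
  rewrite normrM ler_wpM2r//; move: (y *m B) (zP i) => w wi.
  by rewrite !mxE ffunE.
under eq_bigr do rewrite -mulr_sumr.
by rewrite -mulr_sumr -/a mulrAC ler_pdivrMr ?ltr_pwDl// ler_wpM2l ?(ltW t0)//; lra.
Qed.

(** Near a lattice point the increment is at most [e] by periodicity. Elsewhere the sum is at least
    [h], and the factor [M / h] makes it exceed the global bound [M]. *)
Lemma increment_count m e : 0 < e -> exists2 C, 0 <= C & forall y,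
  increment nu (fun x => N x - m) y <= e + C * \sum_j (1 - cos (phase B (@unit_freq d j) y)).
Proof.
move=> e0; have bNm : bmeas (fun x : borel_rV R d => N x - m).
  by apply: bmeasB => //; exact: bmeas_cst.
have [_ [M NM]] := bmeas_increment nu bNm.
have M0 : 0 <= M by apply: le_trans (NM 0).
have [t t0 ht] := increment_count_small m e0.
have [h h0 near] := near_lattice t0.
exists (M / h) => [|y]; first by rewrite divr_ge0// ltW.
set s := \sum_j _.
have s0 : 0 <= s by apply: sumr_ge0 => j _; rewrite subr_ge0 cos_le1.
have [/near[z zt]|hs] := ltP s h.
  rewrite -[y](subrK (lat z)) increment_count_lat.
  by apply: le_trans (ht _ zt) _; rewrite lerDl mulr_ge0// divr_ge0// ltW.
apply: (@le_trans _ _ M); first by have := NM y; rewrite ler_norml => /andP[].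
rewrite -[leLHS]add0r lerD ?(ltW e0)// mulrAC ler_pdivlMr// ler_wpM2l//.
Qed.

End ball.

Lemma variance_count : exists C r1 : R, [/\ 0 <= C, 0 < r1 & forall r, r1 <= r ->
  Ex nu (fun x => (count A (eball d r) x - Ex nu (count A (eball d r))) ^+ 2) <= C * r ^+ n].
Proof.
have uB : B \in unitmx by rewrite unitmx_inv.
have [c c0 cP] := enorm_freq_ge; have [D D0 DP] := bessel_decay R n.
have vb := ball_vol_gt0 R n; have cv := cell_vol_gt0 uA.
pose h := (cell_vol^-1 * ball_vol R n) ^+ 2 * (D * c ^- d.+1).
have h0 : 0 <= h by rewrite mulr_ge0 ?sqr_ge0// mulr_ge0// invr_ge0 exprn_ge0// ltW.
(* From radius [c^-1] on, [r * enorm (freq k)] is at least 1 for every nonzero [k], the range where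
   [bessel_decay] applies. *)
exists (h * lattice_const R d), c^-1; split.
- by rewrite mulr_ge0// ltW// lattice_const_gt0.
- by rewrite invr_gt0.
move=> r rc; have r0 : 0 < r by apply: lt_le_trans rc; rewrite invr_gt0.
have bN := count_bmeas r.
set m := Ex nu (count A (eball d r)).
rewrite mulrAC; apply: (@variance_le_coef _ _ B uB nu (nu_inv uA nuE)).
- by apply: bmeasB => //; exact: bmeas_cst.
- by apply: (periodic_of_lat uA) => x z; rewrite count_lat.
- by rewrite ExB ?Ex_cst ?subrr//; exact: bmeas_cst.
- by rewrite mulr_ge0// exprn_ge0// ltW.
- move=> k k0; rewrite coef2_count//.
  set s : R := (sup_norm k)%:R.
  have s1 : 1 <= s.
    rewrite ler1n lt0n; apply: contraNneq k0 => /eqP; rewrite -leqn0 => /bigmax_leqP H.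
    by apply/forallP => j; rewrite -absz_eq0 -leqn0 H.
  set x := r * enorm (freq k).
  have xs : r * (c * s) <= x by rewrite ler_wpM2l ?(ltW r0)// cP.
  have rcs : 1 <= r * (c * s).
    have : 1 <= r * c by rewrite -ler_pdivrMr// div1r.
    by move=> H; rewrite mulrA mulr_ege1.
  have x1 := le_trans rcs xs; have x0 : 0 < x by lra.
  have rcs0 : 0 < r * (c * s) by lra.
  have H : bessel n x ^+ 2 <= D * (r * (c * s)) ^- d.+1.
    apply: (@le_trans _ _ (D * x ^- d.+1)).
      by rewrite ler_pdivlMr ?exprn_gt0// mulrC DP.
    by rewrite ler_wpM2l// lef_pV2 ?posrE ?exprn_gt0// lerXn2r ?nnegrE// ltW.
  apply: (@le_trans _ _ ((cell_vol^-1 * (r ^+ d * ball_vol R n)) ^+ 2 * (D * (r * (c * s)) ^- d.+1))).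
    by rewrite (mulrA (r ^+ d)) (mulrA cell_vol^-1) [leLHS]exprMn ler_wpM2l// sqr_ge0.
  rewrite le_eqVlt; apply/predU1P; left.
  rewrite /h (@decay_scaling R d n d.+1) //; first by rewrite gt_eqF.
  by rewrite !addnS addSn.
- by move=> e e0; exact: increment_count.
Qed.

(** A volume argument: for each [x] in the cell, all points of [s] translated by [x] fall in a
    slightly wider shell. Averaging its count over [nu] gives its volume divided by that of the
    cell. *)
Lemma shell_lattice_count (c : R) : 0 <= c -> exists C r1 : R, [/\ 0 <= C, 0 < r1 &
  forall r, r1 <= r -> forall s : seq Z, uniq s ->
    (forall z, z \in s -> r - c < enorm (lat z) <= r + c) -> (size s)%:R <= C * r ^+ n].
Proof.
move=> c0; have [K K0 KP] := cell_bounded uA.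
have vb := ball_vol_gt0 R d; have cv := cell_vol_gt0 uA.
pose k := c + K; have k0 : 0 < k by rewrite ltr_wpDl.
exists (cell_vol^-1 * (d%:R * (k *+ 2) * 2 ^+ n * ball_vol R d)), k; split => //.
  by rewrite !mulr_ge0 ?invr_ge0 ?exprn_ge0 ?mulrn_wge0 ?(ltW vb) ?(ltW cv) ?(ltW k0).
move=> r kr s us ss.
have sB : shell (r - k) (r + k) `<=` eball d (r + k) by move=> ? [].
have mS := @measurable_shell R d (r - k) (r + k).
have bS := bmeas_count uA sB mS.
have mC := measurable_cell A.
have nuC : Ex nu (\1_cell) = 1.
  apply: EFin_inj; rewrite Ex_indic// nuE// setIid cell_volE// -EFinM mulVf// gt_eqF//.
apply: (@le_trans _ _ (Ex nu (count A (shell (r - k) (r + k))))).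
  rewrite -[leLHS]mulr1 -[X in _ * X <= _]nuC -ExZ; last exact: bmeas_indic.
  apply: le_Ex => //; first by apply: bmeasZ; exact: bmeas_indic.
  move=> x; rewrite indicE; have [|_] := boolP (x \in _); last first.
    by rewrite mulr0 (count_ge0 uA sB).
  rewrite in_setE mulr1 => xc; rewrite -lee_fin (countE uA sB).
  apply: (@le_trans _ _ (\esum_(z in [set: Z]) ((z \in s)%:R)%:E)%E).
    rewrite (@esum_seq _ _ s)//; last by move=> z /negbTE ->.
    rewrite lee_fin -sum1_size natr_sum big_seq [leRHS]big_seq.
    by apply: ler_sum => z ->.
  apply: le_esum => z _; rewrite lee_fin; case: (boolP (z \in s)) => // /ss /andP[z1 z2].
  rewrite indicE mem_set//; have xK := KP _ xc.
  have := enormD (lat z) x; have := enormDl (lat z) x.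
  by rewrite (addrC x) /shell /eball /= /k; split; lra.
have ES := Ex_count uA sB mS nuE.
have rk : 0 <= r - k by lra.
have H := @leb_shell R d (r - k) (r + k) rk ltac:(lra).
apply: (@le_trans _ _ (cell_vol^-1 * (d%:R * (r + k - (r - k)) * (r + k) ^+ n * ball_vol R d))).
  rewrite -lee_fin [leLHS]ES EFinM; apply: lee_wpmul2l H.
  by rewrite lee_fin invr_ge0 ltW.
rewrite -[leRHS]mulrA ler_wpM2l ?invr_ge0 ?(ltW cv)// [leRHS]mulrAC ler_wpM2r ?(ltW vb)//.
have -> : d%:R * (r + k - (r - k)) = d%:R * (k *+ 2) by ring.
rewrite -[leRHS]mulrA -exprMn ler_wpM2l ?mulr_ge0 ?mulrn_wge0 ?(ltW k0)//.
rewrite lerXn2r ?nnegrE//; last by rewrite mulr2n mulrDl !mul1r lerD2l.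
  by rewrite addr_ge0// (le_trans (ltW k0)).
by rewrite mulr_ge0// (le_trans (ltW k0)).
Qed.

End count_variance.

(** * Perturbed lattices *)

Section law.
Context d d' (T : measurableType d) (V : measurableType d') (R : realType).
Variable P : probability T R.

Lemma ex_law (f : T -> V) : measurable_fun setT f ->
  exists Q : probability V R, (forall A, measurable A -> Q A = P (f @^-1` A)) /\
    forall g, bmeas g -> Ex Q g = Ex P (g \o f).
Proof.
move=> mf; pose F : {mfun T >-> V} := mfun_Sub (mem_set mf).
exists (distribution P F); split=> // g bg; have [mg _] := bg.
apply: EFin_inj; rewrite -ExE// -ExE; last exact: bmeas_comp bg.
rewrite (integral_distribution (X := F))//; first exact/measurable_EFinP.
exact: (bmeas_integrable P (bmeas_comp mf bg)).
Qed.

End law.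

Section decouple.
Context d d' (T : measurableType d) (V : measurableType d') (R : realType).
Variable P : probability T R.
Variables (G : set (set T)) (U : T -> V).
Hypothesis mG : <<s G >> `<=` measurable.
Hypothesis mU : measurable_fun setT U.
Hypothesis indep : forall A B, <<s G >> A -> measurable B ->
  P (A `&` U @^-1` B) = (P A * P (U @^-1` B))%E.
Local Notation S := (g_sigma_algebraType G).

(* T is retyped with the coarser sigma-algebra <<s G>>, on which Q restricts P;
   there the law of (w, U w) is a product measure. *)
Lemma decouple : exists (Q : probability S R) (nu : probability V R),
  [/\ forall A, <<s G >> A -> Q A = P A,
      forall B, measurable B -> nu B = P (U @^-1` B) &
      forall f : S * V -> R, bmeas f ->
        Ex P (fun w => f (w : S, U w)) = Ex nu (fun u => Ex Q (fun w => f (w, u)))].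
Proof.
have mid : measurable_fun setT (id : T -> S).
  by move=> _ B mB; rewrite setTI; exact: mG.
have mj : measurable_fun setT (fun w : T => (w, U w) : S * V).
  by apply: (@measurable_fun_pair _ _ _ T S V (id : T -> S) U).
have [Q [QE QEx]] := ex_law P mid.
have [nu [nuE _]] := ex_law P mU.
have [J [JE JEx]] := ex_law P mj.
exists Q, nu; split => //.
move=> f bf.
rewrite -[LHS](JEx f bf) -Ex_fubini//.
apply: EFin_inj; rewrite -ExE// -Ex_product//.
(* The law [J] of the pair is determined by its values on rectangles, where independence gives the
   product. *)
apply: eq_measure_integral => A mA _; apply/esym.
apply: (@product_measure_unique _ _ _ _ _ Q nu J) => //.
move=> C D mC mD; rewrite [LHS](JE _ (measurableX mC mD)).
rewrite [X in (X * _)%E](QE _ mC) [X in (_ * X)%E](nuE _ mD).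
exact: indep.
Qed.

End decouple.

Section covariance_sum.
Context d (T : measurableType d) (R : realType) (P : probability T R).

Lemma Ex_sqr_shift (f : T -> R) (c : R) : bmeas f ->
  Ex P (fun w => (f w - c) ^+ 2) =
  (Ex P (fun w => f w * f w) - Ex P f * Ex P f) + (Ex P f - c) ^+ 2.
Proof.
move=> bf; have bff := bmeasM bf bf.
have -> : Ex P (fun w => (f w - c) ^+ 2) =
    Ex P (fun w => f w * f w - ((c + c) * f w - c * c)).
  by apply: eq_Ex => w; ring.
rewrite ExB//; last by apply: bmeasB; [exact: bmeasZ|exact: bmeas_cst].
rewrite ExB; [|exact: bmeasZ|exact: bmeas_cst].
by rewrite ExZ// Ex_cst; ring.
Qed.

Lemma Ex_sum_sqr (Z : Type) (s : seq Z) (f : Z -> T -> R) (c : R) :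
  (forall z, bmeas (f z)) ->
  Ex P (fun w => (\sum_(z <- s) f z w - c) ^+ 2) =
  \sum_(z <- s) \sum_(y <- s) (Ex P (fun w => f z w * f y w) - Ex P (f z) * Ex P (f y))
  + (\sum_(z <- s) Ex P (f z) - c) ^+ 2.
Proof.
move=> bf; rewrite Ex_sqr_shift; last exact: bmeas_sum.
rewrite Ex_sum//; congr (_ + _).
have -> : Ex P (fun w => (\sum_(z <- s) f z w) * \sum_(z <- s) f z w) =
    \sum_(z <- s) \sum_(y <- s) Ex P (fun w => f z w * f y w).
  transitivity (Ex P (fun w => \sum_(z <- s) \sum_(y <- s) f z w * f y w)).
    apply: eq_Ex => w; rewrite mulr_suml; apply: eq_bigr => z _.
    by rewrite mulr_sumr.
  rewrite Ex_sum; last by move=> z; apply: bmeas_sum => y; exact: bmeasM.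
  by apply: eq_bigr => z _; rewrite Ex_sum// => y; exact: bmeasM.
rewrite mulr_suml -sumrB; apply: eq_bigr => z _.
by rewrite mulr_sumr -sumrB.
Qed.

Lemma le_Ex_ae (C : set T) (f g : T -> R) : measurable C -> P C = 1%E ->
  bmeas f -> bmeas g -> (forall x, C x -> f x <= g x) -> Ex P f <= Ex P g.
Proof.
move=> mC PC bf bg fg.
have bC : bmeas (\1_C : T -> R) by exact: bmeas_indic.
have C1 : Ex P (\1_C) = 1 by apply: EFin_inj; rewrite Ex_indic// PC.
have [_ [M hM]] := bmeasB bg bf.
rewrite -subr_ge0 -ExB//.
(* On [C] the new integrand is 0; off [C] it is [- M], a lower bound for [g - f]. Its mean is 0
   because [C] has full measure. *)
apply: (@le_trans _ _ (Ex P (fun x => M * (\1_C x - 1)))).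
  rewrite ExZ ?ExB ?C1 ?Ex_cst ?subrr ?mulr0//; try exact: bmeas_cst.
  by apply: bmeasB => //; exact: bmeas_cst.
apply: le_Ex.
- by apply/bmeasZ/bmeasB => //; exact: bmeas_cst.
- exact: bmeasB.
move=> x; rewrite indicE; case: (boolP (x \in C)); rewrite ?in_setE => xC.
  by rewrite subrr mulr0 subr_ge0 fg.
by have := hM x; rewrite ler_norml => /andP[H _]; move: H; rewrite sub0r mulrN1.
Qed.

End covariance_sum.

(** * The lattice, its cell and the uniform law in matrix form *)

Section lattice_of_basis.
Variables (R : realType) (d : nat) (a : d.-tuple 'rV[R]_d).

Definition basis_mx : 'M[R]_d := \matrix_j tnth a j.

Lemma row_basis (u : 'rV[R]_d) : u *m basis_mx = \sum_j u 0 j *: tnth a j.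
Proof. by rewrite mulmx_sum_row; apply: eq_bigr => j _; rewrite rowK. Qed.

Lemma basis_mx_unit : basis_of fullv a -> basis_mx \in unitmx.
Proof.
move=> /basis_free/freeP fa; rewrite -row_free_unit; apply: inj_row_free => v.
rewrite row_basis => v0; apply/rowP => j; rewrite mxE; apply: (fa (v 0)).
by rewrite -[RHS]v0; apply: eq_bigr => i _; rewrite (tnth_nth 0).
Qed.

End lattice_of_basis.

Section lattice_of_basis_succ.
Variables (R : realType) (n : nat) (a : n.+1.-tuple 'rV[R]_n.+1).
Local Notation d := n.+1.
Hypothesis a_basis : basis_of fullv a.
Local Notation A := (basis_mx a).
Local Notation Z := {ffun 'I_d -> int}.
Let uA := basis_mx_unit a_basis.

Lemma lat_sum (z : Z) : lat A z = \sum_j (z j)%:~R *: tnth a j.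
Proof. by rewrite /lat row_basis; apply: eq_bigr => j _; rewrite mxE. Qed.

Lemma lattice_lat_in (z : Z) : lattice a (lat A z).
Proof. by exists z => //; rewrite lat_sum. Qed.

Lemma lattice_bij : set_bij [set: Z] (lattice a) (lat A).
Proof.
split => [z _|z y _ _ zy|_ [z _ <-]]; first exact: lattice_lat_in.
  have : lat A z *m invmx A = lat A y *m invmx A by rewrite zy.
  rewrite !latB// => /rowP E; apply/ffunP => j.
  by have := E j; rewrite !mxE => /intr_inj.
exists [ffun j => z j] => //; rewrite lat_sum.
by apply: eq_bigr => j _; rewrite ffunE.
Qed.

Lemma fundamental_domain_cell : fundamental_domain a = cell A.
Proof.
apply/seteqP; split => [_ [t t01 <-]|x xc].
  move=> j; rewrite (_ : \sum_(i < d) t i *: tnth a i = (\row_i t i) *m A).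
    by rewrite mulmxK// mxE; exact: t01.
  by rewrite row_basis; apply: eq_bigr => i _; rewrite mxE.
exists (fun j => (x *m invmx A) 0 j) => //=.
by rewrite -row_basis mulmxKV.
Qed.

Lemma uniform_cell (dT : measure_display) (T : measurableType dT)
    (P : probability T R) (U : T -> borel_rV R d) :
  uniform_on P U (fundamental_domain a) -> forall C, measurable C ->
  P (U @^-1` C) = ((cell_vol A)^-1%:E * leb R d (C `&` cell A))%E.
Proof.
move=> UU C mC; rewrite UU// fundamental_domain_cell.
have mD := measurable_cell A.
rewrite -!lebE//; last exact: measurableI.
by rewrite cell_volE// inver gt_eqF ?cell_vol_gt0// muleC.
Qed.

End lattice_of_basis_succ.

(** * One-point consequences of mixing and stationarity *)

Section mixing.
Variables (R : realType) (d : nat) (dT : measure_display) (T : measurableType dT).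
Variables (P : probability T R) (L : set 'rV[R]_d) (p : 'rV[R]_d -> T -> borel_rV R d).

Lemma sigma_field_preimage (C : set 'rV[R]_d) i (B : set (borel_rV R d)) : C i ->
  measurable B -> sigma_field p C (p i @^-1` B).
Proof.
move=> Ci mB; apply: sub_sigma_algebra; exists i => //.
by exists B => //; rewrite setTI.
Qed.

Lemma set_dist1 (i j : 'rV[R]_d) : set_dist [set i] [set j] = (enorm (i - j))%:E.
Proof.
rewrite /set_dist (_ : [set _ | _ in _ & _ in _] = [set (enorm (i - j))%:E]) ?ereal_inf1//.
apply/seteqP; split => [_ [_ -> [_ -> <-]]//|_ ->].
by exists i => //; exists j.
Qed.

Lemma alpha11_ge i j E F : L i -> L j ->
  sigma_field p [set i] E -> sigma_field p [set j] F ->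
  (`|P (E `&` F) - P E * P F| <= alpha11 P L p (enorm (i - j)))%E.
Proof.
move=> Li Lj iE jF.
apply: (@le_trans _ _ (strong_mixing P (sigma_field p [set i]) (sigma_field p [set j]))).
  by apply: ereal_sup_ubound; exists E => //; exists F.
apply: ereal_sup_ubound => /=; exists [set i], [set j]; split=> //; split.
- by move=> _ ->.
- by move=> _ ->.
- by have /card_eqPle[] := @card_set1 'rV[R]_d i.
- by have /card_eqPle[] := @card_set1 'rV[R]_d j.
- by rewrite set_dist1.
Qed.

Lemma alpha11_ge0 i : L i -> L 0 -> (0 <= alpha11 P L p (enorm i))%E.
Proof.
move=> Li lattice0; have := @alpha11_ge i 0 set0 set0 Li lattice0 (@sigma_algebra0 _ _ _) (@sigma_algebra0 _ _ _).
by rewrite subr0; apply: le_trans; exact: abse_ge0.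
Qed.

Lemma stationary_law : strictly_stationary P L p -> L 0 -> forall i B, L i -> measurable B ->
  P (p i @^-1` B) = P (p 0 @^-1` B).
Proof.
move=> stat lattice0 i B Li mB.
have := stat [set 0] i (fun _ e => ltac:(by rewrite e)) Li [set x | B (x 0)].
rewrite /= add0r => ->//.
apply: sub_sigma_algebra; exists 0 => //.
by exists B => //; rewrite setTI.
Qed.

End mixing.

Section variance.
Context d (T : measurableType d) (R : realType) (P : probability T R).

Lemma expectation_ae (f g : T -> R) : measurable_fun setT f -> bmeas g ->
  {ae P, forall w, f w = g w} -> ('E_P[f] = (Ex P g)%:E)%E.
Proof.
move=> mf bg fg; have [mg _] := bg.
rewrite unlock -ExE//; apply: ae_eq_integral => //; try exact/measurable_EFinP.
by apply: filterS fg => w /= -> _.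
Qed.

(** The centre [c] is free, so the mean of the point count need not be computed. *)
Lemma variance_le (f g : T -> R) (c : R) : measurable_fun setT f -> bmeas g ->
  {ae P, forall w, f w = g w} -> ('V_P[f] <= (Ex P (fun w => (g w - c) ^+ 2))%:E)%E.
Proof.
move=> mf bg fg.
have Ef := expectation_ae mf bg fg.
rewrite /variance unlock Ef /=.
have bgE : bmeas (fun w => (g w - Ex P g) * (g w - Ex P g)).
  by apply: bmeasM; apply: bmeasB => //; exact: bmeas_cst.
rewrite (@expectation_ae _ (fun w => (g w - Ex P g) * (g w - Ex P g)))//.
- rewrite lee_fin (_ : Ex P _ = Ex P (fun w => (g w - Ex P g) ^+ 2)).
    by rewrite !Ex_sqr_shift// lerD2l subrr expr0n sqr_ge0.
  by apply: eq_Ex => w; rewrite expr2.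
- by apply: measurable_funM; apply: measurable_funB.
- by apply: filterS fg => w fgw; rewrite -[LHS]/((f w - Ex P g) * (f w - Ex P g)) fgw.
Qed.

End variance.

Section measurable_vector.
Context dT (T : measurableType dT) (R : realType) (d : nat).

Lemma measurable_addV (f g : T -> borel_rV R d) :
  measurable_fun setT f -> measurable_fun setT g ->
  measurable_fun setT (fun w => (f w : 'rV[R]_d) + g w : borel_rV R d).
Proof.
move=> mf mg; apply: measurable_rV => j; under eq_fun do rewrite mxE.
by apply: measurable_funD; [exact: (measurableT_comp (measurable_coord j) mf)|
  exact: (measurableT_comp (measurable_coord j) mg)].
Qed.

(* Replacing p_i by its truncation changes Xi on a null set only, and leaves
   bounds that hold for every sample point. *)
Definition trunc (M : R) (x : 'rV[R]_d) : 'rV[R]_d := \1_(eball d M) x *: x.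

Lemma measurable_trunc M : measurable_fun setT (trunc M : borel_rV R d -> borel_rV R d).
Proof.
apply: measurable_rV => j; under eq_fun do rewrite mxE.
apply: measurable_funM; last exact: measurable_coord.
exact: (measurable_indic (@measurable_eball R d M)).
Qed.

Lemma trunc_le M x : 0 <= M -> enorm (trunc M x) <= M.
Proof.
move=> M0; rewrite /trunc indicE; have [|_] := boolP (x \in _).
  by rewrite in_setE scale1r.
by rewrite scale0r enorm0.
Qed.

Lemma trunc_id M x : enorm x <= M -> trunc M x = x.
Proof. by move=> xM; rewrite /trunc indicE mem_set// scale1r. Qed.

End measurable_vector.

Lemma fine_cov_le (R : realType) (e x y b : R) (E X Y : \bar R) :
  e%:E = E -> x%:E = X -> y%:E = Y -> (`|E - X * Y| <= b%:E)%E -> e - x * y <= b.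
Proof.
by move=> <- <- <-; rewrite -EFinM -EFinB lee_fin => /(le_trans (ler_norm _)).
Qed.

(** * Hyperuniformity of the perturbed lattice *)

Section perturbed.
Variables (R : realType) (n : nat) (a : n.+1.-tuple 'rV[R]_n.+1).
Local Notation d := n.+1.
Hypothesis a_basis : basis_of fullv a.
Variables (dT : measure_display) (T : measurableType dT) (P : probability T R).
Variables (p : 'rV[R]_d -> T -> borel_rV R d) (U : T -> borel_rV R d).
Local Notation L := (lattice a).
Hypothesis p_meas : forall i, L i -> measurable_fun [set: T] (p i).
Hypothesis p_stat : strictly_stationary P L p.
Variable M : R.
Hypothesis M0 : 0 <= M.
Hypothesis pM : {ae P, forall w, enorm (p 0 w) <= M}.
Hypothesis U_meas : measurable_fun [set: T] U.
Hypothesis U_unif : uniform_on P U (fundamental_domain a).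
Hypothesis U_indep : independent_fields P (sigma_field p L) (g_sigma_algebra_preimage U).
Hypothesis p_mixing : (\esum_(i in L) alpha11 P L p (enorm i) < +oo)%E.
Local Notation A := (basis_mx a).
Local Notation Z := {ffun 'I_d -> int}.
Local Notation lat := (lat A).
Local Notation cell := (cell A).
Local Notation G := (\bigcup_(i in L) preimage_set_system [set: T] (p i) measurable).
Local Notation S := (g_sigma_algebraType G).
Let uA : A \in unitmx := basis_mx_unit a_basis.

Lemma lat0 : lat 0 = 0.
Proof. by rewrite -(subrr (0 : Z)) latD latN subrr. Qed.

Lemma lat_sub z y : lat (z - y) = lat z - lat y.
Proof. by rewrite latD latN. Qed.

Lemma lattice0 : L 0. Proof. by rewrite -lat0; exact: lattice_lat_in. Qed.

Definition alpha_lat (z : Z) : R := fine (alpha11 P L p (enorm (lat z))).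
Definition alpha_sum : R := fine (\esum_(i in L) alpha11 P L p (enorm i))%E.

Lemma esum_alpha :
  (\esum_(i in L) alpha11 P L p (enorm i) = \esum_(z in [set: Z]) alpha11 P L p (enorm (lat z)))%E.
Proof. exact: reindex_esum (lattice_bij a_basis). Qed.

Lemma alpha_latE z : alpha11 P L p (enorm (lat z)) = (alpha_lat z)%:E.
Proof.
have a0 y : (0 <= alpha11 P L p (enorm (lat y)))%E.
  by apply: alpha11_ge0 => //; [exact: lattice_lat_in|exact: lattice0].
rewrite fineK// ge0_fin_numE//.
apply: le_lt_trans p_mixing; rewrite esum_alpha.
rewrite -(@esum_set1 _ _ z (fun z => alpha11 P L p (enorm (lat z))))//.
by rewrite esum_mkcond; apply: le_esum => y _; case: ifP.
Qed.

Lemma alpha_lat_ge0 z : 0 <= alpha_lat z.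
Proof.
rewrite -lee_fin -alpha_latE.
by apply: alpha11_ge0 => //; [exact: lattice_lat_in|exact: lattice0].
Qed.

Lemma alpha_sumE : ((alpha_sum)%:E = \esum_(z in [set: Z]) (alpha_lat z)%:E)%E.
Proof.
rewrite /alpha_sum fineK esum_alpha; first by apply: eq_esum => z _; rewrite alpha_latE.
rewrite -esum_alpha ge0_fin_numE// esum_alpha esum_ge0// => z _.
by rewrite alpha_latE lee_fin alpha_lat_ge0.
Qed.

(** The map [y] to [z - y] is injective, so the terms are distinct terms of the full mixing series,
    whatever [z] is. *)
Lemma sum_alpha_lat_le (s : seq Z) (z : Z) : uniq s -> \sum_(y <- s) alpha_lat (z - y) <= alpha_sum.
Proof.
move=> us; have um : uniq (map (fun y => z - y) s).
  by rewrite map_inj_uniq// => x y /addrI/oppr_inj.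
rewrite -(big_map (fun y => z - y) xpredT alpha_lat) -lee_fin alpha_sumE.
pose f y := (y \in map (fun y => z - y) s)%:R * alpha_lat y.
rewrite (_ : \sum_(i <- _) _ = \sum_(i <- map (fun y => z - y) s) f i); last first.
  by rewrite big_seq [RHS]big_seq; apply: eq_bigr => y ys; rewrite /f ys mul1r.
rewrite -(@esum_seq _ _ _ f um).
- apply: le_esum => y _; rewrite lee_fin /f; case: (_ \in _); rewrite ?mul1r ?mul0r//.
  exact: alpha_lat_ge0.
- by move=> y; rewrite mulr_ge0// alpha_lat_ge0.
- by move=> y /negbTE; rewrite /f => ->; rewrite mul0r.
Qed.

Lemma alpha_sum_ge0 : 0 <= alpha_sum.
Proof. by have := @sum_alpha_lat_le [::] 0 isT; rewrite big_nil. Qed.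

Lemma sigma_field_sub : <<s G >> `<=` @measurable _ T.
Proof.
apply: smallest_sub; first exact: sigma_algebra_measurable.
by move=> _ [i Li [B mB <-]]; exact: p_meas.
Qed.

Lemma measurable_p z : measurable_fun setT (p (lat z) : S -> borel_rV R d).
Proof.
move=> _ B mB; rewrite setTI; apply: sigma_field_preimage => //.
exact: lattice_lat_in.
Qed.

Definition hit (r : R) (z : Z) (w : T) (u : 'rV[R]_d) : R :=
  \1_(eball d r) (lat z + trunc M (p (lat z) w) + u).

(** For frozen [u], a hit is an event about the single vector [p (lat z)], as the mixing coefficient
    requires. *)
Definition target r z (u : 'rV[R]_d) : set (borel_rV R d) :=
  [set x | eball d r (lat z + trunc M (x : 'rV[R]_d) + u)].

Lemma measurable_target r z u : measurable (target r z u).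
Proof.
rewrite -[X in measurable X]setTI.
have := @measurable_eball R d r; apply: (_ : measurable_fun setT
   (fun x : borel_rV R d => lat z + trunc M (x : 'rV[R]_d) + u : borel_rV R d)) => //.
apply: measurable_addV; last exact: measurable_cst.
by apply: measurable_addV; [exact: measurable_cst|exact: measurable_trunc].
Qed.

Lemma hitE r z w u : hit r z w u = \1_(p (lat z) @^-1` target r z u) w.
Proof. by []. Qed.

Lemma bmeas_hit r z : bmeas (fun x : S * borel_rV R d => hit r z x.1 x.2).
Proof.
have bB : bmeas (\1_(eball d r) : borel_rV R d -> R) :=
  bmeas_indic R (@measurable_eball R d r).
apply: (bmeas_comp (h := fun x : S * borel_rV R d =>
  lat z + trunc M (p (lat z) x.1) + x.2 : borel_rV R d)) bB.
apply: measurable_addV; last exact: measurable_snd.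
apply: measurable_addV; first exact: measurable_cst.
apply: (measurableT_comp (@measurable_trunc R d M)).
by apply: (measurableT_comp (measurable_p z)); exact: measurable_fst.
Qed.

Section decoupled.
Variables (Q : probability S R) (nu : probability (borel_rV R d) R).
Hypothesis QE : forall E, <<s G >> E -> Q E = P E.
Hypothesis nuU : forall B, measurable B -> nu B = P (U @^-1` B).
Hypothesis decoupled : forall f : S * borel_rV R d -> R, bmeas f ->
  Ex P (fun w => f (w : S, U w)) = Ex nu (fun u => Ex Q (fun w => f (w, u))).

Lemma nuE C : measurable C -> nu C = ((cell_vol A)^-1%:E * leb R d (C `&` cell))%E.
Proof. by move=> mC; rewrite [LHS]nuU// (uniform_cell a_basis U_unif). Qed.

Lemma nu_cell : nu cell = 1%E.
Proof.
have cv := cell_vol_gt0 uA.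
rewrite [LHS](nuE (measurable_cell A)) setIid cell_volE//.
by rewrite -EFinM mulVf// gt_eqF.
Qed.

Lemma bmeas_hit1 r z u : bmeas (fun w : S => hit r z w u).
Proof. exact: (bmeas_pair2 (bmeas_hit r z) u). Qed.

Lemma sigma_hit r z u : sigma_field p [set lat z] (p (lat z) @^-1` target r z u).
Proof. by apply: sigma_field_preimage => //; exact: measurable_target. Qed.

Lemma sigma_hitL r z u : <<s G >> (p (lat z) @^-1` target r z u).
Proof.
apply: sigma_field_preimage; [exact: lattice_lat_in|exact: measurable_target].
Qed.

Lemma Ex_hit r z u :
  ((Ex Q (fun w => hit r z w u))%:E = P (p (lat z) @^-1` target r z u))%E.
Proof.
have mE : measurable (p (lat z) @^-1` target r z u : set S) := sigma_hitL r z u.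
by rewrite -(QE mE); exact: (Ex_indic Q mE).
Qed.

Lemma cov_hit_le r z y u :
  Ex Q (fun w => hit r z w u * hit r y w u) -
    Ex Q (fun w => hit r z w u) * Ex Q (fun w => hit r y w u) <= alpha_lat (z - y).
Proof.
have H : ((Ex Q (fun w => hit r z w u * hit r y w u))%:E =
    P ((p (lat z) @^-1` target r z u) `&` (p (lat y) @^-1` target r y u)))%E.
  have mI : measurable ((p (lat z) @^-1` target r z u) `&` (p (lat y) @^-1` target r y u) : set S).
    by apply: measurableI; exact: sigma_hitL.
  rewrite -(QE mI) -(Ex_indic Q mI); congr EFin; apply: eq_Ex => w.
  by rewrite !hitE indicI.
apply: (fine_cov_le H (Ex_hit r z u) (Ex_hit r y u)); rewrite -alpha_latE lat_sub.
by apply: alpha11_ge; [exact: lattice_lat_in..|exact: sigma_hit|exact: sigma_hit].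
Qed.

Lemma cov_hit_cst r z y u (k : R) : (forall w, hit r z w u = k) ->
  Ex Q (fun w => hit r z w u * hit r y w u) -
    Ex Q (fun w => hit r z w u) * Ex Q (fun w => hit r y w u) = 0.
Proof.
move=> hk.
have -> : Ex Q (fun w => hit r z w u) = k by rewrite -(Ex_cst Q k); exact: eq_Ex.
rewrite -ExZ ?subrr//; last exact: bmeas_hit1.
by apply/eqP; rewrite subr_eq0; apply/eqP/eq_Ex => w; rewrite hk.
Qed.

Variable m : R.
Hypothesis m0 : 0 < m.
Hypothesis cell_m : forall x, cell x -> enorm x <= m.

Lemma hit_inside r z w u : cell u -> enorm (lat z) <= r - (M + m) -> hit r z w u = 1.
Proof.
move=> /cell_m um zr; rewrite /hit indicE mem_set//.
have := enormD (lat z + trunc M (p (lat z) w)) u.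
have := enormD (lat z) (trunc M (p (lat z) w)).
have := @trunc_le R d M (p (lat z) w) M0.
by rewrite /eball/=; lra.
Qed.

Lemma hit_outside r z w u : cell u -> r + (M + m) < enorm (lat z) -> hit r z w u = 0.
Proof.
move=> /cell_m um zr; rewrite /hit indicE memNset//.
have := enormDl (lat z + trunc M (p (lat z) w)) u.
have := enormDl (lat z) (trunc M (p (lat z) w)).
have := @trunc_le R d M (p (lat z) w) M0.
by rewrite /eball/=; lra.
Qed.

(** Only [z] is confined to the shell: off the shell its indicator is constant and the whole row
    vanishes. In the shell the row over all [y] is bounded by the mixing series. *)
Lemma sum_cov_le r (s : seq Z) (u : 'rV[R]_d) : uniq s -> cell u ->
  \sum_(z <- s) \sum_(y <- s) (Ex Q (fun w => hit r z w u * hit r y w u) -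
    Ex Q (fun w => hit r z w u) * Ex Q (fun w => hit r y w u)) <=
  (size [seq z <- s | r - (M + m) < enorm (lat z) <= r + (M + m)])%:R * alpha_sum.
Proof.
move=> us uc; rewrite size_filter -sum1_count natr_sum mulr_suml [leRHS]big_mkcond/=.
apply: ler_sum => z _; case: ifPn => [_|].
  rewrite mul1r; apply: le_trans (sum_alpha_lat_le z us).
  by apply: ler_sum => y _; exact: cov_hit_le.
rewrite negb_and -leNgt -ltNge => /orP[zr|zr]; rewrite big1// => y _.
  by apply: (@cov_hit_cst _ _ _ _ 1) => w; exact: hit_inside.
by apply: (@cov_hit_cst _ _ _ _ 0) => w; exact: hit_outside.
Qed.

Lemma Ex_hit_stationary r z u :
  Ex Q (fun w => hit r z w u) = Ex P (fun w => \1_(eball d r) (lat z + trunc M (p 0 w) + u)).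
Proof.
apply: EFin_inj; rewrite Ex_hit.
rewrite (stationary_law p_stat lattice0 (lattice_lat_in a z) (measurable_target r z u)).
have mE : measurable (p 0 @^-1` target r z u).
  by rewrite -[X in measurable X]setTI; apply: (p_meas lattice0) => //; exact: measurable_target.
by rewrite -(Ex_indic P mE).
Qed.

Lemma count_hits r (s : seq Z) (v u : 'rV[R]_d) : uniq s -> cell u ->
  (forall z, enorm (lat z) <= r + (M + m) -> z \in s) -> enorm v <= M ->
  count A (eball d r) (u + v) = \sum_(z <- s) \1_(eball d r) (lat z + v + u).
Proof.
move=> us uc sP vM; apply: EFin_inj; rewrite (countE uA (@subset_refl _ (eball d r))).
rewrite -(@esum_seq _ _ s)//.
  by apply: eq_esum => z _; rewrite (addrC u) (addrC (v + u)) addrA.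
move=> z zs; rewrite indicE memNset//; apply: contraNnot zs => zr.
apply: sP; have um := cell_m uc.
have := enormDl (lat z + v) u; have := enormDl (lat z) v.
by move: zr; rewrite /eball/=; lra.
Qed.

Lemma measurable_p0 : measurable_fun setT (fun w => trunc M (p 0 w) : borel_rV R d).
Proof. exact: (measurableT_comp (@measurable_trunc R d M) (p_meas lattice0)). Qed.

Lemma bmeas_count_shift r c : bmeas (fun x : T * borel_rV R d =>
  (count A (eball d r) ((x.2 : 'rV[R]_d) + trunc M (p 0 x.1)) - c) ^+ 2).
Proof.
have bN := count_bmeas uA r.
have bNc : bmeas (fun x : borel_rV R d => (count A (eball d r) x - c) ^+ 2).
  by apply: bmeasX; apply: bmeasB => //; exact: bmeas_cst.
apply: (bmeas_comp (h := fun x : T * borel_rV R d =>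
  (x.2 : 'rV[R]_d) + trunc M (p 0 x.1) : borel_rV R d)) bNc.
apply: measurable_addV; first exact: measurable_snd.
by apply: (measurableT_comp measurable_p0); exact: measurable_fst.
Qed.

(** A mean depends on the one-point laws only, so all displacements may be replaced by the common
    displacement [p 0]; the sum of hits then becomes a shifted lattice count. *)
Lemma sum_Ex_hit r (s : seq Z) (u : 'rV[R]_d) : uniq s -> cell u ->
  (forall z, enorm (lat z) <= r + (M + m) -> z \in s) ->
  \sum_(z <- s) Ex Q (fun w => hit r z w u) =
  Ex P (fun w => count A (eball d r) (u + trunc M (p 0 w))).
Proof.
move=> us uc sP; under eq_bigr do rewrite Ex_hit_stationary.
rewrite -Ex_sum => [|z]; last first.
  have bB : bmeas (\1_(eball d r) : borel_rV R d -> R) :=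
    bmeas_indic R (@measurable_eball R d r).
  apply: (bmeas_comp (h := fun w => lat z + trunc M (p 0 w) + u : borel_rV R d)) bB.
  apply: measurable_addV; last exact: measurable_cst.
  by apply: measurable_addV; [exact: measurable_cst|exact: measurable_p0].
apply: eq_Ex => w; rewrite (count_hits us uc sP)//.
exact: trunc_le.
Qed.

(** For each fixed displacement, invariance of [nu] absorbs the shift of the periodic count. *)
Lemma Ex_count_shift r c :
  Ex nu (fun u => Ex P (fun w =>
    (count A (eball d r) ((u : 'rV[R]_d) + trunc M (p 0 w)) - c) ^+ 2)) =
  Ex nu (fun u => (count A (eball d r) u - c) ^+ 2).
Proof.
have bN := count_bmeas uA r.
rewrite -(Ex_fubini P nu (bmeas_count_shift r c))/=.
rewrite -[RHS](Ex_cst P); apply: eq_Ex => w.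
apply: (nu_inv uA nuE (f := fun u => (count A (eball d r) u - c) ^+ 2)).
  by apply: bmeasX; apply: bmeasB => //; exact: bmeas_cst.
by apply: (periodic_of_lat uA) => x z; rewrite count_lat.
Qed.

(** [C2 * alpha_sum] bounds the conditional variance given [U], by the shell count, and [C1] the
    fluctuation of the conditional mean, by [variance_count]. *)
Lemma variance_hits : exists K r1 : R, [/\ 0 <= K, 0 < r1 & forall r, r1 <= r ->
  forall s : seq Z, uniq s -> (forall z, enorm (lat z) <= r + (M + m) -> z \in s) ->
  exists c, Ex P (fun w => (\sum_(z <- s) hit r z w (U w) - c) ^+ 2) <= K * r ^+ n].
Proof.
have [C1 [r1 [C10 r10 var]]] := variance_count uA nuE.
have Mm : 0 <= M + m by rewrite addr_ge0// ltW.
have [C2 [r2 [C20 r20 shl]]] := shell_lattice_count uA nuE Mm.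
have a0 := alpha_sum_ge0.
exists (C2 * alpha_sum + C1), (r1 + r2); split.
- by rewrite addr_ge0// mulr_ge0.
- exact: addr_gt0.
move=> r rr s us sP; pose c := Ex nu (count A (eball d r)); exists c.
have rr1 : r1 <= r by apply: le_trans rr; rewrite lerDl ltW.
have rr2 : r2 <= r by apply: le_trans rr; rewrite lerDr ltW.
have bf : bmeas (fun x : S * borel_rV R d => (\sum_(z <- s) hit r z x.1 x.2 - c) ^+ 2).
  apply: bmeasX; apply: bmeasB; last exact: bmeas_cst.
  by apply: bmeas_sum => z; exact: bmeas_hit.
rewrite [leLHS](decoupled bf) /=.
have bg := bmeas_count_shift r c.
have bg2 : bmeas (fun u : borel_rV R d => C2 * r ^+ n * alpha_sum +
    Ex P (fun w => (count A (eball d r) ((u : 'rV[R]_d) + trunc M (p 0 w)) - c) ^+ 2)).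
  by apply: bmeasD; [exact: bmeas_cst|exact: (bmeas_Ex2 P nu bg)].
apply: (@le_trans _ _ (Ex nu (fun u => C2 * r ^+ n * alpha_sum +
    Ex P (fun w => (count A (eball d r) ((u : 'rV[R]_d) + trunc M (p 0 w)) - c) ^+ 2)))).
  (* Both the shell estimate and the window [s] rely on [u] lying in the cell, which holds with
     [nu]-probability one. *)
  apply: (le_Ex_ae (measurable_cell A) nu_cell) => //.
    exact: (bmeas_Ex2 Q nu bf).
  move=> u uc; rewrite (Ex_sum_sqr Q s c (fun z => bmeas_hit1 r z u)); apply: lerD.
    apply: le_trans (sum_cov_le r us uc) _.
    rewrite ler_wpM2r//; apply: shl => //; first exact: filter_uniq.
    by move=> z; rewrite mem_filter => /andP[].
  rewrite (sum_Ex_hit us uc sP); apply: Ex_sqr_le.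
  have bN := count_bmeas uA r.
  apply: (bmeas_comp (h := fun w => (u : 'rV[R]_d) + trunc M (p 0 w) : borel_rV R d)) bN.
  by apply: measurable_addV; [exact: measurable_cst|exact: measurable_p0].
rewrite ExD; [|exact: bmeas_cst|exact: (bmeas_Ex2 P nu bg)].
by rewrite Ex_cst Ex_count_shift mulrDl mulrAC lerD2l var.
Qed.

End decoupled.

Lemma bounded_ae : {ae P, forall w, (forall z, enorm (p (lat z) w) <= M) /\ cell (U w)}.
Proof.
have mB := @measurable_eball R d M.
have mp i : L i -> measurable (p i @^-1` (~` eball d M)).
  move=> Li; rewrite -[X in measurable X]setTI; apply: (p_meas Li) => //.
  exact: measurableC.
have pz z : {ae P, forall w, enorm (p (lat z) w) <= M}.
  have Lz := lattice_lat_in a z.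
  suff : P.-negligible (p (lat z) @^-1` (~` eball d M)) by [].
  apply/negligibleP; first exact: (mp _ Lz).
  rewrite [LHS](stationary_law p_stat lattice0 Lz (measurableC mB)).
  by apply/negligibleP; [exact: (mp _ lattice0)|exact: pM].
have UC : {ae P, forall w, cell (U w)}.
  have mC := measurable_cell A.
  have mU : measurable (U @^-1` (~` cell)).
    by rewrite -[X in measurable X]setTI; apply: U_meas => //; exact: measurableC.
  suff : P.-negligible (U @^-1` (~` cell)) by [].
  apply/negligibleP => //.
  rewrite [LHS](uniform_cell a_basis U_unif (measurableC mC)) setICl.
  by rewrite (_ : leb R d set0 = 0%E) ?mule0//; exact: measure0.
(* The lattice is countable: [pickle_inv] turns the quantifier over [z] into one over [nat], where
   almost sure statements can be intersected. *)
have H k : {ae P, forall w, forall z : Z, pickle_inv k = Some z -> enorm (p (lat z) w) <= M}.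
  case: pickle_inv => [z|]; last by apply: aeW.
  by apply: filterS (pz z) => w zw _ [<-].
apply: filterS2 (ae_foralln H) UC => w Hw Uw; split => // z.
by apply: (Hw (pickle z)); rewrite pickleK_inv.
Qed.

Lemma perturbed_lattice_esum r w : perturbed_lattice L p U w (eball d r) =
  (\esum_(z in [set: Z]) (\1_(eball d r) (lat z + p (lat z) w + U w))%:E)%E.
Proof. exact: reindex_esum (lattice_bij a_basis). Qed.

Variable m : R.
Hypothesis m0 : 0 < m.
Hypothesis cell_m : forall x, cell x -> enorm x <= m.

Lemma perturbed_lattice_hits r (s : seq Z) w : uniq s ->
  (forall z, enorm (lat z) <= r + (M + m) -> z \in s) ->
  (forall z, enorm (p (lat z) w) <= M) -> cell (U w) ->
  perturbed_lattice L p U w (eball d r) = (\sum_(z <- s) hit r z w (U w))%:E.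
Proof.
move=> us sP pw Uw; rewrite perturbed_lattice_esum.
rewrite -(@esum_seq _ _ s (fun z => hit r z w (U w)))//.
  by apply: eq_esum => z _; rewrite /hit trunc_id.
move=> z zs; apply: (hit_outside (m := m)) => //; rewrite ltNge; apply: contra zs; exact: sP.
Qed.

Lemma ex_window r : exists2 s : seq Z, uniq s &
  forall z, enorm (lat z) <= r + (M + m) -> z \in s.
Proof.
have [s us sP] := lattice_window uA (r + (M + m)); exists s => // z zr.
by apply: (sP 0); rewrite ?add0r// => j; rewrite mul0mx mxE lexx ltr01.
Qed.

Lemma measurable_perturbed r :
  measurable_fun setT (fun w => fine (perturbed_lattice L p U w (eball d r))).
Proof.
apply: (measurableT_comp (fine_measurable measurableT)).
under eq_fun do rewrite perturbed_lattice_esum.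
apply: measurable_esum => // z; apply/measurable_EFinP.
apply: (measurableT_comp (measurable_indic (@measurable_eball R d r))).
apply: measurable_addV => //; apply: measurable_addV; first exact: measurable_cst.
exact/p_meas/lattice_lat_in.
Qed.

Lemma bmeas_hits r (s : seq Z) : bmeas (fun w => \sum_(z <- s) hit r z w (U w)).
Proof.
apply: bmeas_sum => z; have bB : bmeas (\1_(eball d r) : borel_rV R d -> R) :=
  bmeas_indic R (@measurable_eball R d r).
apply: (bmeas_comp (h := fun w => lat z + trunc M (p (lat z) w) + U w : borel_rV R d)) bB.
apply: measurable_addV => //; apply: measurable_addV; first exact: measurable_cst.
apply: (measurableT_comp (@measurable_trunc R d M)).
exact/p_meas/lattice_lat_in.
Qed.

Lemma perturbed_hyperuniform : class_I_hyperuniform P (perturbed_lattice L p U).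
Proof.
split.
  apply: filterS bounded_ae => w [pw Uw] r; have [s us sP] := ex_window r.
  by rewrite (perturbed_lattice_hits us sP pw Uw) ltry.
have indep C D : <<s G >> C -> measurable D ->
    P (C `&` U @^-1` D) = (P C * P (U @^-1` D))%E.
  by move=> GC mD; apply: U_indep => //; exists D => //; rewrite setTI.
have [Q [nu [QE nuU dec]]] := decouple sigma_field_sub U_meas indep.
have [K [r1 [K0 r10 HK]]] := variance_hits QE nuU dec m0 cell_m.
have vb := ball_vol_gt0 R d.
exists (K / ball_vol R d), r1; split; first exact: num_real.
move=> r rr1; have r0 : 0 < r by exact: lt_trans rr1.
have [s us sP] := ex_window r.
have [c cK] := HK _ (ltW rr1) s us sP.
rewrite -lebE; last exact: measurable_eball.
rewrite [X in (_ / X)%E](leb_eball_ge0 d (ltW r0)).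
rewrite inver gt_eqF ?mulr_gt0 ?exprn_gt0//.
apply: (@le_trans _ _ ((K * r ^+ n)%:E * (r ^+ d * ball_vol R d)^-1%:E)%E).
  apply: lee_wpmul2r; first by rewrite lee_fin invr_ge0 mulr_ge0 ?exprn_ge0 ?(ltW r0) ?(ltW vb).
  apply: (@le_trans _ _ (Ex P (fun w => (\sum_(z <- s) hit r z w (U w) - c) ^+ 2))%:E).
    apply: variance_le; [exact: measurable_perturbed|exact: bmeas_hits|].
    by apply: filterS bounded_ae => w [pw Uw]; rewrite (perturbed_lattice_hits us sP pw Uw).
  by rewrite lee_fin.
(* [r ^+ n] over [r ^+ d] is [r^-1], because [d = n.+1]. *)
rewrite -EFinM lee_fin le_eqVlt; apply/predU1P; left.
rewrite exprS; field.
by rewrite !gt_eqF ?exprn_gt0.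
Qed.

End perturbed.

Theorem corollary1 (R : realType) (d : nat) (d_gt0 : (0 < d)%N)
    (a : d.-tuple 'rV[R]_d) (a_basis : basis_of fullv a)
    (dT : measure_display) (T : measurableType dT) (P : probability T R)
    (p : 'rV[R]_d -> T -> borel_rV R d) (U : T -> borel_rV R d)
    (p_meas : forall i, lattice a i -> measurable_fun [set: T] (p i))
    (p_stat : strictly_stationary P (lattice a) p)
    (p_bounded : exists M : R, {ae P, forall w, enorm (p 0 w) <= M})
    (U_meas : measurable_fun [set: T] U)
    (U_unif : uniform_on P U (fundamental_domain a))
    (U_indep : independent_fields P (sigma_field p (lattice a))
                 (g_sigma_algebra_preimage U))
    (p_mixing : (\esum_(i in lattice a) alpha11 P (lattice a) p (enorm i)
                   < +oo)%E) :
  class_I_hyperuniform P (perturbed_lattice (lattice a) p U).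
Proof.
have [M pM] := p_bounded.
case: d d_gt0 a a_basis p U p_meas p_stat pM p_bounded U_meas U_unif U_indep p_mixing => // n _ a a_basis.
move=> p U p_meas p_stat pM _ U_meas U_unif U_indep p_mixing.
have [m m0 cell_m] := cell_bounded (basis_mx_unit a_basis).
(* The norm of [M] supplies the nonnegative bound that the truncation requires. *)
apply: (@perturbed_hyperuniform _ _ a a_basis _ _ P p U p_meas p_stat `|M| _ _ _ _ _ _ m) => //.
apply: filterS pM => w /le_trans; apply; exact: ler_norm.
Qed.
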